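(* Let $M_p$ and $A_p$ be weight sequences satisfying the standing assumptions (see context) and let $B_p$ be a weight sequence satisfying $(M.1)$ and $(M.2)$ such that $A_p \subset B_p$. Let $(\ast,\dagger,\ddagger)$ be either $((M_p),(A_p),(B_p))$ (Beurling case) or $(\{M_p\},\{A_p\},\{B_p\})$ (Roumieu case). For $f \in \mathcal{S}'^{\ast}_{\dagger}(\mathbb{R}^d)$ the following statements are equivalent: (i) $f \in \mathcal{O}_C'^{\ast,\ddagger}(\mathbb{R}^d)$. (ii) $f \ast \varphi \in \mathcal{W}_{(B_p)} C(\mathbb{R}^d)$ in the Beurling case ($f \ast \varphi \in \mathcal{V}_{\{B_p\}}C(\mathbb{R}^d)$ in the Roumieu case) for all $\varphi \in \mathcal{S}^{\ast}_{\dagger}(\mathbb{R}^d)$. (iii) $f \ast \varphi \in \mathcal{S}^{\ast}_{\ddagger}(\mathbb{R}^d)$ for all $\varphi \in \mathcal{S}^{\ast}_{\dagger}(\mathbb{R}^d)$.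
   Context: Weight sequences. For a sequence $(M_p)_{p\in\mathbb{N}}$ of positive reals ($\mathbb N=\{0,1,2,\dots\}$) put $m_p := M_p/M_{p-1}$, $p\ge 1$. It is a weight sequence if $m_p\to\infty$. Write $M_\alpha=M_{|\alpha|}$ for $\alpha\in\mathbb{N}^d$. $(M.1)$: $M_p^2\le M_{p-1}M_{p+1}$, $p\ge1$. $(M.2)$: $M_{p+q}\le C_0H^{p+q}M_pM_q$ for all $p,q$, for some $C_0,H\ge1$. $M_p\subset N_p$ means there are $C,h>0$ with $M_p\le Ch^pN_p$ for all $p$; $M_p\prec N_p$ means this holds for every $h>0$ with some $C=C_h>0$. The associated function of $A_p$ is $A(t)=\sup_{p}\log(t^pA_0/A_p)$ for $t>0$, $A(0)=0$, and $A(x)=A(|x|)$ for $x\in\mathbb{R}^d$; $B$ denotes the associated function of $B_p$. Spaces. For $h>0$ and a positive continuous function $w$ on $\mathbb{R}^d$, $\mathcal{B}^{M_p,h}_w(\mathbb{R}^d)$ is the Banach space of $\varphi\in C^\infty(\mathbb{R}^d)$ with $\sup_{\alpha\in\mathbb{N}^d}\sup_{x\in\mathbb R^d}h^{|\alpha|}|\varphi^{(\alpha)}(x)|w(x)/M_\alpha<\infty$. The Gelfand-Shilov spaces are $\mathcal{S}^{(M_p)}_{(A_p)}(\mathbb{R}^d)=\varprojlim_{h\to\infty}\mathcal{B}^{M_p,h}_{e^{A(h\cdot)}}(\mathbb{R}^d)$ and $\mathcal{S}^{\{M_p\}}_{\{A_p\}}(\mathbb{R}^d)=\varinjlim_{h\to0^+}\mathcal{B}^{M_p,h}_{e^{A(h\cdot)}}(\mathbb{R}^d)$,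 and similarly with $B_p$ in place of $A_p$; $\mathcal{S}'^\ast_\dagger$ is the dual of $\mathcal{S}^\ast_\dagger$. Further, $\mathcal{O}_C^{(M_p),(B_p)}(\mathbb{R}^d)=\varinjlim_{n\in\mathbb{N}}\varprojlim_{h\to\infty}\mathcal{B}^{M_p,h}_{e^{-B(n\cdot)}}(\mathbb{R}^d)$ and $\mathcal{O}_C^{\{M_p\},\{B_p\}}(\mathbb{R}^d)=\varinjlim_{h\to0^+}\varprojlim_{N\ge1}\mathcal{B}^{M_p,h}_{e^{-B(\cdot/N)}}(\mathbb{R}^d)$; $\mathcal{O}_C'^{\ast,\ddagger}$ is the dual of $\mathcal{O}_C^{\ast,\ddagger}$. $\mathcal{W}_{(B_p)}C(\mathbb{R}^d)$ is the space of $g\in C(\mathbb{R}^d)$ with $\sup_x|g(x)|e^{B(Nx)}<\infty$ for all $N\in\mathbb{N}$; $\mathcal{V}_{\{B_p\}}C(\mathbb{R}^d)$ is the space of $g\in C(\mathbb{R}^d)$ with $\sup_x|g(x)|e^{B(x/n)}<\infty$ for some $n\ge1$. Standing assumptions. $M_p$ and $A_p$ satisfy $(M.1)$ and $(M.2)$, $p!\prec M_pA_p$, and $\mathcal{S}^{(M_p)}_{(A_p)}(\mathbb{R}^d)\ne\{0\}$. Under the assumptions of the statement $\mathcal{S}^\ast_\dagger(\mathbb{R}^d)$ is densely and continuously included in $\mathcal{O}_C^{\ast,\ddagger}(\mathbb{R}^d)$, so $\mathcal{O}_C'^{\ast,\ddagger}(\mathbb{R}^d)$ is regarded as a subspace of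 $\mathcal{S}'^\ast_\dagger(\mathbb{R}^d)$. Convolution: $(f\ast\varphi)(x)=\langle f,\varphi(x-\cdot)\rangle$. *)

(* Defs.v *)
From HB Require Import structures.
From mathcomp Require Import all_boot all_order all_algebra.
From mathcomp Require Import all_classical all_reals all_analysis.
From mathcomp Require Import complex.

Set Implicit Arguments.
Unset Strict Implicit.
Unset Printing Implicit Defensive.

Import Order.TTheory GRing.Theory Num.Theory.
Import numFieldTopology.Exports numFieldNormedType.Exports.

Local Open Scope classical_set_scope.
Local Open Scope ring_scope.
Local Open Scope complex_scope.

Section WeightSequences.
Context {R : realType}.
Implicit Types M N A : nat -> R.

Definition weight_sequence M :=
  (forall p, 0 < M p) /\ (M p.+1 / M p @[p --> \oo] --> +oo).

Definition cond_M1 M := forall p, M p.+1 ^+ 2 <= M p * M p.+2.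

Definition cond_M2 M := exists C0 H : R, [/\ 1 <= C0, 1 <= H &
  forall p q, M (p + q)%N <= C0 * H ^+ (p + q) * M p * M q].

Definition wsubset M N := exists C h : R, [/\ 0 < C, 0 < h &
  forall p, M p <= C * h ^+ p * N p].

Definition wprec M N := forall h : R, 0 < h -> exists2 C : R, 0 < C &
  forall p, M p <= C * h ^+ p * N p.

(* A real-valued supremum: the set is bounded above for every weight
   sequence, since [A p.+1 / A p] tends to infinity. *)
Definition assoc_fun A (t : R) : R :=
  if 0 < t then sup [set ln (t ^+ p * A 0%N / A p) | p in setT] else 0.

(* The norm of the library on ['rV_d] is the maximum norm. *)
Definition eucl_norm d (x : 'rV[R]_d) : R := Num.sqrt (\sum_(i < d) x 0 i ^+ 2).

Definition assoc_funV d A (x : 'rV[R]_d) : R := assoc_fun A (eucl_norm x).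

End WeightSequences.

(* Locally convex topologies on subspaces of a vector space [V]: the underlying
   subspace, and the filter of the sets [U] whose trace [U `&` E] is a
   neighbourhood of 0 in [E]. *)
Record lcs (K : numFieldType) (V : lmodType K) := Lcs {
  lcs_set :> V -> Prop ;
  nbhs0 : set_system V }.

Section LocallyConvex.
Context {K : numFieldType} {V : lmodType K}.
Implicit Types E : lcs V.

(* The normed space [{x in E | N x < +oo}]. *)
Definition normed_lcs (R : realType) (E : set V) (N : V -> \bar R) : lcs V :=
  let EN := [set x | E x /\ (N x < +oo)%E] in
  Lcs EN (filter_from [set r : R | 0 < r]
            (fun r => [set x | EN x /\ (N x < r%:E)%E])).

(* The intersection, with the coarsest topology making all the inclusions
   into the [E i] continuous. *)
Definition proj_limit I (D : set I) (E : I -> lcs V) : lcs V :=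
  let EI := \bigcap_(i in D) lcs_set (E i) in
  Lcs EI (within EI (smallest (@Filter V) (\bigcup_(i in D) nbhs0 (E i)))).

Definition absolutely_convex (W : set V) :=
  forall (a b : K) (x y : V),
    `|a| + `|b| <= 1 -> W x -> W y -> W (a *: x + b *: y).

(* The union of a directed family, with the finest locally convex topology
   making all the inclusions of the [E i] continuous: the absolutely convex
   sets whose trace on each [E i] is a neighbourhood of 0 form a basis of
   neighbourhoods of 0. *)
Definition ind_limit I (D : set I) (E : I -> lcs V) : lcs V :=
  let EU := \bigcup_(i in D) lcs_set (E i) in
  Lcs EU (filter_from
    [set W | absolutely_convex W /\ forall i, D i -> nbhs0 (E i) W]
    (fun W => W `&` EU)).

(* Continuous linear functionals on [E]. They are represented by functions on
   [V] of which only the values on [E] matter. *)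
Definition lcs_dual E : set (V -> K) := [set f |
  (forall (a : K) (x y : V), E x -> E y -> f (a *: x + y) = a * f x + f y) /\
  ((f : V -> K^o) @ nbhs0 E --> (0 : K^o))].

(* [f], a functional on [E], belongs to the dual of [F], for [E] included in
   [F]: elements of the dual of [F] are regarded as functionals on [E] by
   restriction. *)
Definition in_lcs_dual E (F : lcs V) (f : V -> K) :=
  exists2 g, lcs_dual F g & forall x, E x -> g x = f x.

End LocallyConvex.

Section Spaces.
Context {R : realType} {d : nat}.

Definition cfun := 'rV[R]_d -> R[i]^o.

Implicit Types (g phi : cfun) (M A B : nat -> R).

(* Modulus of a complex number, as an element of [R]. *)
Definition cmod (z : R[i]) : R := Normc.normc z.

Definition has_pderiv (j : 'I_d) phi := forall x : 'rV[R]_d,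
  derivable (fun y => complex.Re (phi y)) x (delta_mx 0 j) /\
  derivable (fun y => complex.Im (phi y)) x (delta_mx 0 j).

Definition pderiv (j : 'I_d) phi : cfun := fun x : 'rV[R]_d =>
  'D_(delta_mx 0 j) (fun y => complex.Re (phi y)) x +i*
  'D_(delta_mx 0 j) (fun y => complex.Im (phi y)) x.

Definition smooth phi := forall s : seq 'I_d,
  continuous (foldr pderiv phi s) /\
  forall j, has_pderiv j (foldr pderiv phi s).

Definition multi_index := 'I_d -> nat.
Definition mlen (alpha : multi_index) : nat := \sum_(j < d) alpha j.

Definition mderiv (alpha : multi_index) phi : cfun :=
  foldr (fun j => iter (alpha j) (pderiv j)) phi (enum 'I_d).

Definition Bnorm M (h : R) (w : 'rV[R]_d -> R) phi : \bar R :=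
  ereal_sup [set ereal_sup
    [set (h ^+ mlen alpha * cmod (mderiv alpha phi x) * w x
            / M (mlen alpha))%:E | x in setT] | alpha in setT].

Definition Bspace M (h : R) (w : 'rV[R]_d -> R) : lcs cfun :=
  normed_lcs [set phi | smooth phi] (Bnorm M h w).

Inductive gs_class := Beurling | Roumieu.

Definition GS (c : gs_class) M A : lcs cfun :=
  let step h := Bspace M h (fun x => expR (assoc_funV A (h *: x))) in
  match c with
  | Beurling => proj_limit [set h : R | 0 < h] step
  | Roumieu => ind_limit [set h : R | 0 < h] step
  end.

Definition OC (c : gs_class) M B : lcs cfun :=
  match c with
  | Beurling =>
      ind_limit [set: nat] (fun n =>
        proj_limit [set h : R | 0 < h] (fun h =>
          Bspace M h (fun x => expR (- assoc_funV B (n%:R *: x)))))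
  | Roumieu =>
      ind_limit [set h : R | 0 < h] (fun h =>
        proj_limit [set N : nat | (1 <= N)%N] (fun N =>
          Bspace M h (fun x => expR (- assoc_funV B (N%:R^-1 *: x)))))
  end.

Definition wsup B (k : R) g : \bar R :=
  ereal_sup [set (cmod (g x) * expR (assoc_funV B (k *: x)))%:E | x in setT].

(* [W_(B) C] in the Beurling case, [V_{B} C] in the Roumieu case. *)
Definition decaying_cont (c : gs_class) B : set cfun := [set g |
  continuous g /\
  match c with
  | Beurling => forall N : nat, (wsup B N%:R g < +oo)%E
  | Roumieu => exists2 n : nat, (1 <= n)%N & (wsup B n%:R^-1 g < +oo)%E
  end].

Definition convolution (f : cfun -> R[i]) phi : cfun :=
  fun x : 'rV[R]_d => f (fun y : 'rV[R]_d => phi (x - y)).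

End Spaces.

Arguments cfun R d : clear implicits.

(* Main.v *)
Require Import Defs.
From HB Require Import structures.
From mathcomp Require Import all_boot all_order all_algebra.
From mathcomp Require Import all_classical all_reals all_analysis.
From mathcomp Require Import complex ring lra.

(** Write [refl x phi] for the function [y |-> phi (x - y)], so that the convolution
    of [f] and [phi] has at [x] the value [f (refl x phi)].

    All the spaces are described by weighted bounds of derivatives (the relation
    [bd]), and membership of a functional in a dual by estimates against such
    bounds ([dual_GS_Beurling], [dual_GS_Roumieu], [dual_OC_Beurling],
    [dual_OC_Roumieu]); nothing else is retained of the topologies. A convolution
    is smooth, with derivatives that fall on the test function
    ([conv_smooth_D]), because the Taylor expansions of the translates of a test
    function converge in the test space.

    From (i) to (iii). If [g] extends [f] to the functions of moderate growth, the
    derivatives of the convolution at [x] are the values of [g] at reflections at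
    [x] of derivatives of [phi]. A reflection at [x] has norm at most a constant
    times [exp (- B (k x / 2))] with respect to the weight [exp (- B (k y))], since
    either [y] or [x - y] is large when [x] is ([ocb_refl_D]); (M.2) for [M]
    takes care of all the derivatives at once. That (iii) implies (ii) is clear.

    From (ii) to (i). There is a test function [psi] whose translates by the points
    [v] of the integer lattice add up to one ([partition_of_unity]). For [chi] of
    moderate growth, the product of [chi] and of the translate of [psi] to [v] is
    the reflection at [v] of a test function, whose norms grow with [v] like a
    weight of [B]; hence the value of [f] at this product is the value at [v] of
    a convolution. Statement (ii) says that each convolution decays; a gliding
    hump in the complete step spaces ([uniform_boundedness]) makes this
    decay uniform on the balls of a norm ([uniform_decay_Beurling],
    [uniform_decay_Roumieu]), and (M.2) for [B] lets it beat the growth of the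
    pieces with a summable surplus. So the sum over [v] of the values of [f] at
    the pieces of [chi] converges and is bounded by a norm of [chi]
    ([partial_limit], [piece_value_bd]). It defines a continuous extension of [f],
    because for a test function [chi] the series of its pieces converges to [chi]
    in the test space ([extension_GS]).

    The partition of unity comes from any nonzero element of the Beurling space:
    its squared modulus, restricted to a line parallel to an axis, is a
    nonnegative function of one variable; the integrals of that function over
    unit intervals have integer translates whose sum telescopes to the total
    integral ([profile_average]). Normalized, and multiplied over the
    coordinates, they give [psi]. *)

Set Implicit Arguments.
Unset Strict Implicit.
Unset Printing Implicit Defensive.

Import Order.TTheory GRing.Theory Num.Theory.
Import numFieldTopology.Exports numFieldNormedType.Exports.

Local Open Scope classical_set_scope.
Local Open Scope ring_scope.
Local Open Scope complex_scope.

(** * Weight functions *)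

Lemma le_of_eq (R : realType) (x y : R) : x = y -> x <= y.
Proof. by move->. Qed.

Section WeightFunctions.
Context {R : realType}.
Implicit Types (A B M : nat -> R) (s t k h c : R).

(** The weights enter through the supremum of [t ^+ p * A 0 / A p], of which
    [wexp_ge] and [wexp_le] are the characteristic properties; logarithms do not
    occur any more after that. *)
Definition wexp A t : R := expR (assoc_fun A t).

Lemma wseq_gt0 A p : weight_sequence A -> 0 < A p.
Proof. by case. Qed.

(** The quotients [A p.+1 / A p] tend to infinity, so that the terms decrease from
    some index on. *)
Lemma assoc_bounded A t : weight_sequence A -> 0 < t ->
  exists2 c, 0 < c & forall p, t ^+ p * A 0%N / A p <= c.
Proof.
move=> [Apos Ainf] t0.
have [N _ HN] : \forall p \near \oo, t <= A p.+1 / A p.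
  by move/cvgryPge: Ainf; exact.
pose u p := t ^+ p * A 0%N / A p.
have u_ge0 p : 0 < u p by rewrite !(mulr_gt0, invr_gt0, exprn_gt0).
have udec p : (N <= p)%N -> u p.+1 <= u p.
  move=> Np.
  have -> : u p.+1 = u p * (t / (A p.+1 / A p)).
    by rewrite /u exprS; field; rewrite !gt_eqF.
  rewrite (ler_piMr (ltW (u_ge0 _)))// ler_pdivrMr ?divr_gt0// mul1r.
  exact: HN _ Np.
exists (\sum_(i < N.+1) u i); first by rewrite big_ord_recr ltr_wpDl ?sumr_ge0// => i _; exact: ltW.
move=> p; rewrite -/(u p).
have small q : (q <= N)%N -> u q <= \sum_(i < N.+1) u i.
  move=> qN; rewrite (bigD1 (inord q)) //= inordK ?ltnS// lerDl sumr_ge0// => i _.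
  exact: ltW.
have [/small//|/ltnW Np] := leqP p N.
rewrite -(subnKC Np); elim: (p - N)%N => [|n IH]; first by rewrite addn0 small.
by rewrite addnS; apply: le_trans IH; rewrite udec// leq_addr.
Qed.

Lemma wexp_ge A t p : weight_sequence A -> 0 <= t ->
  t ^+ p * A 0%N / A p <= wexp A t.
Proof.
move=> hA; have Apos := wseq_gt0 _ hA; rewrite le_eqVlt => /orP[/eqP<-|t0].
  rewrite /wexp /assoc_fun ltxx expR0; case: p => [|p].
    by rewrite expr0 mul1r divff ?gt_eqF.
  by rewrite expr0n/= !mul0r.
rewrite -ler_ln ?posrE ?expR_gt0 ?(mulr_gt0, invr_gt0, exprn_gt0)//.
rewrite /wexp expRK /assoc_fun t0.
apply: ub_le_sup; last by exists p.
have [c c0 Hc] := assoc_bounded hA t0.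
exists (ln c) => _ [q _ <-].
by rewrite ler_ln ?posrE ?(mulr_gt0, invr_gt0, exprn_gt0).
Qed.

Lemma wexp_le A t c : weight_sequence A -> 0 <= t ->
  (forall p, t ^+ p * A 0%N / A p <= c) -> wexp A t <= c.
Proof.
move=> hA; have Apos := wseq_gt0 _ hA.
rewrite le_eqVlt => /orP[/eqP<-|t0] H.
  by rewrite /wexp /assoc_fun ltxx expR0; have := H 0%N; rewrite expr0 mul1r divff ?gt_eqF.
have c0 : 0 < c by apply: lt_le_trans (H 0%N); rewrite !(mulr_gt0, invr_gt0, exprn_gt0).
rewrite -[leRHS]lnK ?posrE// ler_expR /assoc_fun t0.
apply: sup_le_ub; first by exists (ln (t ^+ 0 * A 0%N / A 0%N)); exists 0%N.
by move=> _ [q _ <-]; rewrite ler_ln ?posrE ?(mulr_gt0, invr_gt0, exprn_gt0).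
Qed.

Lemma wexp_gt0 A t : 0 < wexp A t.
Proof. exact: expR_gt0. Qed.

Lemma wexp_ge1 A t : weight_sequence A -> 0 <= t -> 1 <= wexp A t.
Proof.
move=> hA t0; have := wexp_ge 0 hA t0.
by rewrite expr0 mul1r divff ?gt_eqF ?wseq_gt0.
Qed.

Lemma wexp0 A : wexp A 0 = 1.
Proof. by rewrite /wexp /assoc_fun ltxx expR0. Qed.

Lemma wexp_mono A s t : weight_sequence A -> 0 <= s -> s <= t ->
  wexp A s <= wexp A t.
Proof.
move=> hA s0 st; apply: wexp_le => // p.
apply: le_trans (wexp_ge p hA (le_trans s0 st)).
rewrite ler_pM2r ?invr_gt0 ?wseq_gt0// ler_pM2r ?wseq_gt0//.
by rewrite lerXn2r ?nnegrE// (le_trans s0 st).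
Qed.

(** The factor of the larger of [s] and [t] alone dominates the left-hand side,
    and the other factor is at least one; this crude form of subadditivity needs
    no convexity of the associated function. *)
Lemma wexp_quasi_add A u s t : weight_sequence A -> 0 <= u -> 0 <= s -> 0 <= t ->
  u <= 2 * Num.max s t -> wexp A u <= wexp A (2 * s) * wexp A (2 * t).
Proof.
move=> hA u0 s0 t0 ust.
apply: le_trans (wexp_mono hA u0 ust) _.
have [st|/ltW st] := leP s t.
  by rewrite (ler_peMl (ltW (wexp_gt0 _ _)))// wexp_ge1// mulr_ge0.
by rewrite (ler_peMr (ltW (wexp_gt0 _ _)))// wexp_ge1// mulr_ge0.
Qed.

Lemma wexp_leM A t y c : weight_sequence A -> 0 <= t -> 0 <= y ->
  (forall p, t ^+ p * A 0%N / A p * y <= c) -> wexp A t * y <= c.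
Proof.
move=> hA t0; rewrite le_eqVlt => /orP[/eqP<- H|y0 H].
  by have := H 0%N; rewrite !mulr0.
rewrite -ler_pdivlMr//; apply: wexp_le => // p.
by rewrite ler_pdivlMr.
Qed.

(** Applying (M.2) to the product of the terms of orders [p] and [q] gives the
    term of order [p + q], up to a geometric factor that rescales [t]. *)
Lemma wexp_sqr A : weight_sequence A -> cond_M2 A ->
  exists C H, [/\ 1 <= C, 1 <= H &
    forall t, 0 <= t -> wexp A t ^+ 2 <= C * wexp A (H * t)].
Proof.
move=> hA [C0 [H [C1 H1 HA]]]; have Apos := wseq_gt0 _ hA.
have H0 : 0 <= H by exact: le_trans ler01 H1.
have C00 : 0 <= C0 by exact: le_trans ler01 C1.
(* The summand one serves only to make the constant at least one. *)
exists (1 + C0 * A 0%N), H; split => //.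
  by rewrite lerDl mulr_ge0// ltW.
move=> t t0; rewrite expr2.
have Ht : 0 <= H * t by exact: mulr_ge0.
apply: (@le_trans _ _ (C0 * A 0%N * wexp A (H * t))); last first.
  by rewrite ler_wpM2r ?ltW ?wexp_gt0// ltrDr.
apply: wexp_leM => //; first exact/ltW/wexp_gt0.
move=> p; rewrite mulrC; apply: wexp_leM => //.
  by rewrite divr_ge0 ?mulr_ge0 ?exprn_ge0 ?(ltW (Apos _)).
move=> q; have := wexp_ge (p + q) hA Ht.
move=> /(ler_wpM2l (mulr_ge0 C00 (ltW (Apos 0%N)))); apply: le_trans.
have -> : t ^+ q * A 0%N / A q * (t ^+ p * A 0%N / A p) =
   t ^+ (p + q) * A 0%N ^+ 2 / (A p * A q).
  by rewrite exprD; field; rewrite !gt_eqF.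
have -> : C0 * A 0%N * ((H * t) ^+ (p + q) * A 0%N / A (p + q)%N) =
   t ^+ (p + q) * A 0%N ^+ 2 * (C0 * H ^+ (p + q) / A (p + q)%N).
  by rewrite exprMn; field; rewrite !gt_eqF.
apply: ler_wpM2l; first by rewrite mulr_ge0 ?exprn_ge0 ?(ltW (Apos _)).
by rewrite ler_pdivlMr// mulrC ler_pdivrMr ?mulr_gt0// mulrA; exact: HA.
Qed.

Lemma wexp_subset A B : weight_sequence A -> weight_sequence B -> wsubset A B ->
  exists C L, [/\ 0 < C, 0 < L & forall t, 0 <= t -> wexp B t <= C * wexp A (L * t)].
Proof.
move=> hA hB [C [h [C0 h0 H]]].
have Apos := wseq_gt0 _ hA; have Bpos := wseq_gt0 _ hB.
exists (C * B 0%N / A 0%N), h; split => //; first by rewrite !mulr_gt0 ?invr_gt0.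
move=> t t0; apply: wexp_le => // p.
have /(ler_wpM2l (ltW (mulr_gt0 (mulr_gt0 C0 (Bpos 0%N)) _))) := wexp_ge p hA (mulr_ge0 (ltW h0) t0).
move=> /(_ (A 0%N)^-1); rewrite invr_gt0 => /(_ (Apos _)); apply: le_trans.
have -> : C * B 0%N / A 0%N * ((h * t) ^+ p * A 0%N / A p) =
   t ^+ p * B 0%N * (C * h ^+ p / A p).
  by rewrite exprMn; field; rewrite !gt_eqF.
apply: ler_wpM2l; first by rewrite mulr_ge0 ?exprn_ge0 ?(ltW (Bpos _)).
by rewrite ler_pdivlMr// mulrC ler_pdivrMr// H.
Qed.

(** The terms of orders [0] and [q] of the supremum suffice. *)
Lemma wexp_poly A q : weight_sequence A ->
  exists2 C, 0 < C & forall t, 0 <= t -> (1 + t) ^+ q <= C * wexp A t.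
Proof.
move=> hA; have Apos := wseq_gt0 _ hA.
exists (2 ^+ q * (1 + A q / A 0%N)).
  by rewrite mulr_gt0 ?exprn_gt0// ltr_pwDl ?ltr01// divr_ge0 ?ltW.
move=> t t0; apply: (@le_trans _ _ (2 ^+ q * (1 + t ^+ q))).
  have [t1|/ltW t1] := leP t 1.
    apply: (@le_trans _ _ (2 ^+ q)); first by rewrite lerXn2r ?nnegrE//; lra.
    by rewrite ler_peMr ?exprn_ge0// lerDl exprn_ge0.
  apply: (@le_trans _ _ ((2 * t) ^+ q)); first by rewrite lerXn2r ?nnegrE//; lra.
  by rewrite exprMn ler_wpM2l ?exprn_ge0// lerDr.
rewrite -mulrA ler_wpM2l ?exprn_ge0// mulrDl mul1r lerD ?wexp_ge1//.
have := ler_wpM2l (ltW (divr_gt0 (Apos q) (Apos 0%N))) (wexp_ge q hA t0).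
by apply: le_trans; apply: le_of_eq; field; rewrite !gt_eqF.
Qed.

(** The quotients [M p.+1 / M p] are nondecreasing by (M.1), and [M q / M 0] and
    [M (p + q) / M p] are products of [q] consecutive ones of them. *)
Lemma M1_mul M p q : weight_sequence M -> cond_M1 M ->
  M p * M q <= M 0%N * M (p + q)%N.
Proof.
move=> hM hM1; have Mpos := wseq_gt0 _ hM.
have r_mono a b : M a.+1 * M (a + b)%N <= M a * M (a + b).+1.
  elim: b => [|b IH]; first by rewrite addn0 mulrC.
  rewrite addnS.
  have := hM1 (a + b)%N; rewrite expr2 => K.
  have := Mpos (a + b)%N; have := Mpos (a + b).+1; have := Mpos (a + b).+2.
  set x := M (a + b)%N in IH K *; set y := M (a + b).+1 in IH K *.
  set z := M (a + b).+2 in IH K * => z0 y0 x0.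
  rewrite -(ler_pM2r x0).
  apply: (@le_trans _ _ (M a * (y * y))).
    by rewrite mulrAC mulrA ler_pM2r.
  by rewrite -mulrA ler_pM2l// [z * x]mulrC.
elim: q => [|q IH]; first by rewrite addn0 mulrC.
rewrite addnS -(ler_pM2r (Mpos q)) mulrAC.
apply: le_trans (ler_wpM2r (ltW (Mpos _)) IH) _.
rewrite -!mulrA ler_pM2l// [leRHS]mulrC addnC [leLHS]mulrC; exact: r_mono.
Qed.

Lemma M1_le1 M : weight_sequence M -> cond_M1 M ->
  exists2 C, 0 < C & forall n, M n <= C * M n.+1.
Proof.
move=> hM hM1; have Mpos := wseq_gt0 _ hM; exists (M 0%N / M 1%N); first exact: divr_gt0.
move=> n; rewrite mulrAC ler_pdivlMr//; apply: le_trans (M1_mul _ _ hM hM1) _.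
by rewrite addn1.
Qed.

End WeightFunctions.

Section Euclid.
Context {R : realType} {d : nat}.
Implicit Types (A : nat -> R) (x y : 'rV[R]_d).

Lemma eucl_ge0 x : 0 <= eucl_norm x.
Proof. exact: sqrtr_ge0. Qed.

Lemma euclZ (a : R) x : eucl_norm (a *: x) = `|a| * eucl_norm x.
Proof.
rewrite /eucl_norm -sqrtr_sqr -sqrtrM ?sqr_ge0//; congr Num.sqrt.
by rewrite mulr_sumr; apply: eq_bigr => i _; rewrite mxE exprMn.
Qed.

Lemma euclN x : eucl_norm (- x) = eucl_norm x.
Proof. by rewrite -scaleN1r euclZ normrN normr1 mul1r. Qed.

Lemma eucl_coord x j : `|x 0 j| <= eucl_norm x.
Proof.
rewrite -sqrtr_sqr ler_sqrt ?sumr_ge0// => [|i _]; last exact: sqr_ge0.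
by rewrite (bigD1 j)//= lerDl sumr_ge0// => i _; exact: sqr_ge0.
Qed.

Lemma eucl_delta (t : R) j : eucl_norm (t *: delta_mx 0 j : 'rV[R]_d) = `|t|.
Proof.
rewrite euclZ /eucl_norm (bigD1 j)//= big1 ?addr0 ?mxE ?eqxx ?expr1n ?sqrtr1 ?mulr1//.
by move=> i /negPf ij; rewrite mxE eqxx ij/= expr0n.
Qed.

(** The sharp triangle inequality is replaced by its crude form, which needs
    no Cauchy-Schwarz and is absorbed by the weights. *)
Lemma eucl_quasi_add x y :
  eucl_norm (x + y) <= 2 * Num.max (eucl_norm x) (eucl_norm y).
Proof.
set a := eucl_norm x; set b := eucl_norm y.
have sq (z : 'rV[R]_d) : \sum_i z 0 i ^+ 2 = eucl_norm z ^+ 2.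
  by rewrite sqr_sqrtr ?sumr_ge0// => i _; exact: sqr_ge0.
have m0 : 0 <= Num.max a b by rewrite le_max eucl_ge0.
rewrite -(ler_pXn2r (n := 2)) ?nnegrE ?eucl_ge0 ?mulr_ge0// -sq.
apply: (@le_trans _ _ (2 * (a ^+ 2 + b ^+ 2))).
  rewrite -!sq -big_split/= mulr_sumr; apply: ler_sum => i _; rewrite mxE.
  have := sqr_ge0 (x 0 i - y 0 i); rewrite sqrrB sqrrD; lra.
have : a ^+ 2 <= Num.max a b ^+ 2 by rewrite lerXn2r ?nnegrE ?eucl_ge0// le_max lexx.
have : b ^+ 2 <= Num.max a b ^+ 2 by rewrite lerXn2r ?nnegrE ?eucl_ge0// le_max lexx orbT.
by rewrite exprMn; lra.
Qed.

(** A coordinate of maximal modulus carries at least the [d]-th part of the norm;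
    the first alternative is there for dimension zero. *)
Lemma eucl_max x : (forall j, x 0 j = 0) \/ exists j, eucl_norm x <= d%:R * `|x 0 j|.
Proof.
have [|/forallNP H] := pselect (exists j, eucl_norm x <= d%:R * `|x 0 j|); first by right.
left=> j; have := H j; move=> /negP; rewrite -ltNge => Hj.
suff : eucl_norm x <= 0.
  move=> x0; apply/normr0_eq0/eqP; rewrite eq_le normr_ge0 andbT.
  exact: le_trans (eucl_coord x j) x0.
rewrite leNgt; apply/negP => x0.
have d0 : (0 < d)%N by apply: leq_ltn_trans (ltn_ord j).
have lt i : x 0 i ^+ 2 < eucl_norm x ^+ 2 / d%:R.
  have := H i => /negP; rewrite -ltNge => Hi.
  apply: (@le_lt_trans _ _ ((d%:R * `|x 0 i|) ^+ 2 / d%:R)).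
    rewrite exprMn -normrX ger0_norm ?sqr_ge0// mulrAC ler_peMl ?sqr_ge0//.
    by rewrite expr2 mulfK ?pnatr_eq0 -?lt0n// ler1n.
  by rewrite ltr_pM2r ?invr_gt0 ?ltr0n// ltrXn2r// nnegrE ?mulr_ge0// ltW.
have : eucl_norm x ^+ 2 < eucl_norm x ^+ 2.
  have {1}-> : eucl_norm x ^+ 2 = \sum_(i < d) x 0 i ^+ 2.
    by rewrite sqr_sqrtr// sumr_ge0// => i _; exact: sqr_ge0.
  apply: (@lt_le_trans _ _ (\sum_(i < d) eucl_norm x ^+ 2 / d%:R)).
    apply: ltr_sum => //; apply/hasP; exists j => //; exact: mem_index_enum.
  by rewrite sumr_const card_ord -[_ / _ *+ d]mulr_natr divfK ?pnatr_eq0 -?lt0n.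
by rewrite ltxx.
Qed.

Definition weight A (k : R) x : R := wexp A (k * eucl_norm x).

Lemma weightE A k x : 0 <= k -> expR (assoc_funV A (k *: x)) = weight A k x.
Proof. by move=> k0; rewrite /assoc_funV euclZ ger0_norm// /weight /wexp. Qed.

Lemma weightNE A k x : 0 <= k -> expR (- assoc_funV A (k *: x)) = (weight A k x)^-1.
Proof. by move=> k0; rewrite expRN weightE. Qed.

Lemma weight_gt0 A k x : 0 < weight A k x.
Proof. exact: wexp_gt0. Qed.

Lemma weight_ge1 A k x : weight_sequence A -> 0 <= k -> 1 <= weight A k x.
Proof. by move=> hA k0; rewrite wexp_ge1// mulr_ge0// eucl_ge0. Qed.

Lemma weight_mono A k k' x : weight_sequence A -> 0 <= k -> k <= k' ->
  weight A k x <= weight A k' x.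
Proof. by move=> hA k0 kk'; rewrite wexp_mono// ?mulr_ge0 ?ler_wpM2r ?eucl_ge0. Qed.

Lemma weightN A k x : weight A k (- x) = weight A k x.
Proof. by rewrite /weight euclN. Qed.

Lemma weight_add A k x y : weight_sequence A -> 0 <= k ->
  weight A k (x + y) <= weight A (2 * k) x * weight A (2 * k) y.
Proof.
move=> hA k0; rewrite /weight -2!mulrA.
apply: wexp_quasi_add; rewrite ?mulr_ge0 ?eucl_ge0//.
by rewrite -maxr_pMr// mulrCA ler_wpM2l// eucl_quasi_add.
Qed.

Lemma weight_prod A : weight_sequence A -> cond_M2 A ->
  exists C H, [/\ 1 <= C, 1 <= H & forall k k' x, 0 <= k -> 0 <= k' ->
    weight A k x * weight A k' x <= C * weight A (H * Num.max k k') x].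
Proof.
move=> hA /(wexp_sqr hA)[C [H [C1 H1 HA]]]; exists C, H; split => // k k' x k0 k'0.
have m0 : 0 <= Num.max k k' by rewrite le_max k0.
apply: le_trans (_ : weight A (Num.max k k') x ^+ 2 <= _).
  rewrite expr2; apply: ler_pM; rewrite ?(ltW (weight_gt0 _ _ _))//.
    by rewrite weight_mono// le_max lexx.
  by rewrite weight_mono// le_max lexx orbT.
rewrite /weight -mulrA; apply: HA; by rewrite mulr_ge0// eucl_ge0.
Qed.

End Euclid.

(* From here on the weights are used through the lemmas above only; conversion
   must not unfold the exponential series. *)
#[global] Opaque wexp expR.

(** * Complex-valued functions of several variables *)

Section Modulus.
Context {R : realType}.
Implicit Types z w : R[i].

Lemma norm_cmod z : `|z| = (cmod z)%:C.
Proof. by []. Qed.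

Lemma cmod_ge0 z : 0 <= cmod z.
Proof. by rewrite -lecR -norm_cmod normr_ge0. Qed.

Lemma cmodM z w : cmod (z * w) = cmod z * cmod w.
Proof. exact: Normc.normcM. Qed.

Lemma cmodD z w : cmod (z + w) <= cmod z + cmod w.
Proof. exact: le_normcD. Qed.

Lemma cmodN z : cmod (- z) = cmod z.
Proof. exact: normcN. Qed.

Lemma cmod0 : cmod (0 : R[i]) = 0.
Proof. exact: Normc.normc0. Qed.

Lemma cmod_eq0 z : cmod z = 0 -> z = 0.
Proof. exact: Normc.eq0_normc. Qed.

Lemma cmodB z w : cmod (z - w) <= cmod z + cmod w.
Proof. by rewrite -(cmodN w) cmodD. Qed.

Lemma cmodC z w : cmod (z - w) = cmod (w - z).
Proof. by rewrite -cmodN opprB. Qed.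

Lemma cmodR (a : R) : cmod a%:C = `|a|.
Proof. by rewrite /cmod /Normc.normc /= expr0n/= addr0 sqrtr_sqr. Qed.

Lemma cmodJ z : cmod z^*%C = cmod z.
Proof. by case: z => a b; rewrite /cmod /= sqrrN. Qed.

Lemma cmod_Re z : `|complex.Re z| <= cmod z.
Proof.
by case: z => a b; rewrite /cmod /= -sqrtr_sqr ler_wsqrtr// lerDl sqr_ge0.
Qed.

Lemma cmod_Im z : `|complex.Im z| <= cmod z.
Proof.
by case: z => a b; rewrite /cmod /= -sqrtr_sqr ler_wsqrtr// lerDr sqr_ge0.
Qed.

Lemma cmod_ReIm z : cmod z <= `|complex.Re z| + `|complex.Im z|.
Proof.
case: z => a b; have E : a +i* b = a%:C + (0 +i* b) by simpc.
rewrite [X in cmod X]E; apply: le_trans (cmodD _ _) _; rewrite cmodR lerD2l /=.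
by rewrite /cmod /= expr0n/= add0r sqrtr_sqr.
Qed.

Lemma cmod_sum I (s : seq I) (P : pred I) (F : I -> R[i]) :
  cmod (\sum_(i <- s | P i) F i) <= \sum_(i <- s | P i) cmod (F i).
Proof.
elim/big_ind2: _ => [|x a y b xa yb|//]; first by rewrite cmod0.
by apply: le_trans (cmodD _ _) _; exact: lerD.
Qed.

(** The radii of balls in the complex plane are themselves complex numbers, which
    are real and positive. *)
Lemma complex_gt0P (e : R[i]) : 0 < e -> exists2 r : R, 0 < r & e = r%:C.
Proof. by case: e => a b; rewrite ltcE /= => /andP[/eqP E a0]; exists a; rewrite ?E. Qed.

Lemma reD z w : complex.Re (z + w) = complex.Re z + complex.Re w.
Proof. by case: z w => [? ?] [? ?]. Qed.
Lemma imD z w : complex.Im (z + w) = complex.Im z + complex.Im w.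
Proof. by case: z w => [? ?] [? ?]. Qed.
Lemma reN z : complex.Re (- z) = - complex.Re z.
Proof. by case: z => [? ?]. Qed.
Lemma imN z : complex.Im (- z) = - complex.Im z.
Proof. by case: z => [? ?]. Qed.
Lemma reM z w : complex.Re (z * w) =
  complex.Re z * complex.Re w - complex.Im z * complex.Im w.
Proof. by case: z w => [? ?] [? ?]. Qed.
Lemma imM z w : complex.Im (z * w) =
  complex.Re z * complex.Im w + complex.Im z * complex.Re w.
Proof. by case: z w => [? ?] [? ?]. Qed.

End Modulus.

Section OneVariable.
Context {R : realType}.
Implicit Types g : R -> R.

Lemma is_derive_continuous g (g' : R -> R) :
  (forall t : R, is_derive t 1 g (g' t)) -> continuous g.
Proof.
by move=> H t; apply: differentiable_continuous; apply/derivable1_diffP; case: (H t).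
Qed.

Lemma mvt g g' a b : (forall t : R, is_derive t 1 g (g' t)) ->
  exists2 c, `|c - a| <= `|b - a| & g b - g a = g' c * (b - a).
Proof.
move=> H; have cg := is_derive_continuous H.
have [ab|/ltW ba] := leP a b.
  have [c cab E] := MVT_segment ab (fun x _ => H x) (continuous_subspaceT cg).
  exists c => //; move: cab; rewrite in_itv/= => /andP[ac cb].
  by rewrite !ger0_norm ?subr_ge0// lerB.
have [c cab E] := MVT_segment ba (fun x _ => H x) (continuous_subspaceT cg).
exists c.
  move: cab; rewrite in_itv/= => /andP[bc ca].
  by rewrite distrC [leRHS]distrC !ger0_norm ?subr_ge0// lerB.
by rewrite -opprB E -mulrN opprB.
Qed.

(** The mean value theorem, applied to [g] and then to [g']. *)
Lemma taylor1 g g' g'' K t :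
  (forall t : R, is_derive t 1 g (g' t)) -> (forall t : R, is_derive t 1 g' (g'' t)) ->
  (forall s, `|s| <= `|t| -> `|g'' s| <= K) ->
  `|g t - g 0 - t * g' 0| <= K * t ^+ 2.
Proof.
move=> H1 H2 HK.
have [c ct E1] := mvt 0 t H1; have [c' c't E2] := mvt 0 c H2.
move: ct c't E1 E2; rewrite !subr0 => ct c't E1 E2.
have -> : g t - g 0 - t * g' 0 = (g' c - g' 0) * t by rewrite E1; ring.
rewrite E2 !normrM -mulrA -(ger0_norm (sqr_ge0 t)) normrX expr2.
rewrite ler_pM ?mulr_ge0//; first by apply: HK; exact: le_trans c't ct.
by rewrite ler_wpM2r.
Qed.

(** A first order expansion with quadratic remainder determines the derivative;
    this is how the derivatives of convolutions and of limits are found. *)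
Lemma is_derive_of_estimate (V : normedModType R) (u : V -> R) (x v : V) l K :
  (forall t : R, `|t| <= 1 -> `|u (x + t *: v) - u x - t * l| <= K * t ^+ 2) ->
  is_derive x v u l.
Proof.
move=> H.
have K0 : 0 <= K by have := H 1; rewrite normr1 expr1n mulr1 => /(_ (lexx _)); exact: le_trans.
suff F : h^-1 *: ((u \o shift x) (h *: v) - u x) @[h --> 0^'] --> (l : R^o).
  by split; [apply/cvg_ex; exists l | exact/cvg_lim].
apply/cvgrPdist_le => e e0.
have d0 : 0 < Num.min 1 (e / (K + 1)).
  by rewrite lt_min ltr01 divr_gt0// ltr_wpDl.
apply/nbhs_ballP; exists (Num.min 1 (e / (K + 1))) => //= h.
rewrite /ball/= sub0r normrN lt_min => /andP[h1 he] hN0.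
rewrite [h *: v + x]addrC /GRing.scale/=.
have -> : l - h^-1 * (u (x + h *: v) - u x) =
   - (h^-1 * (u (x + h *: v) - u x - h * l)).
  by field; exact: hN0.
rewrite normrN normrM normfV ler_pdivrMl ?normr_gt0//.
apply: le_trans (H _ (ltW h1)) _.
rewrite -(ger0_norm (sqr_ge0 h)) normrX expr2 [leLHS]mulrCA ler_wpM2l//.
move: he; rewrite ltr_pdivlMr ?ltr_wpDl// => /ltW; apply: le_trans.
by rewrite mulrC ler_wpM2l// lerDl.
Qed.

Lemma is_derive_line (V : normedModType R) (u : V -> R) (x v : V) t l :
  is_derive (x + t *: v) v u l -> is_derive t 1 (fun s : R => u (x + s *: v)) l.
Proof.
case=> ex val.
suff E : (fun h : R => h^-1 *: (((fun s => u (x + s *: v)) \o shift t) (h *: 1) - u (x + t *: v))) =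
         (fun h : R => h^-1 *: ((u \o shift (x + t *: v)) (h *: v) - u (x + t *: v))).
  by split; rewrite /derivable /derive E.
apply/funext => h /=; congr (_ *: (u _ - _)).
by rewrite [h%:A]mulr1 scalerDl addrCA.
Qed.

Lemma is_derive_of_line (V : normedModType R) (u : V -> R) (x v : V) l :
  is_derive (0 : R) 1 (fun s : R => u (x + s *: v)) l -> is_derive x v u l.
Proof.
case=> ex val.
suff E : (fun h : R => h^-1 *: ((u \o shift x) (h *: v) - u x)) =
  (fun h : R => h^-1 *: (((fun s => u (x + s *: v)) \o shift 0) (h *: 1) - u (x + 0 *: v))).
  by split; rewrite /derivable /derive E.
apply/funext => h /=; rewrite addr0 scale0r addr0; congr (_ *: (u _ - _)).
by rewrite [h%:A]mulr1 addrC.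
Qed.

End OneVariable.

Section Calculus.
Context {R : realType} {d : nat}.
Notation V := 'rV[R]_d.
Notation e_ j := (delta_mx 0 j : 'rV[R]_d).
Implicit Types (phi psi : cfun R d) (x y : V) (s : seq 'I_d).

(** Derivatives are indexed by sequences of directions instead of multi-indices:
    they compose by concatenation, and the Leibniz rule has no binomial
    coefficients. *)
Definition D s phi : cfun R d := foldr (@pderiv R d) phi s.

Arguments D : simpl never.

Lemma D_cons j s phi : D (j :: s) phi = pderiv j (D s phi).
Proof. by []. Qed.

Lemma D_cat s s' phi : D (s ++ s') phi = D s (D s' phi).
Proof. exact: foldr_cat. Qed.

(** The graph of [pderiv j], on its domain: one relation carries the existence of
    the derivative and its value. *)
Definition has_pd j phi psi := forall x,
  is_derive x (e_ j) (fun y => complex.Re (phi y)) (complex.Re (psi x)) /\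
  is_derive x (e_ j) (fun y => complex.Im (phi y)) (complex.Im (psi x)).

Lemma has_pd_pderiv j phi psi : has_pd j phi psi ->
  has_pderiv j phi /\ pderiv j phi = psi.
Proof.
move=> H; split=> [x|]; first by case: (H x) => [[? _] [? _]].
apply/funext => x; rewrite /pderiv; case: (H x) => [[_ ->] [_ ->]].
by case: (psi x).
Qed.

Lemma pderiv_has_pd j phi : has_pderiv j phi -> has_pd j phi (pderiv j phi).
Proof. by move=> H x; case: (H x) => ? ?; split; exact: DeriveDef. Qed.

Lemma smooth_has_pd phi s j : smooth phi -> has_pd j (D s phi) (D (j :: s) phi).
Proof. by move=> /(_ s)[_ H]; exact: pderiv_has_pd. Qed.

Lemma smooth_D phi s : smooth phi -> smooth (D s phi).
Proof. by move=> H s'; rewrite -/(D s' (D s phi)) -D_cat; exact: H. Qed.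

Lemma has_pd_line j phi psi x : has_pd j phi psi ->
  (forall t : R, is_derive t 1 (fun r : R => complex.Re (phi (x + r *: e_ j)))
    (complex.Re (psi (x + t *: e_ j)))) /\
  (forall t : R, is_derive t 1 (fun r : R => complex.Im (phi (x + r *: e_ j)))
    (complex.Im (psi (x + t *: e_ j)))).
Proof.
move=> H; split=> t; have [A B] := H (x + t *: e_ j).
  exact: (is_derive_line A).
exact: (is_derive_line B).
Qed.

(** The factor two comes from the separate treatment of the real and imaginary
    parts. *)
Lemma cmvt j phi phi' x t K : has_pd j phi phi' ->
  (forall r, `|r| <= `|t| -> cmod (phi' (x + r *: e_ j)) <= K) ->
  cmod (phi (x + t *: e_ j) - phi x) <= 2 * K * `|t|.
Proof.
move=> /(has_pd_line x)[A B] HK.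
apply: le_trans (cmod_ReIm _) _; rewrite reD imD reN imN.
have [c1 c1t E1] := mvt 0 t A; have [c2 c2t E2] := mvt 0 t B.
move: c1t c2t E1 E2; rewrite !subr0 scale0r addr0 => c1t c2t -> ->.
rewrite !normrM -mulrDl ler_wpM2r// mulrDl mul1r lerD//.
  exact: le_trans (cmod_Re _) (HK _ c1t).
exact: le_trans (cmod_Im _) (HK _ c2t).
Qed.

Lemma ctaylor j phi phi' phi'' x t K : has_pd j phi phi' -> has_pd j phi' phi'' ->
  (forall r, `|r| <= `|t| -> cmod (phi'' (x + r *: e_ j)) <= K) ->
  cmod (phi (x + t *: e_ j) - phi x - t%:C * phi' x) <= 2 * K * t ^+ 2.
Proof.
move=> /(has_pd_line x)[A B] /(has_pd_line x)[A' B'] HK.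
have E1 := taylor1 A A' (fun r rt => le_trans (cmod_Re _) (HK r rt)).
have E2 := taylor1 B B' (fun r rt => le_trans (cmod_Im _) (HK r rt)).
move: E1 E2; rewrite !scale0r !addr0 => E1 E2.
apply: le_trans (cmod_ReIm _) _; rewrite !reD !imD !reN !imN reM imM /=.
by rewrite !mul0r subr0 addr0 -mulrA mulrDl mul1r lerD.
Qed.

Lemma has_pd_of_estimate j phi phi' :
  (forall x, exists K, forall t : R, `|t| <= 1 ->
    cmod (phi (x + t *: e_ j) - phi x - t%:C * phi' x) <= K * t ^+ 2) ->
  has_pd j phi phi'.
Proof.
move=> H x; have [K HK] := H x; split; apply: (@is_derive_of_estimate _ _ _ _ _ _ K) => t t1.
  apply: le_trans (HK t t1); apply: le_trans (cmod_Re _).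
  by rewrite !reD !reN reM /= mul0r subr0.
apply: le_trans (HK t t1); apply: le_trans (cmod_Im _).
by rewrite !imD !imN imM /= mul0r addr0.
Qed.

Definition in_box x (r : R) y := forall j, `|x 0 j - y 0 j| < r.

Lemma nbhs_box x (P : set V) : nbhs x P <->
  exists2 r : R, 0 < r & forall y, in_box x r y -> P y.
Proof.
split=> [/nbhs_ballP[r r0 H]|[r r0 H]].
  by exists r => // y xy; apply: H; split => // i j; rewrite ord1; exact: xy.
apply/nbhs_ballP; exists r => // y [_ xy]; apply: H => j; exact: xy.
Qed.

Lemma continuous_box phi : continuous phi <->
  forall x (e : R), 0 < e -> exists2 r : R, 0 < r &
    forall y, in_box x r y -> cmod (phi x - phi y) < e.
Proof.
split=> [C x e e0|H x].
  have /cvgrPdist_lt/(_ e%:C) := C x; rewrite ltcR => /(_ e0).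
  move=> /nbhs_box[r r0 Hr]; exists r => // y /Hr.
  by rewrite norm_cmod ltcR.
apply/(@cvgrPdist_lt _ _ _ (nbhs x) (nbhs_filter x)) => _ /complex_gt0P[e e0 ->].
have [r r0 Hr] := H x e e0; apply/nbhs_box; exists r => // y /Hr.
by rewrite norm_cmod ltcR.
Qed.

(** Bounds of derivatives are what the estimates provide; the continuity required
    of smooth functions then follows from bounds one order higher. *)
Definition loc_bounded phi := forall x, exists2 C : R, 0 <= C &
  exists2 r : R, 0 < r & forall y, in_box x r y -> cmod (phi y) <= C.

Lemma continuous_loc_bounded phi : continuous phi -> loc_bounded phi.
Proof.
move=> /continuous_box H x; exists (1 + cmod (phi x)).
  by rewrite addr_ge0// cmod_ge0.
have [r r0 Hr] := H x 1 ltr01; exists r => // y /Hr xy.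
have -> : phi y = (phi y - phi x) + phi x by rewrite subrK.
by apply: le_trans (cmodD _ _) _; rewrite lerD2r cmodC ltW.
Qed.

(** The increment along [y - x] is a telescoping sum of increments parallel to
    the axes, to each of which the mean value inequality applies. *)
Lemma loc_bounded_continuous phi :
  (forall j, exists2 psi, loc_bounded psi & has_pd j phi psi) -> continuous phi.
Proof.
move=> H; have /boolp.choice[psi Hpsi] : forall j, exists psi, loc_bounded psi /\ has_pd j phi psi.
  by move=> j; case: (H j) => p ? ?; exists p.
apply/continuous_box => x e e0.
have /boolp.choice[Cr HCr] : forall j, exists Cr : R * R,
    [/\ 0 <= Cr.1, 0 < Cr.2 & forall y, in_box x Cr.2 y -> cmod (psi j y) <= Cr.1].
  by move=> j; case: (Hpsi j) => + _ => /(_ x)[C C0 [r r0 Hr]]; exists (C, r).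
pose K := 1 + \sum_j 2 * (Cr j).1.
have K1 : 0 < K.
  by rewrite ltr_pwDl// sumr_ge0// => j _; rewrite mulr_ge0//; case: (HCr j).
pose r := \big[Num.min/e / K]_j (Cr j).2.
have r0 : 0 < r.
  rewrite /r; elim/big_ind: _ => [|a b a0 b0|j _]; first exact: divr_gt0.
    by rewrite lt_min a0.
  by case: (HCr j).
have rle j : r <= (Cr j).2 by rewrite /r; apply: bigmin_le.
have rK : r <= e / K by rewrite /r; apply: bigmin_le_id.
exists r => // y xy.
pose z k : V := \row_j (if (j < k)%N then y 0 j else x 0 j).
have zx : z 0%N = x by apply/rowP => j; rewrite mxE ltn0.
have zy : z d = y by apply/rowP => j; rewrite mxE ltn_ord.
have step (j : 'I_d) : cmod (phi (z j.+1) - phi (z j)) <= 2 * (Cr j).1 * r.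
  have -> : z j.+1 = z j + (y 0 j - x 0 j) *: e_ j.
    apply/rowP => i; rewrite !mxE eqxx /= ltnS leq_eqVlt.
    have [->|ij] := eqVneq i j; first by rewrite eqxx ltnn mulr1 addrC subrK.
    by rewrite -val_eqE /= in ij; rewrite (negPf ij) /= mulr0 addr0.
  have [C0 _ HC] := HCr j; have [_ Hj] := Hpsi j.
  apply: le_trans (cmvt (K := (Cr j).1) Hj _) _.
    move=> t tj; apply: HC => i; rewrite !mxE eqxx /=.
    have [->|ij] := eqVneq i j.
      rewrite ltnn mulr1 opprD addrA subrr sub0r normrN.
      apply: le_lt_trans tj _; rewrite distrC.
      exact: lt_le_trans (xy j) (rle j).
    rewrite mulr0 addr0; case: ifP => _; first exact: lt_le_trans (xy i) (rle j).
    by rewrite subrr normr0; exact: lt_le_trans r0 (rle j).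
  by rewrite ler_wpM2l ?mulr_ge0// distrC ltW.
have -> : phi x - phi y = - \sum_(j < d) (phi (z j.+1) - phi (z j)).
  rewrite -(big_mkord xpredT (fun j => phi (z j.+1) - phi (z j))).
  by rewrite telescope_sumr// zx zy opprB.
rewrite cmodN; apply: le_lt_trans (cmod_sum _ _ _) _.
apply: (@le_lt_trans _ _ ((K - 1) * r)).
  by rewrite /K addrC addKr mulr_suml; apply: ler_sum => j _; exact: step.
apply: (@lt_le_trans _ _ (K * r)); first by rewrite ltr_pM2r// gtrBl.
by rewrite mulrC -ler_pdivlMr.
Qed.

(** Being closed under partial differentiation bootstraps to smoothness, since
    boundedness of the next derivatives gives continuity. *)
Lemma smooth_of_closed (P : cfun R d -> Prop) :
  (forall phi, P phi -> loc_bounded phi) ->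
  (forall phi j, P phi -> exists2 psi, P psi & has_pd j phi psi) ->
  forall phi, P phi -> smooth phi.
Proof.
move=> Pb Pd phi Pphi s.
have : P (D s phi).
  elim: s => // j s IH; have [psi Ppsi H] := Pd _ j IH.
  by rewrite D_cons; case: (has_pd_pderiv H) => _ ->.
rewrite -/(D s phi); move: (D s phi) => {Pphi}phi Pphi; split.
  apply: loc_bounded_continuous => j; have [psi Ppsi H] := Pd _ j Pphi.
  by exists psi => //; exact: Pb.
by move=> j; have [psi Ppsi H] := Pd _ j Pphi; case: (has_pd_pderiv H).
Qed.

(** Candidates [F s] for all the derivatives at once are indeed the derivatives
    of [F [::]] as soon as consecutive ones fit; this and [smooth_of_family]
    compute the derivatives of products, reflections, convolutions and limits. *)
Lemma D_of_family (F : seq 'I_d -> cfun R d) :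
  (forall s j, has_pd j (F s) (F (j :: s))) -> forall s, D s (F [::]) = F s.
Proof.
by move=> H; elim=> // j s IH; rewrite D_cons IH; case: (has_pd_pderiv (H s j)).
Qed.

Lemma smooth_of_family (F : seq 'I_d -> cfun R d) :
  (forall s, loc_bounded (F s)) -> (forall s j, has_pd j (F s) (F (j :: s))) ->
  smooth (F [::]).
Proof.
move=> Fb Fd; apply: (@smooth_of_closed (fun phi => exists s, phi = F s)).
- by move=> _ [s ->].
- by move=> _ j [s ->]; exists (F (j :: s)) => //; exists (j :: s).
- by exists [::].
Qed.

Lemma smooth_loc_bounded phi s : smooth phi -> loc_bounded (D s phi).
Proof. by move=> /(_ s)[H _]; exact: continuous_loc_bounded. Qed.

End Calculus.
Arguments D {R d} s phi : simpl never.

(** * Symmetry of derivatives, sums, products and reflections *)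

Section Schwarz.
Context {R : realType} {d : nat}.
Notation V := 'rV[R]_d.
Notation e_ j := (delta_mx 0 j : 'rV[R]_d).

(** The mean value theorem in direction [i] and then in direction [j]. *)
Lemma second_difference (u ui uij : V -> R) i j x (r : R) :
  (forall y, is_derive y (e_ i) u (ui y)) -> (forall y, is_derive y (e_ j) ui (uij y)) ->
  exists a b, [/\ `|a| <= `|r|, `|b| <= `|r| &
    u (x + r *: e_ i + r *: e_ j) - u (x + r *: e_ i) - u (x + r *: e_ j) + u x =
    r ^+ 2 * uij (x + a *: e_ i + b *: e_ j)].
Proof.
move=> Hi Hj.
pose p t := u ((x + r *: e_ j) + t *: e_ i) - u (x + t *: e_ i).
pose p' t := ui ((x + r *: e_ j) + t *: e_ i) - ui (x + t *: e_ i).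
have pd (t : R) : is_derive t 1 p (p' t).
  by apply: is_deriveB; apply: is_derive_line; exact: Hi.
have [a ar Ea] := mvt 0 r pd.
have qd (t : R) : is_derive t 1 (fun t => ui ((x + a *: e_ i) + t *: e_ j))
    (uij ((x + a *: e_ i) + t *: e_ j)).
  by apply: is_derive_line; exact: Hj.
have [b br Eb] := mvt 0 r qd.
exists a, b; split; [by move: ar; rewrite !subr0|by move: br; rewrite !subr0|].
move: Ea Eb; rewrite /p /p' !subr0 !scale0r !addr0.
rewrite [x + r *: e_ j + a *: _]addrAC => Ea Eb.
rewrite Eb in Ea; rewrite expr2 -mulrA [r * (r * _)]mulrC [r * _]mulrC -Ea.
by rewrite [x + r *: e_ j + r *: _]addrAC; ring.
Qed.

(** The second difference is symmetric in the two directions, so that values of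
    the two mixed derivatives agree at points arbitrarily close to [x]. *)
Lemma schwarz_real (u ui uj uij uji : V -> R) i j x :
  (forall y, is_derive y (e_ i) u (ui y)) -> (forall y, is_derive y (e_ j) ui (uij y)) ->
  (forall y, is_derive y (e_ j) u (uj y)) -> (forall y, is_derive y (e_ i) uj (uji y)) ->
  (forall e, 0 < e -> exists2 r : R, 0 < r & forall y, in_box x r y -> `|uij x - uij y| < e) ->
  (forall e, 0 < e -> exists2 r : R, 0 < r & forall y, in_box x r y -> `|uji x - uji y| < e) ->
  uij x = uji x.
Proof.
move=> Hi Hij Hj Hji Cij Cji; apply/eqP; rewrite -subr_eq0 -normr_le0.
apply/ler_addgt0Pr => e e0; rewrite add0r.
have e20 : 0 < e / 2 by lra.
have [r1 r10 H1] := Cij _ e20; have [r2 r20 H2] := Cji _ e20.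
pose m := Num.min r1 r2; have m0 : 0 < m by rewrite lt_min r10.
pose r := m / 3; have r0 : 0 < r by rewrite /r; lra.
have [a [b [ar br E1]]] := second_difference x r Hi Hij.
have [a' [b' [ar' br' E2]]] := second_difference x r Hj Hji.
have E : uij (x + a *: e_ i + b *: e_ j) = uji (x + a' *: e_ j + b' *: e_ i).
  apply: (mulfI (x := r ^+ 2)); first by rewrite gt_eqF ?exprn_gt0.
  by rewrite -E1 -E2 [x + r *: e_ j + r *: _]addrAC; ring.
have cl k l (s t : R) : `|s| <= `|r| -> `|t| <= `|r| -> in_box x m (x + s *: e_ k + t *: e_ l).
  rewrite (gtr0_norm r0) => sr tr n; rewrite !mxE !eqxx /=.
  rewrite -addrA opprD addrA subrr sub0r normrN; apply: le_lt_trans (ler_normD _ _) _.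
  have le1 (z : R) (bb : bool) : `|z * bb%:R| <= `|z|.
    by case: bb; rewrite ?mulr1// mulr0 normr0.
  apply: (@le_lt_trans _ _ (r + r)); last by rewrite /r; lra.
  by rewrite lerD// (le_trans (le1 _ _)).
have A1 : `|uij x - uij (x + a *: e_ i + b *: e_ j)| < e / 2.
  by apply: H1 => k; apply: lt_le_trans (cl _ _ _ _ ar br k) _; rewrite ge_min lexx.
have A2 : `|uji x - uji (x + a' *: e_ j + b' *: e_ i)| < e / 2.
  by apply: H2 => k; apply: lt_le_trans (cl _ _ _ _ ar' br' k) _; rewrite ge_min lexx orbT.
rewrite E in A1.
have -> : uij x - uji x = (uij x - uji (x + a' *: e_ j + b' *: e_ i)) -
   (uji x - uji (x + a' *: e_ j + b' *: e_ i)) by ring.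
by apply: le_trans (ler_normB _ _) _; lra.
Qed.

Lemma schwarz (phi : cfun R d) s i j : smooth phi ->
  D (i :: j :: s) phi = D (j :: i :: s) phi.
Proof.
move=> Sphi; apply/funext => x.
have C t (e : R) : 0 < e -> exists2 r : R, 0 < r &
    forall y, in_box x r y -> cmod (D t phi x - D t phi y) < e.
  by move=> e0; have [/continuous_box H _] := Sphi t; exact: H.
have [hi hij] := (smooth_has_pd s i Sphi, smooth_has_pd (i :: s) j Sphi).
have [hj hji] := (smooth_has_pd s j Sphi, smooth_has_pd (j :: s) i Sphi).
suff [ERe EIm] : complex.Re (D (i :: j :: s) phi x) = complex.Re (D (j :: i :: s) phi x) /\
    complex.Im (D (i :: j :: s) phi x) = complex.Im (D (j :: i :: s) phi x).
  move: ERe EIm; case: (D (i :: j :: s) phi x) => a b.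
  by case: (D _ phi x) => a' b' /= -> ->.
split.
  apply: (schwarz_real (fun y => (hj y).1) (fun y => (hji y).1)
                       (fun y => (hi y).1) (fun y => (hij y).1)) => e /C H.
    have [r r0 Hr] := H (i :: j :: s); exists r => // y /Hr; apply: le_lt_trans.
    by rewrite -reN -reD cmod_Re.
  have [r r0 Hr] := H (j :: i :: s); exists r => // y /Hr; apply: le_lt_trans.
  by rewrite -reN -reD cmod_Re.
apply: (schwarz_real (fun y => (hj y).2) (fun y => (hji y).2)
                     (fun y => (hi y).2) (fun y => (hij y).2)) => e /C H.
  have [r r0 Hr] := H (i :: j :: s); exists r => // y /Hr; apply: le_lt_trans.
  by rewrite -imN -imD cmod_Im.
have [r r0 Hr] := H (j :: i :: s); exists r => // y /Hr; apply: le_lt_trans.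
by rewrite -imN -imD cmod_Im.
Qed.

Lemma D_perm (phi : cfun R d) s s' : smooth phi -> perm_eq s s' -> D s phi = D s' phi.
Proof.
move=> Sphi.
have D_rem j t : j \in t -> D t phi = D (j :: rem j t) phi.
  elim: t => // a t IH; rewrite inE /=; have [->//|ja /=] := eqVneq a j.
  by move=> /IH E; rewrite D_cons E schwarz.
elim: s s' => [|j s IH] s'; first by rewrite perm_sym => /perm_nilP ->.
move=> ss'; have js' : j \in s' by rewrite -(perm_mem ss') mem_head.
rewrite (D_rem _ _ js') D_cons (IH (rem j s'))//.
by rewrite -(perm_cons j) (perm_trans ss')// perm_to_rem.
Qed.

Lemma D_pderiv (phi : cfun R d) s j : smooth phi -> D s (pderiv j phi) = D (j :: s) phi.
Proof.
move=> Sphi; rewrite -[pderiv j phi]/(D [:: j] phi) -D_cat; apply: D_perm => //.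
by rewrite cats1 perm_rcons.
Qed.

End Schwarz.

Section SmoothClosure.
Context {R : realType} {d : nat}.
Notation V := 'rV[R]_d.
Notation e_ j := (delta_mx 0 j : 'rV[R]_d).
Implicit Types (phi psi : cfun R d) (x y : V) (s : seq 'I_d).

Lemma cfunD phi psi x : (phi + psi) x = (phi x : R[i]) + (psi x : R[i]).
Proof. by []. Qed.
Lemma cfunN phi x : (- phi) x = - (phi x : R[i]).
Proof. by []. Qed.
Lemma cfunZ (a : R[i]) phi x : (a *: phi) x = a * (phi x : R[i]) :> R[i].
Proof. by []. Qed.

Lemma is_derive_ext (u u' : V -> R) x v l l' : u =1 u' -> l = l' ->
  is_derive x v u l -> is_derive x v u' l'.
Proof. by move=> /funext-> ->. Qed.

Lemma is_derive_lin (u1 u2 : V -> R) x v (a b l1 l2 : R) :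
  is_derive x v u1 l1 -> is_derive x v u2 l2 ->
  is_derive x v (fun y => a * u1 y + b * u2 y) (a * l1 + b * l2).
Proof. by move=> H1 H2; exact: (is_deriveD (is_deriveZ a H1) (is_deriveZ b H2)). Qed.

Lemma is_derive_mul (u1 u2 : V -> R) x v (l1 l2 : R) :
  is_derive x v u1 l1 -> is_derive x v u2 l2 ->
  is_derive x v (fun y => u1 y * u2 y) (l1 * u2 x + u1 x * l2).
Proof.
move=> H1 H2; apply: (is_derive_ext _ _ (is_deriveM H1 H2)) => //=.
by rewrite /GRing.scale /= addrC [u2 x * _]mulrC.
Qed.

Lemma has_pd_lin j (a : R[i]) phi phi' psi psi' : has_pd j phi phi' -> has_pd j psi psi' ->
  has_pd j (a *: phi + psi) (a *: phi' + psi').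
Proof.
move=> H1 H2 x; have [[A B] [A' B']] := (H1 x, H2 x); split.
  apply: (is_derive_ext _ _ (is_derive_lin 1 1 (is_derive_lin (complex.Re a)
    (- complex.Im a) A B) A')) => [y|]; by rewrite cfunD cfunZ !mul1r reD reM mulNr.
apply: (is_derive_ext _ _ (is_derive_lin 1 1 (is_derive_lin (complex.Re a)
    (complex.Im a) B A) B')) => [y|]; by rewrite cfunD cfunZ !mul1r imD imM.
Qed.

Lemma has_pd0 j : has_pd j (0 : cfun R d) 0.
Proof. by move=> x; split; exact: is_derive_cst. Qed.

Lemma has_pd_sum j I (l : seq I) (F F' : I -> cfun R d) :
  (forall i, has_pd j (F i) (F' i)) ->
  has_pd j (\sum_(i <- l) F i) (\sum_(i <- l) F' i).
Proof.
move=> H; elim: l => [|i l IH]; first by rewrite !big_nil; exact: has_pd0.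
by rewrite !big_cons -[F i]scale1r -[F' i]scale1r; exact: has_pd_lin.
Qed.

Definition pmul phi psi : cfun R d := fun x => (phi x : R[i]) * (psi x : R[i]).

Lemma has_pd_mul j phi phi' psi psi' : has_pd j phi phi' -> has_pd j psi psi' ->
  has_pd j (pmul phi psi) (pmul phi' psi + pmul phi psi').
Proof.
move=> H1 H2 x; have [[A B] [A' B']] := (H1 x, H2 x); split.
  apply: (is_derive_ext _ _ (is_derive_lin 1 (-1) (is_derive_mul A A')
    (is_derive_mul B B'))) => [y|].
      by rewrite reM; ring.
    by rewrite cfunD reD !reM; ring.
apply: (is_derive_ext _ _ (is_derive_lin 1 1 (is_derive_mul A B')
    (is_derive_mul B A'))) => [y|]; rewrite ?cfunD ?imD !imM; ring.
Qed.

Definition refl x phi : cfun R d := fun y => phi (x - y).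

Lemma has_pd_refl j x phi phi' : has_pd j phi phi' ->
  has_pd j (refl x phi) (- refl x phi').
Proof.
have key (u u' : V -> R) y : is_derive (x - y) (e_ j) u (u' (x - y)) ->
    is_derive y (e_ j) (fun z => u (x - z)) (- u' (x - y)).
  move=> H.
  have H0 : is_derive (- (0 : R)) 1 (fun h : R => u ((x - y) + h *: e_ j)) (u' (x - y)).
    by rewrite oppr0; apply: is_derive_line; rewrite scale0r addr0.
  have N : is_derive (0 : R) 1 (-%R : R -> R) (-1) by exact: is_deriveNid.
  apply: is_derive_of_line.
  have -> : (fun h : R => u (x - (y + h *: e_ j))) =
      (fun h : R => u (x - y + h *: e_ j)) \o -%R.
    by apply/funext => h /=; congr u; rewrite scaleNr opprD addrA.
  by apply: (is_derive_eq (is_derive1_comp H0 N)); exact: mulrN1.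
move=> H y; have [A B] := H (x - y); split.
  by rewrite reN; exact: (key (fun z => complex.Re (phi z)) (fun z => complex.Re (phi' z))).
by rewrite imN; exact: (key (fun z => complex.Im (phi z)) (fun z => complex.Im (phi' z))).
Qed.

Definition cconj phi : cfun R d := fun x => ((phi x)^*)%C.

Lemma has_pd_conj j phi phi' : has_pd j phi phi' -> has_pd j (cconj phi) (cconj phi').
Proof.
move=> H x; have [A B] := H x; split.
  by apply: (is_derive_ext _ _ A) => [y|]; rewrite /cconj; [case: (phi y)|case: (phi' x)].
apply: (is_derive_ext _ _ (is_deriveN B)) => [y|]; rewrite /cconj.
  by rewrite -[LHS]/(- complex.Im (phi y)); case: (phi y).
by case: (phi' x).
Qed.

Lemma in_box_le x r r' y : r <= r' -> in_box x r y -> in_box x r' y.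
Proof. by move=> rr' H j; exact: lt_le_trans (H j) rr'. Qed.

(** A common form for linear combinations and products: [g] is the bound for the
    result in terms of bounds for the two arguments. *)
Lemma loc_bounded2 (g : R -> R -> R) phi psi theta :
  (forall a b a' b', 0 <= a -> 0 <= b -> a <= a' -> b <= b' -> g a b <= g a' b') ->
  (forall x, cmod (theta x) <= g (cmod (phi x)) (cmod (psi x))) ->
  loc_bounded phi -> loc_bounded psi -> loc_bounded theta.
Proof.
move=> gm H H1 H2 x; have [C1 C10 [r1 r10 K1]] := H1 x; have [C2 C20 [r2 r20 K2]] := H2 x.
exists (Num.max 0 (g C1 C2)); first by rewrite le_max lexx.
exists (Num.min r1 r2); first by rewrite lt_min r10.
move=> y xy; rewrite le_max; apply/orP; right; apply: le_trans (H y) _.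
apply: gm; rewrite ?cmod_ge0//.
  by apply: K1; apply: in_box_le xy; rewrite ge_min lexx.
by apply: K2; apply: in_box_le xy; rewrite ge_min lexx orbT.
Qed.

Lemma loc_bounded_lin (a : R[i]) phi psi : loc_bounded phi -> loc_bounded psi ->
  loc_bounded (a *: phi + psi).
Proof.
apply: (loc_bounded2 (g := fun b c => cmod a * b + c)).
  by move=> b c b' c' b0 c0 bb cc; rewrite lerD// ler_wpM2l// cmod_ge0.
by move=> x; apply: le_trans (cmodD _ _) _; rewrite cmodM.
Qed.

Lemma loc_bounded_mul phi psi : loc_bounded phi -> loc_bounded psi ->
  loc_bounded (pmul phi psi).
Proof.
apply: (loc_bounded2 (g := fun b c => b * c)).
  by move=> *; rewrite ler_pM.
by move=> x; rewrite cmodM.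
Qed.

Lemma loc_bounded_sum I (l : seq I) (F : I -> cfun R d) :
  (forall i, loc_bounded (F i)) -> loc_bounded (\sum_(i <- l) F i).
Proof.
move=> H; elim: l => [|i l IH].
  by rewrite big_nil => x; exists 0 => //; exists 1 => // y _; rewrite cmod0.
by rewrite big_cons -[F i]scale1r; exact: loc_bounded_lin.
Qed.

Lemma loc_bounded_refl x phi : loc_bounded phi -> loc_bounded (refl x phi).
Proof.
move=> H y; have [C C0 [r r0 K]] := H (x - y); exists C => //; exists r => // z yz.
apply: K => j; rewrite !mxE.
have -> : x 0 j - y 0 j - (x 0 j - z 0 j) = - (y 0 j - z 0 j) by ring.
by rewrite normrN.
Qed.

Lemma smooth_lin_D (a : R[i]) phi psi : smooth phi -> smooth psi ->
  smooth (a *: phi + psi) /\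
  forall s, D s (a *: phi + psi) = a *: D s phi + D s psi.
Proof.
move=> S1 S2; pose F s := a *: D s phi + D s psi.
have Fd s j : has_pd j (F s) (F (j :: s)).
  by apply: has_pd_lin; exact: smooth_has_pd.
split; last exact: (D_of_family Fd).
apply: (smooth_of_family (F := F)) => // s.
by apply: loc_bounded_lin; exact: smooth_loc_bounded.
Qed.

Lemma smooth_lin (a : R[i]) phi psi : smooth phi -> smooth psi -> smooth (a *: phi + psi).
Proof. by move=> S1 S2; case: (smooth_lin_D a S1 S2). Qed.

Lemma D_lin (a : R[i]) phi psi s : smooth phi -> smooth psi ->
  D s (a *: phi + psi) = a *: D s phi + D s psi.
Proof. by move=> S1 S2; case: (smooth_lin_D a S1 S2). Qed.

Lemma smooth0 : smooth (0 : cfun R d).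
Proof.
apply: (smooth_of_family (F := fun=> 0)) => [s x|s j]; last exact: has_pd0.
by exists 0 => //; exists 1 => // y _; rewrite cmod0.
Qed.

Lemma D_zero s : D s (0 : cfun R d) = 0.
Proof. exact: (D_of_family (F := fun=> 0) (fun _ _ => has_pd0 _)). Qed.

Lemma smoothB phi psi : smooth phi -> smooth psi -> smooth (phi - psi).
Proof.
by move=> S1 S2; have := smooth_lin (-1) S2 S1; rewrite scaleN1r addrC.
Qed.

Lemma DB phi psi s : smooth phi -> smooth psi -> D s (phi - psi) = D s phi - D s psi.
Proof.
by move=> S1 S2; have := D_lin (-1) s S2 S1; rewrite !scaleN1r addrC [RHS]addrC.
Qed.

(** The [2 ^ size s] ways of distributing the directions of [s] over the two
    factors of a product. *)
Fixpoint splits s : seq (seq 'I_d * seq 'I_d) :=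
  if s is j :: s' then
    [seq (j :: p.1, p.2) | p <- splits s'] ++ [seq (p.1, j :: p.2) | p <- splits s']
  else [:: ([::], [::])].

Lemma size_splits s : size (splits s) = (2 ^ size s)%N.
Proof. by elim: s => //= j s IH; rewrite size_cat !size_map IH addnn -mul2n expnS. Qed.

Lemma splits_size s p : p \in splits s -> (size p.1 + size p.2 = size s)%N.
Proof.
elim: s p => [|j s IH] p /=; first by rewrite inE => /eqP ->.
rewrite mem_cat => /orP[] /mapP[q /IH E ->] /=; first by rewrite addSn E.
by rewrite addnS E.
Qed.

Lemma smooth_mul_D phi psi : smooth phi -> smooth psi ->
  smooth (pmul phi psi) /\
  forall s, D s (pmul phi psi) = \sum_(p <- splits s) pmul (D p.1 phi) (D p.2 psi).
Proof.
move=> S1 S2; pose F s : cfun R d := \sum_(p <- splits s) pmul (D p.1 phi) (D p.2 psi).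
have F0 : pmul phi psi = F [::] by rewrite /F big_seq1.
have Fd s j : has_pd j (F s) (F (j :: s)).
  have -> : F (j :: s) = \sum_(p <- splits s)
      (pmul (D (j :: p.1) phi) (D p.2 psi) + pmul (D p.1 phi) (D (j :: p.2) psi)).
    by rewrite /F /= big_cat !big_map big_split.
  by apply: has_pd_sum => p; apply: has_pd_mul; exact: smooth_has_pd.
rewrite F0; split; last exact: (D_of_family Fd).
apply: (smooth_of_family (F := F)) => // s; apply: loc_bounded_sum => p.
by apply: loc_bounded_mul; exact: smooth_loc_bounded.
Qed.

Lemma smooth_mul phi psi : smooth phi -> smooth psi -> smooth (pmul phi psi).
Proof. by move=> S1 S2; case: (smooth_mul_D S1 S2). Qed.

Lemma D_mul phi psi s : smooth phi -> smooth psi ->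
  D s (pmul phi psi) = \sum_(p <- splits s) pmul (D p.1 phi) (D p.2 psi).
Proof. by move=> S1 S2; case: (smooth_mul_D S1 S2). Qed.

Lemma smooth_refl_D x phi : smooth phi ->
  smooth (refl x phi) /\
  forall s, D s (refl x phi) = (-1) ^+ size s *: refl x (D s phi).
Proof.
move=> S; pose F s : cfun R d := (-1) ^+ size s *: refl x (D s phi).
have F0 : refl x phi = F [::] by rewrite /F expr0 scale1r.
have Fd s j : has_pd j (F s) (F (j :: s)).
  have := has_pd_lin ((-1) ^+ size s) (has_pd_refl x (smooth_has_pd s j S)) (has_pd0 j).
  by rewrite !addr0 scalerN -scaleNr -[- _ ^+ _]mulN1r -exprS.
rewrite F0; split; last exact: (D_of_family Fd).
apply: (smooth_of_family (F := F)) => // s.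
rewrite /F -[_ *: _]addr0; apply: loc_bounded_lin.
  by apply: loc_bounded_refl; exact: smooth_loc_bounded.
exact: (smooth_loc_bounded [::] smooth0).
Qed.

Lemma smooth_refl x phi : smooth phi -> smooth (refl x phi).
Proof. by move=> S; case: (smooth_refl_D x S). Qed.

Lemma cmod_D_refl x phi s y : smooth phi ->
  cmod (D s (refl x phi) y) = cmod (D s phi (x - y)).
Proof.
move=> /(smooth_refl_D x)[_ ->]; rewrite cmodM.
have -> : cmod ((-1 : R[i]) ^+ size s) = 1.
  elim: (size s) => [|n IH]; first by rewrite expr0 (cmodR 1) normr1.
  by rewrite exprS cmodM IH mulr1 cmodN (cmodR 1) normr1.
by rewrite mul1r.
Qed.

Lemma smooth_conj_D phi : smooth phi ->
  smooth (cconj phi) /\ forall s, D s (cconj phi) = cconj (D s phi).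
Proof.
move=> S; pose F s : cfun R d := cconj (D s phi).
have Fd s j : has_pd j (F s) (F (j :: s)) by apply: has_pd_conj; exact: smooth_has_pd.
split; last exact: (D_of_family Fd).
apply: (smooth_of_family (F := F)) => // s x.
have [C C0 [r r0 K]] := smooth_loc_bounded s S x; exists C => //; exists r => // y /K.
by rewrite cmodJ.
Qed.

Definition shift_by v phi : cfun R d := fun y => phi (y + v).

Lemma shift_byE v phi : shift_by v phi = refl 0 (refl v phi).
Proof. by apply/funext => y; rewrite /refl /shift_by sub0r opprK addrC. Qed.

Lemma smooth_shift_D v phi : smooth phi ->
  smooth (shift_by v phi) /\ forall s, D s (shift_by v phi) = shift_by v (D s phi).
Proof.
move=> S; rewrite shift_byE; have S' := smooth_refl v S.
split; first exact: smooth_refl.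
move=> s; have [_ ->] := smooth_refl_D 0 S'; have [_ ->] := smooth_refl_D v S.
apply/funext => y; rewrite cfunZ /refl cfunZ signrMK /shift_by.
by rewrite sub0r opprK addrC.
Qed.

End SmoothClosure.

(** * Weighted bounds of derivatives *)

Section WeightedBounds.
Context {R : realType} {d : nat}.
Notation V := 'rV[R]_d.
Notation e_ j := (delta_mx 0 j : 'rV[R]_d).
Implicit Types (M : nat -> R) (h c : R) (w : V -> R) (phi psi : cfun R d)
  (x y : V) (s : seq 'I_d).

(** Upper bounds [c] of the norm of [phi] replace the norm itself, which avoids
    suprema and infinite values. *)
Record bd M h w phi c : Prop := Bd { bd_apply :> forall s x,
  h ^+ size s * cmod (D s phi x) * w x <= c * M (size s) }.

Definition multi_seq (alpha : 'I_d -> nat) :=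
  flatten [seq nseq (alpha j) j | j <- enum 'I_d].

Lemma mderivE alpha phi : mderiv alpha phi = D (multi_seq alpha) phi.
Proof.
rewrite /mderiv /multi_seq; elim: (enum 'I_d) => //= j l IH.
by rewrite D_cat -IH; elim: (alpha j) => //= n ->.
Qed.

Lemma size_multi_seq alpha : size (multi_seq alpha) = mlen alpha.
Proof.
rewrite /mlen size_flatten /shape -map_comp sumnE big_map big_enum /=.
by apply: eq_bigr => i _; rewrite size_nseq.
Qed.

Lemma perm_multi_seq s : perm_eq (multi_seq (fun j => count_mem j s)) s.
Proof.
apply/allP => i _; apply/eqP; rewrite count_flatten -map_comp sumnE big_map big_enum /=.
rewrite (bigD1 i)//= big1 ?addn0 ?count_nseq /= ?eqxx ?mul1n// => j ji.
by rewrite count_nseq /= (negPf ji).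
Qed.

(** By the symmetry of the derivatives every sequence of directions may be sorted
    into the one that belongs to a multi-index. *)
Lemma Bnorm_le M h w phi c : (forall p, 0 < M p) -> smooth phi ->
  (Bnorm M h w phi <= c%:E)%E <-> bd M h w phi c.
Proof.
move=> M0 S; split=> [H|H]; first split=> s x.
  rewrite -ler_pdivrMr// -lee_fin; apply: le_trans H.
  pose al j := count_mem j s.
  apply: le_trans (ereal_sup_ubound _); last by exists al.
  apply: ereal_sup_ubound; exists x => //=; rewrite -size_multi_seq mderivE.
  by rewrite (D_perm S (perm_multi_seq s)) (perm_size (perm_multi_seq s)).
apply: ge_ereal_sup => _ [al _ <-]; apply: ge_ereal_sup => _ [x _ <-].
rewrite lee_fin ler_pdivrMr// mderivE -size_multi_seq; exact: H.
Qed.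

Lemma bd_ge0 M h w phi c : 0 < M 0%N -> (forall x, 0 <= w x) -> bd M h w phi c -> 0 <= c.
Proof.
move=> M0 w0 B; have := B [::] 0; rewrite expr0 mul1r => H.
have : 0 <= c * M 0%N by apply: le_trans H; rewrite mulr_ge0 ?cmod_ge0.
by rewrite pmulr_lge0.
Qed.

Lemma bd_weaken M h h' w w' K phi c : 0 <= h -> h <= h' -> 0 <= K ->
  (forall x, 0 <= w x) -> (forall x, 0 <= w' x) -> (forall x, w x <= K * w' x) ->
  bd M h' w' phi c -> bd M h w phi (K * c).
Proof.
move=> h0 hh K0 w0 w0' ww H; split=> s x.
apply: (@le_trans _ _ (K * (h' ^+ size s * cmod (D s phi x) * w' x))); last first.
  by rewrite -[leRHS]mulrA ler_wpM2l//; exact: H.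
rewrite [leRHS]mulrCA; apply: ler_pM; rewrite ?mulr_ge0 ?exprn_ge0 ?cmod_ge0//.
rewrite ler_wpM2r ?cmod_ge0// lerXn2r// nnegrE; exact: le_trans hh.
Qed.

Lemma bd_mono M h h' w w' phi c : 0 <= h -> h <= h' ->
  (forall x, 0 <= w x) -> (forall x, w x <= w' x) ->
  bd M h' w' phi c -> bd M h w phi c.
Proof.
move=> h0 hh w0 ww H; rewrite -[c]mul1r; apply: bd_weaken H => // x.
  exact: le_trans (ww x).
by rewrite mul1r.
Qed.

Lemma bd_eqw M h w w' phi c : w =1 w' -> bd M h w phi c -> bd M h w' phi c.
Proof. by move=> /funext ->. Qed.

Lemma bd_le M h w phi c c' : (forall p, 0 < M p) -> c <= c' ->
  bd M h w phi c -> bd M h w phi c'.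
Proof.
by move=> M0 cc H; split=> s x; apply: le_trans (H s x) _; rewrite ler_pM2r.
Qed.

Lemma bd_lin M h w (a : R[i]) phi psi c c' : smooth phi -> smooth psi ->
  0 <= h -> (forall x, 0 <= w x) ->
  bd M h w phi c -> bd M h w psi c' -> bd M h w (a *: phi + psi) (cmod a * c + c').
Proof.
move=> S1 S2 h0 w0 H1 H2; split=> s x; rewrite D_lin// cfunD cfunZ.
apply: (@le_trans _ _ (cmod a * (h ^+ size s * cmod (D s phi x) * w x) +
                      h ^+ size s * cmod (D s psi x) * w x)).
  have -> : cmod a * (h ^+ size s * cmod (D s phi x) * w x) +
      h ^+ size s * cmod (D s psi x) * w x =
      h ^+ size s * (cmod a * cmod (D s phi x) + cmod (D s psi x)) * w x by ring.
  rewrite ler_wpM2r// ler_wpM2l ?exprn_ge0//.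
  by apply: le_trans (cmodD _ _) _; rewrite cmodM.
rewrite mulrDl -[X in _ <= X + _]mulrA; apply: lerD; last exact: H2.
by rewrite ler_wpM2l ?cmod_ge0//; exact: H1.
Qed.

Lemma bd_zero M h w : bd M h w (0 : cfun R d) 0.
Proof. by split=> s x; rewrite D_zero cmod0 mulr0 !mul0r. Qed.

Lemma bdZ M h w (a : R[i]) phi c : smooth phi -> 0 <= h -> (forall x, 0 <= w x) ->
  bd M h w phi c -> bd M h w (a *: phi) (cmod a * c).
Proof.
move=> S h0 w0 H; rewrite -[a *: phi]addr0 -[_ * c]addr0.
by apply: (bd_lin a S smooth0 h0 w0 H); exact: bd_zero.
Qed.

Lemma bd_conj M h w phi c : smooth phi -> bd M h w phi c -> bd M h w (cconj phi) c.
Proof.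
by move=> /smooth_conj_D[_ DE] H; split=> s x; rewrite DE cmodJ; exact: H.
Qed.

Lemma bd_refl M h w w' K v phi c : smooth phi -> 0 <= h -> 0 <= K ->
  (forall x, w x <= K * w' (v - x)) ->
  bd M h w' phi c -> bd M h w (refl v phi) (K * c).
Proof.
move=> S h0 K0 ww H; split=> s x; rewrite cmod_D_refl//.
apply: le_trans (ler_wpM2l _ (ww x)) _; first by rewrite mulr_ge0 ?exprn_ge0 ?cmod_ge0.
by rewrite mulrCA -[leRHS]mulrA ler_wpM2l//; exact: H.
Qed.

(** In the Leibniz rule the [2 ^ size s] terms are absorbed by doubling [h], and
    logarithmic convexity merges the two factors [M]. *)
Lemma bd_mul M h w w1 w2 K phi psi c1 c2 :
  weight_sequence M -> cond_M1 M -> smooth phi -> smooth psi -> 0 <= h -> 0 <= K ->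
  (forall x, 0 <= w1 x) -> (forall x, 0 <= w2 x) ->
  (forall x, w x <= K * (w1 x * w2 x)) ->
  bd M (2 * h) w1 phi c1 -> bd M (2 * h) w2 psi c2 ->
  bd M h w (pmul phi psi) (M 0%N * K * (c1 * c2)).
Proof.
move=> hM hM1 S1 S2 h0 K0 w10 w20 ww H1 H2; split=> s x.
have M0 p := wseq_gt0 p hM.
have c10 := bd_ge0 (M0 _) w10 H1; have c20 := bd_ge0 (M0 _) w20 H2.
rewrite D_mul// fct_sumE.
apply: le_trans (ler_wpM2l _ (ww x)) _; first by rewrite mulr_ge0 ?exprn_ge0 ?cmod_ge0.
have -> : h ^+ size s * cmod (\sum_(p <- splits s) pmul (D p.1 phi) (D p.2 psi) x) *
    (K * (w1 x * w2 x)) =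
  K * (h ^+ size s * cmod (\sum_(p <- splits s) pmul (D p.1 phi) (D p.2 psi) x) *
     (w1 x * w2 x)) by ring.
have -> : M 0%N * K * (c1 * c2) * M (size s) = K * (c1 * c2 * (M 0%N * M (size s))) by ring.
rewrite ler_wpM2l//.
apply: (@le_trans _ _ (\sum_(p <- splits s) h ^+ size s *
    (cmod (D p.1 phi x) * cmod (D p.2 psi x)) * (w1 x * w2 x))).
  rewrite -mulr_suml -mulr_sumr ler_wpM2r ?mulr_ge0// ler_wpM2l ?exprn_ge0//.
  by apply: le_trans (cmod_sum _ _ _) _; apply: ler_sum => p _; rewrite cmodM.
have -> : c1 * c2 * (M 0%N * M (size s)) =
    \sum_(p <- splits s) (2 ^+ size s)^-1 * (c1 * c2 * (M 0%N * M (size s))).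
  rewrite big_const_seq count_predT size_splits iter_addr addr0 -[_ *+ (2 ^ _)%N]mulr_natl natrX.
  by rewrite mulVKf// expf_neq0// pnatr_eq0.
rewrite big_seq [leRHS]big_seq; apply: ler_sum => p /splits_size sp.
rewrite ler_pdivlMl ?exprn_gt0//.
have -> : 2 ^+ size s * (h ^+ size s * (cmod (D p.1 phi x) * cmod (D p.2 psi x)) * (w1 x * w2 x)) =
   ((2 * h) ^+ size p.1 * cmod (D p.1 phi x) * w1 x) *
   ((2 * h) ^+ size p.2 * cmod (D p.2 psi x) * w2 x).
  by rewrite -sp !exprMn !exprD; ring.
have h20 : 0 <= 2 * h by rewrite mulr_ge0.
apply: (@le_trans _ _ ((c1 * M (size p.1)) * (c2 * M (size p.2)))).
  by apply: ler_pM; [| |exact: H1|exact: H2]; rewrite ?mulr_ge0 ?exprn_ge0 ?cmod_ge0.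
have := M1_mul (size p.1) (size p.2) hM hM1; rewrite sp => MM.
apply: le_trans (ler_wpM2l (mulr_ge0 c10 c20) MM).
by apply: le_of_eq; ring.
Qed.

(** (M.2) splits [M (size t + size s)]. The explicit dependence of the constant on
    [s] matters: it is what bounds all the derivatives of a convolution at once. *)
Lemma bd_D M C0 H h w phi c s : (forall p q, M (p + q)%N <= C0 * H ^+ (p + q) * M p * M q) ->
  0 < h -> 0 < H -> 0 <= c -> (forall x, 0 <= w x) ->
  bd M (h * H) w phi c -> bd M h w (D s phi) (c * (C0 * M (size s) / h ^+ size s)).
Proof.
move=> M2 h0 H0 c0 w0 B; split=> t x; rewrite -D_cat.
have := B (t ++ s) x; rewrite size_cat => Bx.
have hH : 0 < (H * h) ^+ size s * H ^+ size t by rewrite mulr_gt0 ?exprn_gt0 ?mulr_gt0.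
rewrite -(ler_pM2l hH).
apply: le_trans (_ : c * M (size t + size s)%N <= _).
  apply: le_trans Bx; rewrite exprD !exprMn.
  by apply: le_of_eq; ring.
apply: le_trans (ler_wpM2l c0 (M2 _ _)) _.
apply: le_of_eq; rewrite exprMn exprD; field.
by rewrite expf_neq0// gt_eqF.
Qed.

Lemma bd_pointwise M h w phi c s x : 0 < h -> 1 <= w x ->
  bd M h w phi c -> cmod (D s phi x) <= c * (M (size s) / h ^+ size s).
Proof.
move=> h0 w1 H; rewrite mulrA ler_pdivlMr ?exprn_gt0// mulrC.
apply: le_trans (H s x); rewrite ler_peMr// mulr_ge0 ?cmod_ge0 ?exprn_ge0// ltW//.
Qed.

End WeightedBounds.

(** * Duals of projective and inductive limits *)

Section AbstractDuality.
Context {R : realType} {V : lmodType R[i]}.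
Implicit Types (E : lcs V) (f : V -> R[i]).

Definition linear_on (E : V -> Prop) f :=
  forall (a : R[i]) x y, E x -> E y -> f (a *: x + y) = a * f x + f y.

Definition subspace (E : V -> Prop) :=
  E 0 /\ forall (a : R[i]) x y, E x -> E y -> E (a *: x + y).

Lemma subspaceZ (E : V -> Prop) (a : R[i]) x : subspace E -> E x -> E (a *: x).
Proof. by move=> [E0 EL] Ex; rewrite -[_ *: _]addr0; apply: EL. Qed.

Lemma subspaceB (E : V -> Prop) x y : subspace E -> E x -> E y -> E (x - y).
Proof. by move=> [_ EL] Ex Ey; rewrite addrC -scaleN1r; exact: EL. Qed.

Lemma linear_on0 (E : V -> Prop) f : subspace E -> linear_on E f -> f 0 = 0.
Proof.
move=> [E0 _] L; have := L 1 0 0 E0 E0; rewrite scaler0 addr0 mul1r => /eqP.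
by rewrite -subr_eq0 opprD addNKr oppr_eq0 => /eqP.
Qed.

Lemma linear_onZ (E : V -> Prop) f a x : subspace E -> linear_on E f -> E x ->
  f (a *: x) = a * f x.
Proof.
by move=> S L Ex; rewrite -[a *: x]addr0 L ?(linear_on0 S L) ?addr0//; case: S.
Qed.

Lemma linear_onB (E : V -> Prop) f x y : subspace E -> linear_on E f -> E x -> E y ->
  f (x - y) = f x - f y.
Proof.
by move=> S L Ex Ey; rewrite -scaleN1r addrC L// mulN1r addrC.
Qed.

Lemma linear_on_sum (E : V -> Prop) f I (l : seq I) (F : I -> V) :
  subspace E -> linear_on E f -> (forall i, E (F i)) ->
  E (\sum_(i <- l) F i) /\ f (\sum_(i <- l) F i) = \sum_(i <- l) f (F i).
Proof.
move=> S L EF; elim: l => [|i l [IE IH]].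
  by rewrite !big_nil (linear_on0 S L); case: S.
rewrite !big_cons; split; first by rewrite -[F i]scale1r; apply: S.2.
by rewrite -[F i]scale1r L// scale1r mul1r IH.
Qed.

(** The topology of a directed family of seminorms that are given by their upper
    bounds: [b i x c] stands for [|x|_i <= c]. *)
Definition normed_by I (J : set I) (b : I -> V -> R -> Prop) E :=
  forall U : set V, nbhs0 E U <->
    exists i (r : R), [/\ J i, 0 < r & forall x, E x -> forall c, b i x c -> c < r -> U x].

Definition seminorm_bounds I (J : set I) (b : I -> V -> R -> Prop) (E : V -> Prop) :=
  forall i x c, J i -> E x ->
  b i x c -> 0 <= c /\ forall a : R[i], b i (a *: x) (cmod a * c).

Lemma lim0P E f (H : forall U U' : set V, U `<=` U' -> nbhs0 E U -> nbhs0 E U') :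
  ((f : V -> R[i]^o) @ nbhs0 E --> (0 : R[i]^o)) <->
  forall e : R, 0 < e -> nbhs0 E [set x | cmod (f x) < e].
Proof.
split=> [C e e0|C U].
  have : nbhs (0 : R[i]^o) [set z | cmod z < e].
    apply/nbhs_ballP; exists e%:C; rewrite /= ?ltcR// => z.
    by rewrite /ball /= sub0r normrN norm_cmod ltcR.
  by move/C; apply: H.
move=> /nbhs_ballP[_ /complex_gt0P[e e0 ->] HU].
apply: (H [set x | cmod (f x) < e]); last exact: C.
by move=> x /= fx; apply: HU; rewrite /ball /= sub0r normrN norm_cmod ltcR.
Qed.

Lemma normed_by_up I J b E : @normed_by I J b E ->
  forall U U' : set V, U `<=` U' -> nbhs0 E U -> nbhs0 E U'.
Proof.
move=> N U U' UU /N[i [r [Ji r0 H]]]; apply/N; exists i, r; split => // x Ex c bc cr.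
by apply: UU; exact: H bc cr.
Qed.

(** Homogeneity, applied to the multiples of [x] inside the ball; the bound [c] is
    first enlarged by a small amount, because it may be zero. *)
Lemma bound_of_ball I (J : set I) (b : I -> V -> R -> Prop) (E : V -> Prop) f i (r : R) :
  subspace E -> seminorm_bounds J b E -> linear_on E f -> J i -> 0 < r ->
  (forall x, E x -> forall c, b i x c -> c < r -> cmod (f x) <= 1) ->
  forall x c, E x -> b i x c -> cmod (f x) <= 2 / r * c.
Proof.
move=> S B L Ji r0 H x c Ex bc; have [c0 bZ] := B _ _ _ Ji Ex bc.
apply/ler_addgt0Pr => e e0.
pose c' := c + e * r / 2; have c'0 : 0 < c' by rewrite ltr_wpDl// !mulr_gt0// invr_gt0.
pose a := r / (2 * c'); have a0 : 0 < a by rewrite divr_gt0// mulr_gt0.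
have := H (a%:C *: x) (subspaceZ _ S Ex) _ (bZ _).
rewrite (linear_onZ _ S L Ex) cmodM cmodR gtr0_norm//.
have ac : a * c < r.
  rewrite /a mulrAC ltr_pdivrMr ?mulr_gt0// ltr_pM2l// /c'.
  have : 0 < e * r / 2 by rewrite !mulr_gt0// invr_gt0.
  lra.
move=> /(_ ac); rewrite mulrC -ler_pdivlMr// mul1r; move=> fx; apply: le_trans fx _.
rewrite /a invf_div /c' mulrDr; apply: le_of_eq.
by field; rewrite gt_eqF.
Qed.

Lemma dual_normed_by I J b E f : @normed_by I J b E -> subspace E ->
  seminorm_bounds J b E ->
  lcs_dual E f <-> linear_on E f /\ exists i (C : R), [/\ J i, 0 <= C &
    forall x c, E x -> b i x c -> cmod (f x) <= C * c].
Proof.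
move=> N S B; split=> [[L /(lim0P _ (normed_by_up N)) C]|[L [i [C [Ji C0 H]]]]].
  split => //; have /N[i [r [Ji r0 H]]] := C 1 ltr01.
  exists i, (2 / r); split => //; first by rewrite divr_ge0// ltW.
  by apply: (bound_of_ball S B) => // x Ex c bc cr; apply/ltW; exact: H bc cr.
split => //; apply/(lim0P _ (normed_by_up N)) => e e0; apply/N; exists i, (e / (C + 1)).
have C1 : 0 < C + 1 by rewrite ltr_wpDl.
split => //; first by rewrite divr_gt0.
move=> x Ex c bc; rewrite /= ltr_pdivlMr// => ce.
apply: le_lt_trans (H _ _ Ex bc) _; apply: le_lt_trans ce.
by rewrite mulrC ler_wpM2l ?lerDl//; case: (B _ _ _ Ji Ex bc).
Qed.

(** If [f] is continuous on the steps, the absolutely convex set where [|f|] is at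
    most [e / 2] is a neighbourhood of zero in the inductive limit. *)
Lemma dual_ind_limit K (T : set K) (E : K -> lcs V) I (J : K -> set I) b f :
  (forall k, T k -> normed_by (J k) (b k) (E k)) ->
  (forall k, T k -> subspace (E k)) ->
  (forall k, T k -> seminorm_bounds (J k) (b k) (E k)) ->
  subspace (ind_limit T E) ->
  lcs_dual (ind_limit T E) f <-> linear_on (ind_limit T E) f /\
    forall k, T k -> exists i (C : R), [/\ J k i, 0 <= C &
    forall x c, E k x -> b k i x c -> cmod (f x) <= C * c].
Proof.
move=> N S B ES.
have up (U U' : set V) : U `<=` U' -> nbhs0 (ind_limit T E) U -> nbhs0 (ind_limit T E) U'.
  by move=> UU [W HW HU]; exists W => // x /HU/UU.
split=> [[L /(lim0P _ up) C]|[L H]].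
  split => // k Tk; have [W [_ /(_ k Tk)/(N k Tk)[i [r [Ji r0 H]]]] WU] := C 1 ltr01.
  exists i, (2 / r); split => //; first by rewrite divr_ge0// ltW.
  move=> x c; apply: (bound_of_ball (S k Tk) (B k Tk)) => //.
    by move=> a y z Ey Ez; apply: L; exists k.
  move=> y Ey c' bc cr; apply/ltW; apply: WU; split; first exact: H bc cr.
  by exists k.
split => //; apply/(lim0P _ up) => e e0.
exists [set x | (ind_limit T E) x /\ cmod (f x) <= e / 2]; last first.
  by move=> x [[_ fx] _] /=; apply: le_lt_trans fx _; lra.
split.
  move=> a a' x y; rewrite !norm_cmod -rmorphD /= -[1]/(1%:C) lecR => aa [Ex fx] [Ey fy].
  have E'y : ind_limit T E (a' *: y) by exact: subspaceZ.
  split; first exact: ES.2.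
  rewrite L//; rewrite (linear_onZ _ ES L Ey).
  apply: le_trans (cmodD _ _) _; rewrite !cmodM.
  apply: (@le_trans _ _ (cmod a * (e / 2) + cmod a' * (e / 2))).
    by rewrite lerD// ler_wpM2l// cmod_ge0.
  by rewrite -mulrDl ler_piMl//; lra.
move=> k Tk; have [i [C [Ji C0 Hk]]] := H k Tk; apply/(N k Tk).
have C1 : 0 < C + 1 by rewrite ltr_wpDl.
exists i, (e / 2 / (C + 1)); split => //; first by rewrite !divr_gt0.
move=> x Ex c bc; rewrite ltr_pdivlMr// => ce; split; first by exists k.
apply: le_trans (Hk _ _ Ex bc) _; apply: le_trans (ltW ce).
by rewrite mulrC ler_wpM2l ?lerDl//; case: (B k Tk _ _ _ Ji Ex bc).
Qed.

End AbstractDuality.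

Section StepSpaces.
Context {R : realType} {d : nat}.
Notation V := 'rV[R]_d.
Context (M : nat -> R).
Hypothesis M0 : forall p, 0 < M p.
Implicit Types (h c : R) (w : V -> R) (phi psi : cfun R d).

Lemma Bspace_mem h w phi : Bspace M h w phi <-> smooth phi /\ exists c, bd M h w phi c.
Proof.
split=> [[S N]|[S [c B]]].
  split => //; case E : (Bnorm M h w phi) => [r| |].
  - by exists r; apply/Bnorm_le; rewrite // E.
  - by rewrite E in N.
  - by exists 0; apply/Bnorm_le; rewrite // E leNye.
by split => //; apply: le_lt_trans (ltry c); exact: ((Bnorm_le _ _ _ M0 S).2 B).
Qed.

Lemma Bspace_nbhs h w (U : set (cfun R d)) : nbhs0 (Bspace M h w) U <->
  exists2 r : R, 0 < r & forall phi, smooth phi -> forall c, bd M h w phi c -> c < r -> U phi.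
Proof.
split=> [[r r0 H]|[r r0 H]].
  exists r => // phi S c B cr; apply: H; split; first by apply/Bspace_mem; split=> //; exists c.
  apply: (@le_lt_trans _ _ c%:E); last by rewrite lte_fin.
  exact: ((Bnorm_le _ _ _ M0 S).2 B).
exists (r / 2); first by rewrite /= divr_gt0.
move=> phi [[S _] N]; apply: (H _ S (r / 2)); last by rewrite ltr_pdivrMr//; lra.
by apply/Bnorm_le => //; exact: ltW.
Qed.

Lemma Bspace_normed_by h w : normed_by [set: unit] (fun=> bd M h w) (Bspace M h w).
Proof.
move=> U; rewrite Bspace_nbhs; split=> [[r r0 H]|[_ [r [_ r0 H]]]].
  by exists tt, r; split => // phi /Bspace_mem[S _] c; exact: H.
exists r => // phi S c B cr; apply: (H phi _ c B cr).
by apply/Bspace_mem; split => //; exists c.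
Qed.

Lemma bd_seminorm I (J : set I) (h : I -> R) (w : I -> V -> R) (E : cfun R d -> Prop) :
  (forall i, J i -> 0 <= h i) -> (forall i x, 0 <= w i x) ->
  (forall phi, E phi -> smooth phi) ->
  seminorm_bounds J (fun i => bd M (h i) (w i)) E.
Proof.
move=> h0 w0 ES i phi c Ji Ephi B; split; first by apply: bd_ge0 B => //; exact: w0.
by move=> a; apply: bdZ => //; [exact: ES|exact: h0].
Qed.

Lemma Bspace_subspace h w : 0 <= h -> (forall x, 0 <= w x) -> subspace (Bspace M h w).
Proof.
move=> h0 w0; split.
  apply/Bspace_mem; split; first exact: smooth0.
  by exists 0; exact: bd_zero.
move=> a phi psi /Bspace_mem[S1 [c1 B1]] /Bspace_mem[S2 [c2 B2]]; apply/Bspace_mem.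
by split; [exact: smooth_lin|exists (cmod a * c1 + c2); exact: bd_lin].
Qed.

Section Projective.
Context (I : Type) (J : set I) (h : I -> R) (w : I -> V -> R).
Hypothesis J0 : exists i, J i.
Hypothesis h0 : forall i, J i -> 0 <= h i.
Hypothesis w0 : forall i x, 0 <= w i x.
Hypothesis directed : forall i j, J i -> J j -> exists k, J k /\
  forall phi c, bd M (h k) (w k) phi c -> bd M (h i) (w i) phi c /\ bd M (h j) (w j) phi c.

Let E := proj_limit J (fun i => Bspace M (h i) (w i)).

Let projE phi : E phi = forall i, J i -> Bspace M (h i) (w i) phi.
Proof. by []. Qed.

Lemma proj_mem phi : E phi <-> smooth phi /\ forall i, J i -> exists c, bd M (h i) (w i) phi c.
Proof.
rewrite projE; split=> [H|[S H] i Ji]; last by apply/Bspace_mem; split=> //; exact: H.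
split; first by have [i Ji] := J0; case/Bspace_mem: (H i Ji).
by move=> i Ji; case/Bspace_mem: (H i Ji).
Qed.

Lemma proj_subspace : subspace E.
Proof.
split; first by rewrite projE => i Ji; case: (Bspace_subspace (h0 Ji) (w0 i)).
move=> a x y; rewrite !projE => Ex Ey i Ji.
have [_ H] := Bspace_subspace (h0 Ji) (w0 i).
by apply: H; [exact: Ex|exact: Ey].
Qed.

(** As the family is directed, the sets that contain a ball for one of the
    seminorms already form a filter, so that no finite intersections are needed. *)
Lemma proj_normed_by : normed_by J (fun i => bd M (h i) (w i)) E.
Proof.
move=> U; have nbhsE : nbhs0 E U = smallest (@Filter (cfun R d))
    (\bigcup_(i in J) nbhs0 (Bspace M (h i) (w i))) [set x | E x -> U x] by [].
rewrite nbhsE; split.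
  pose G : set_system (cfun R d) := [set W | exists i (r : R), [/\ J i, 0 < r &
    forall phi, smooth phi -> forall c, bd M (h i) (w i) phi c -> c < r -> W phi]].
  have FG : Filter G.
    split.
    - by have [i Ji] := J0; exists i, 1; split.
    - move=> A B [i [r [Ji r0 HA]]] [j [r' [Jj r'0 HB]]].
      have [k [Jk Hk]] := directed Ji Jj; exists k, (Num.min r r'); split => //.
        by rewrite lt_min r0.
      move=> phi S c /Hk[Bi Bj]; rewrite lt_min => /andP[cr cr'].
      by split; [exact: HA Bi cr|exact: HB Bj cr'].
    - move=> A B AB [i [r [Ji r0 HA]]]; exists i, r; split => // phi S c Bc cr.
      by apply: AB; exact: HA Bc cr.
  have incl : \bigcup_(i in J) nbhs0 (Bspace M (h i) (w i)) `<=` G.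
    by move=> W [i Ji] /Bspace_nbhs[r r0 H]; exists i, r.
  move=> /(smallest_sub FG incl)[i [r [Ji r0 H]]].
  exists i, r; split => // phi Ephi c B cr.
  have [S _] := (proj_mem phi).1 Ephi; exact: (H phi S c B cr Ephi).
move=> [i [r [Ji r0 H]]].
apply: sub_gen_smallest; exists i => //; apply/Bspace_nbhs; exists r => // phi S c B cr Ephi.
exact: H B cr.
Qed.

End Projective.
End StepSpaces.

(** * The spaces and their duals in terms of bounds *)

Definition growing_weight (R : realType) d (A : nat -> R) h (x : 'rV[R]_d) :=
  expR (assoc_funV A (h *: x)).
Definition decaying_weight (R : realType) d (B : nat -> R) k (x : 'rV[R]_d) :=
  expR (- assoc_funV B (k *: x)).

Section Duals.
Context {R : realType} {d : nat} (M A B : nat -> R).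
Notation V := 'rV[R]_d.
Hypothesis hM : weight_sequence M.
Hypothesis hA : weight_sequence A.
Hypothesis hB : weight_sequence B.
Implicit Types (h k c : R) (phi chi : cfun R d) (f : cfun R d -> R[i]).

Let M0 p : 0 < M p := wseq_gt0 p hM.

(** The bounds that define the steps of the test spaces and of the spaces of
    functions of moderate growth. *)
Definition gsb (W : nat -> R) h phi c := bd M h (weight W h) phi c.
Definition ocb (W : nat -> R) h k phi c := bd M h (fun x => (weight W k x)^-1) phi c.

Lemma inv_weight_ge0 (W : nat -> R) k (x : V) : 0 <= (weight W k x)^-1.
Proof. by rewrite invr_ge0 ltW// weight_gt0. Qed.

Lemma gsb_mono (W : nat -> R) (hW : weight_sequence W) h h' phi c : 0 <= h -> h <= h' ->
  gsb W h' phi c -> gsb W h phi c.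
Proof.
move=> h0 hh; exact: (bd_mono h0 hh (fun x => ltW (weight_gt0 W h x))
  (fun x => weight_mono x hW h0 hh)).
Qed.

Lemma ocb_mono (W : nat -> R) (hW : weight_sequence W) h h' k k' phi c :
  0 <= h -> h <= h' -> 0 <= k' -> k' <= k -> ocb W h' k' phi c -> ocb W h k phi c.
Proof.
move=> h0 hh k0 kk; apply: (bd_mono h0 hh (fun x => inv_weight_ge0 W k x)) => x.
by rewrite lef_pV2 ?posrE ?weight_gt0//; exact: weight_mono.
Qed.

Notation wG := (growing_weight A).
Notation wO := (decaying_weight B).

Let wGE h : 0 < h -> wG h = weight A h :> (V -> R).
Proof. by move=> h0; apply/funext => x; rewrite /growing_weight weightE// ltW. Qed.

Let wG_gsb h phi c : 0 < h -> bd M h (wG h) phi c <-> gsb A h phi c.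
Proof. by move=> h0; rewrite (wGE h0). Qed.

Lemma GS_Beurling (W : nat -> R) phi : GS Beurling M W phi <->
  smooth phi /\ forall h, 0 < h -> exists c, gsb W h phi c.
Proof.
have -> : GS Beurling M W phi = forall h, 0 < h ->
  Bspace M h (fun x => expR (assoc_funV W (h *: x))) phi by [].
split=> [H|[S H] h h0].
  split; first by have /(Bspace_mem M0)[] := H 1 ltr01.
  move=> h h0; have /(Bspace_mem M0)[_ [c Hc]] := H h h0; exists c.
  by apply: bd_eqw Hc => x; rewrite weightE// ltW.
apply/(Bspace_mem M0); split => //; have [c Hc] := H h h0; exists c.
by apply: bd_eqw Hc => x; rewrite weightE// ltW.
Qed.

Lemma GS_Roumieu (W : nat -> R) phi : GS Roumieu M W phi <->
  smooth phi /\ exists2 h, 0 < h & exists c, gsb W h phi c.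
Proof.
split=> [[h h0 /(Bspace_mem M0)[S [c H]]]|[S [h h0 [c H]]]].
  split => //; exists h => //; exists c.
  by apply: bd_eqw H => x; rewrite weightE// ltW.
exists h => //; apply/(Bspace_mem M0); split => //; exists c.
by apply: bd_eqw H => x; rewrite weightE// ltW.
Qed.

Lemma GS_smooth cl (W : nat -> R) phi : GS cl M W phi -> smooth phi.
Proof. by case: cl; [case/GS_Beurling|case/GS_Roumieu]. Qed.

Let dirG i j : 0 < i -> 0 < j -> exists k, 0 < k /\
  forall phi c, bd M k (wG k) phi c -> bd M i (wG i) phi c /\ bd M j (wG j) phi c.
Proof.
move=> i0 j0; exists (Num.max i j); split; first by rewrite lt_max i0.
have m0 : 0 < Num.max i j by rewrite lt_max i0.
move=> phi c; rewrite (wGE m0) (wGE i0) (wGE j0) => H.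
by split; apply: gsb_mono H; rewrite ?(ltW i0) ?(ltW j0) ?le_max ?lexx ?orbT.
Qed.

Let wG0 h (x : V) : 0 <= wG h x. Proof. exact/ltW/expR_gt0. Qed.
Let pos1 : exists h : R, 0 < h. Proof. by exists 1. Qed.
Let posW (h : R) : 0 < h -> 0 <= h. Proof. exact: ltW. Qed.

Lemma GS_subspace cl : subspace (GS cl M A : lcs (cfun R d)).
Proof.
case: cl; first exact: (proj_subspace (h := id) M0 (J := [set h : R | 0 < h]) posW wG0).
split.
  apply/GS_Roumieu; split; first exact: smooth0.
  by exists 1 => //; exists 0; exact: bd_zero.
move=> a phi psi /GS_Roumieu[S1 [h1 h10 [c1 H1]]] /GS_Roumieu[S2 [h2 h20 [c2 H2]]].
have m0 : 0 < Num.min h1 h2 by rewrite lt_min h10.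
apply/GS_Roumieu; split; first exact: smooth_lin.
exists (Num.min h1 h2) => //; exists (cmod a * c1 + c2).
have m1 : Num.min h1 h2 <= h1 by rewrite ge_min lexx.
have m2 : Num.min h1 h2 <= h2 by rewrite ge_min lexx orbT.
exact: (bd_lin a S1 S2 (ltW m0) (fun x => ltW (weight_gt0 A _ x))
  (gsb_mono hA (ltW m0) m1 H1) (gsb_mono hA (ltW m0) m2 H2)).
Qed.

Lemma dual_GS_Beurling f : lcs_dual (GS Beurling M A) f <->
  linear_on (GS Beurling M A : lcs (cfun R d)) f /\ exists h C, [/\ 0 < h, 0 <= C &
    forall phi c, GS Beurling M A phi -> gsb A h phi c -> cmod (f phi) <= C * c].
Proof.
have := dual_normed_by f (proj_normed_by M0 (h := id) pos1 dirG)
   (GS_subspace Beurling).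
move=> /(_ _) -> /=; last by apply: bd_seminorm => // phi; exact: (@GS_smooth Beurling).
split=> [] [L [h [C [h0 C0 H]]]]; (split; first exact: L).
  exists h, C; split; [exact: h0|exact: C0|] => phi c G Hc.
  exact: (H phi c G ((wG_gsb _ _ h0).2 Hc)).
exists h, C; split; [exact: h0|exact: C0|] => phi c G Hc.
exact: (H phi c G ((wG_gsb _ _ h0).1 Hc)).
Qed.

Lemma dual_GS_Roumieu f : lcs_dual (GS Roumieu M A) f <->
  linear_on (GS Roumieu M A : lcs (cfun R d)) f /\ forall h, 0 < h -> exists2 C, 0 <= C &
    forall phi c, smooth phi -> gsb A h phi c -> cmod (f phi) <= C * c.
Proof.
have := @dual_ind_limit _ _ _ [set h : R | 0 < h] (fun h => Bspace M h (wG h)) _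
   (fun=> [set: unit]) (fun h _ => bd M h (wG h)) f
   (fun h _ => Bspace_normed_by M0 h (wG h)) _ _ (GS_subspace Roumieu).
move=> /(_ _ _) -> /=; first last.
- move=> h h0; exact: (bd_seminorm M0 (fun _ _ => ltW h0) (fun=> wG0 h)
    (fun phi H => ((Bspace_mem M0 _ _ phi).1 H).1)).
- by move=> h h0; exact: (Bspace_subspace M0 (ltW h0) (wG0 h)).
split=> [] [L H]; (split; first exact: L) => h h0.
  have [_ [C [_ C0 HC]]] := H h h0; exists C; first exact: C0.
  move=> phi c S Hc.
  have Hc' := (wG_gsb _ _ h0).2 Hc; apply: (HC phi c _ Hc').
  by apply/(Bspace_mem M0); split; [exact: S|exists c; exact: Hc'].
have [C C0 HC] := H h h0; exists tt, C; split; [exact: I|exact: C0|] => phi c /(Bspace_mem M0)[S _].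
by move=> Hc; exact: (HC phi c S ((wG_gsb _ _ h0).1 Hc)).
Qed.

Let wOE k : 0 <= k -> wO k = (fun x : V => (weight B k x)^-1).
Proof. by move=> k0; apply/funext => x; rewrite /decaying_weight weightNE. Qed.

Let wO0 k (x : V) : 0 <= wO k x. Proof. exact/ltW/expR_gt0. Qed.

Let wO_ocb h k phi c : 0 <= k -> bd M h (wO k) phi c <-> ocb B h k phi c.
Proof. by move=> k0; rewrite (wOE k0). Qed.

Let EB (n : nat) : lcs (cfun R d) := proj_limit [set h : R | 0 < h] (fun h => Bspace M h (wO n%:R)).
Let ER (h : R) : lcs (cfun R d) := proj_limit [set N : nat | (1 <= N)%N] (fun N => Bspace M h (wO N%:R^-1)).

Let EB_mem n phi : EB n phi <->
  smooth phi /\ forall h, 0 < h -> exists c, ocb B h n%:R phi c.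
Proof.
rewrite /EB (proj_mem M0 id (fun=> wO n%:R) pos1 phi).
split=> [] [S H]; split => // h h0; have [c Hc] := H h h0; exists c.
  by move: Hc; rewrite wOE.
by rewrite wOE.
Qed.

Let ER_mem h phi : ER h phi <->
  smooth phi /\ forall N : nat, (1 <= N)%N -> exists c, ocb B h N%:R^-1 phi c.
Proof.
rewrite /ER (proj_mem M0 (fun=> h) (fun N => wO N%:R^-1) (ex_intro _ 1%N isT) phi).
split=> [] [S H]; split => // N N0; have [c Hc] := H N N0; exists c.
  by move: Hc; rewrite wOE// invr_ge0.
by rewrite wOE// invr_ge0.
Qed.

Lemma OC_Beurling phi : OC Beurling M B phi <->
  exists n : nat, smooth phi /\ forall h, 0 < h -> exists c, ocb B h n%:R phi c.
Proof.
by split=> [[n _ /EB_mem H]|[n H]]; exists n => //; apply/EB_mem.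
Qed.

Lemma OC_Roumieu phi : OC Roumieu M B phi <->
  exists2 h, 0 < h & smooth phi /\ forall N : nat, (1 <= N)%N -> exists c, ocb B h N%:R^-1 phi c.
Proof.
by split=> [[h h0 /ER_mem H]|[h h0 H]]; exists h => //; apply/ER_mem.
Qed.

Let dirB (n : nat) i j : 0 < i -> 0 < j -> exists k, 0 < k /\ forall phi c,
  bd M k (wO n%:R) phi c -> bd M i (wO n%:R) phi c /\ bd M j (wO n%:R) phi c.
Proof.
move=> i0 j0; exists (Num.max i j); split; first by rewrite lt_max i0.
move=> phi c H; split.
  by apply: (bd_mono (ltW i0) _ _ (fun x => lexx _) H) => //; rewrite le_max lexx.
by apply: (bd_mono (ltW j0) _ _ (fun x => lexx _) H) => //; rewrite le_max lexx orbT.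
Qed.

Let dirR h : 0 < h -> forall i j : nat, (1 <= i)%N -> (1 <= j)%N -> exists m : nat, (1 <= m)%N /\
  forall phi c, bd M h (wO m%:R^-1) phi c ->
    bd M h (wO i%:R^-1) phi c /\ bd M h (wO j%:R^-1) phi c.
Proof.
move=> h0 i j i1 j1; exists (maxn i j); split; first by rewrite leq_max i1.
have n0 (n : nat) : 0 <= n%:R^-1 :> R by rewrite invr_ge0.
have ij0 : (0 < maxn i j)%N by rewrite leq_max i1.
move=> phi c; rewrite !(wOE (n0 _)) => H; split.
  apply: (ocb_mono hB (ltW h0) (lexx h) (n0 _) _ H).
  by rewrite lef_pV2 ?posrE ?ltr0n// ler_nat leq_maxl.
apply: (ocb_mono hB (ltW h0) (lexx h) (n0 _) _ H).
by rewrite lef_pV2 ?posrE ?ltr0n// ler_nat leq_maxr.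
Qed.

Lemma OC_subspace cl : subspace (OC cl M B : lcs (cfun R d)).
Proof.
case: cl; split.
- apply/OC_Beurling; exists 0%N; split; first exact: smooth0.
  by move=> h _; exists 0; exact: bd_zero.
- move=> a phi psi [n _ /EB_mem[S1 H1]] [m _ /EB_mem[S2 H2]].
  apply/OC_Beurling; exists (maxn n m); split; first exact: smooth_lin.
  move=> h h0; have [c1 B1] := H1 h h0; have [c2 B2] := H2 h h0.
  exists (cmod a * c1 + c2).
  apply: (bd_lin a S1 S2 (ltW h0) (fun x => inv_weight_ge0 B _ x)).
    by apply: (ocb_mono hB (ltW h0) (lexx h) _ _ B1); rewrite ?ler0n// ler_nat leq_maxl.
  by apply: (ocb_mono hB (ltW h0) (lexx h) _ _ B2); rewrite ?ler0n// ler_nat leq_maxr.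
- apply/OC_Roumieu; exists 1; first exact: ltr01.
  by split; [exact: smooth0|move=> N _; exists 0; exact: bd_zero].
move=> a phi psi [h h0 /ER_mem[S1 H1]] [h' h'0 /ER_mem[S2 H2]].
have m0 : 0 < Num.min h h' by rewrite lt_min h0.
apply/OC_Roumieu; exists (Num.min h h'); first exact: m0.
split; first exact: smooth_lin.
move=> N N1; have [c1 B1] := H1 N N1; have [c2 B2] := H2 N N1.
exists (cmod a * c1 + c2).
apply: (bd_lin a S1 S2 (ltW m0) (fun x => inv_weight_ge0 B _ x)).
  by apply: (ocb_mono hB (ltW m0) _ _ (lexx _) B1); rewrite ?invr_ge0// ge_min lexx.
by apply: (ocb_mono hB (ltW m0) _ _ (lexx _) B2); rewrite ?invr_ge0// ge_min lexx orbT.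
Qed.

Lemma dual_OC_Beurling f : lcs_dual (OC Beurling M B) f <->
  linear_on (OC Beurling M B : lcs (cfun R d)) f /\ forall n : nat, exists h C,
    [/\ 0 < h, 0 <= C & forall phi c, smooth phi ->
      (forall h, 0 < h -> exists c, ocb B h n%:R phi c) ->
      ocb B h n%:R phi c -> cmod (f phi) <= C * c].
Proof.
have := @dual_ind_limit _ _ _ [set: nat] EB _ (fun=> [set h : R | 0 < h])
   (fun n h => bd M h (wO n%:R)) f
   (fun n _ => proj_normed_by M0 (h := id) (w := fun=> wO n%:R) pos1 (@dirB n))
   _ _ (OC_subspace Beurling).
move=> /(_ _ _) -> /=; first last.
- move=> n _; exact: (bd_seminorm M0 posW (fun=> wO0 n%:R) (fun phi H => ((EB_mem n phi).1 H).1)).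
- by move=> n _; exact: (proj_subspace M0 (h := id) posW (fun=> wO0 n%:R)).
split=> [] [L H]; (split; first exact: L) => n.
  have [h [C [h0 C0 HC]]] := H n I; exists h, C; split; [exact: h0|exact: C0|] => phi c S K.
  move=> Hc; apply: (HC phi c _ ((wO_ocb _ _ _ (ler0n R n)).2 Hc)).
  by apply/EB_mem; split; [exact: S|exact: K].
move=> _; have [h [C [h0 C0 HC]]] := H n; exists h, C; split; [exact: h0|exact: C0|] => phi c /EB_mem[S K].
by move=> Hc; exact: (HC phi c S K ((wO_ocb _ _ _ (ler0n R n)).1 Hc)).
Qed.

Lemma dual_OC_Roumieu f : lcs_dual (OC Roumieu M B) f <->
  linear_on (OC Roumieu M B : lcs (cfun R d)) f /\ forall h, 0 < h -> exists (N : nat) C,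
    [/\ (1 <= N)%N, 0 <= C & forall phi c, smooth phi ->
      (forall N : nat, (1 <= N)%N -> exists c, ocb B h N%:R^-1 phi c) ->
      ocb B h N%:R^-1 phi c -> cmod (f phi) <= C * c].
Proof.
have := @dual_ind_limit _ _ _ [set h : R | 0 < h] ER _ (fun=> [set N : nat | (1 <= N)%N])
   (fun h N => bd M h (wO N%:R^-1)) f
   (fun h hpos => proj_normed_by M0 (h := fun=> h) (w := fun N => wO N%:R^-1)
      (ex_intro _ 1%N isT) (@dirR h hpos))
   _ _ (OC_subspace Roumieu).
move=> /(_ _ _) -> /=; first last.
- move=> h h0; exact: (bd_seminorm M0 (fun _ _ => ltW h0) (fun N : nat => wO0 N%:R^-1)
    (fun phi H => ((ER_mem h phi).1 H).1)).
- by move=> h h0; exact: (proj_subspace M0 (h := fun=> h) (fun _ _ => ltW h0) (fun N : nat => wO0 N%:R^-1)).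
have n0 (N : nat) : 0 <= N%:R^-1 :> R by rewrite invr_ge0.
split=> [] [L H]; (split; first exact: L) => h h0.
  have [N [C [N1 C0 HC]]] := H h h0; exists N, C; split; [exact: N1|exact: C0|] => phi c S K.
  move=> Hc; apply: (HC phi c _ ((wO_ocb _ _ _ (n0 N)).2 Hc)).
  by apply/ER_mem; split; [exact: S|exact: K].
have [N [C [N1 C0 HC]]] := H h h0; exists N, C; split; [exact: N1|exact: C0|] => phi c /ER_mem[S K].
by move=> Hc; exact: (HC phi c S K ((wO_ocb _ _ _ (n0 N)).1 Hc)).
Qed.

End Duals.

(** * Convolutions are smooth *)

Section TestFunctions.
Context {R : realType} {d : nat} (M A : nat -> R).
Notation V := 'rV[R]_d.
Notation e_ j := (delta_mx 0 j : 'rV[R]_d).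
Hypothesis hM : weight_sequence M.
Hypothesis hM2 : cond_M2 M.
Hypothesis hA : weight_sequence A.
Implicit Types (h k c t : R) (phi psi : cfun R d) (x y : V) (f : cfun R d -> R[i]).

Let M0 p : 0 < M p := wseq_gt0 p hM.
Let w0 k x : 0 <= weight A k x := ltW (weight_gt0 A k x).
Let two0 h : 0 < h -> 0 < 2 * h. Proof. exact: mulr_gt0. Qed.
Let le2 h : 0 < h -> h <= 2 * h. Proof. by move=> ?; lra. Qed.

(** A reflection is continuous on the test space, and its norm grows with [x] at
    most like the weight. *)
Lemma gs_refl h phi c x : 0 < h -> smooth phi -> gsb M A (2 * h) phi c ->
  gsb M A h (refl x phi) (weight A (2 * h) x * c).
Proof.
move=> hp S B; apply: (bd_refl S (ltW hp) (w0 _ _) _ (bd_mono (ltW hp) (le2 hp) (w0 _) (fun y => lexx _) B)).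
move=> y; rewrite -[X in weight A h X](subKr x).
by apply: le_trans (weight_add x (- (x - y)) hA (ltW hp)) _; rewrite weightN.
Qed.

(** An operation that trades one level for another preserves the test space of
    either class: in the Beurling case the level of the result is prescribed, in
    the Roumieu case that of the argument. *)
Lemma gs_cl_levels cl phi psi :
  (forall h, 0 < h -> exists k, 0 < k /\ forall c, gsb M A k phi c -> exists c', gsb M A h psi c') ->
  (forall k, 0 < k -> exists h, 0 < h /\ forall c, gsb M A k phi c -> exists c', gsb M A h psi c') ->
  smooth psi -> GS cl M A phi -> GS cl M A psi.
Proof.
move=> HB HR S; case: cl => [/(GS_Beurling hM)[_ H]|/(GS_Roumieu hM)[_ [k kp [c Hc]]]].
  apply/(GS_Beurling hM); split; first exact: S.
  by move=> h hp; have [k [kp K]] := HB h hp; have [c Hc] := H k kp; exact: K c Hc.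
apply/(GS_Roumieu hM); split; first exact: S.
by have [h [hp K]] := HR k kp; exists h; [exact: hp|exact: K c Hc].
Qed.

Lemma GS_refl cl phi x : GS cl M A phi -> GS cl M A (refl x phi).
Proof.
move=> G; have S := GS_smooth hM G; apply: gs_cl_levels (G).
- move=> h hp; exists (2 * h); split; first exact: two0.
  by move=> c Hc; exists (weight A (2 * h) x * c); exact: gs_refl.
- move=> k kp; have k2 : 0 < k / 2 by rewrite divr_gt0.
  exists (k / 2); split; first exact: k2.
  move=> c Hc; exists (weight A (2 * (k / 2)) x * c); apply: (gs_refl _ k2 S).
  by have -> : 2 * (k / 2) = k by field.
- exact: smooth_refl.
Qed.

Lemma M2_pos : exists C0 H : R, [/\ 0 < C0, 1 <= H &
  forall p q, M (p + q)%N <= C0 * H ^+ (p + q) * M p * M q].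
Proof.
by have [C0 [H [C1 H1 HH]]] := hM2; exists C0, H; split => //; exact: lt_le_trans ltr01 C1.
Qed.

Lemma GS_D cl phi s : GS cl M A phi -> GS cl M A (D s phi).
Proof.
move=> G; have S := GS_smooth hM G; have [C0 [H [C00 H1 HH]]] := M2_pos.
have H0 : 0 < H by exact: lt_le_trans ltr01 H1.
have key h c : 0 < h -> gsb M A (h * H) phi c -> exists c', gsb M A h (D s phi) c'.
  move=> hp B; have hh : h <= h * H by rewrite ler_peMr// ltW.
  exists (c * (C0 * M (size s) / h ^+ size s)).
  have c0 : 0 <= c by exact: (bd_ge0 (M0 _) (w0 _) B).
  apply: (bd_D s HH hp H0 c0 (w0 _)).
  by apply: (bd_mono (mulr_ge0 (ltW hp) (ltW H0)) (lexx _) (w0 _) _ B) => x; exact: weight_mono (ltW hp) hh.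
apply: gs_cl_levels (G); last exact: smooth_D.
  move=> h hp; exists (h * H); split; first exact: mulr_gt0.
  by move=> c Hc; exact: key Hc.
move=> k kp; have kH : 0 < k / H by rewrite divr_gt0.
exists (k / H); split; first exact: kH.
by move=> c Hc; apply: (key _ c kH); rewrite divfK// gt_eqF.
Qed.

(** In both classes a functional and a test function share a level [h]: in the
    Beurling case [h] is dictated by the functional, in the Roumieu case by the
    test function. *)
Lemma dual_level cl f phi K : 1 <= K -> lcs_dual (GS cl M A) f -> GS cl M A phi ->
  exists h C c, [/\ 0 < h, 0 <= C, gsb M A (K * h) phi c &
    forall psi c', GS cl M A psi -> gsb M A h psi c' -> cmod (f psi) <= C * c'].
Proof.
move=> K1; have K0 : 0 < K by exact: lt_le_trans ltr01 K1.
case: cl.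
  move=> /(dual_GS_Beurling hM hA)[_ [h [C [hp C0 HC]]]] /(GS_Beurling hM)[S H].
  have [c Hc] := H (K * h) (mulr_gt0 K0 hp).
  by exists h, C, c; split; [exact: hp|exact: C0|exact: Hc|exact: HC].
move=> /(dual_GS_Roumieu hM hA)[_ HC] /(GS_Roumieu hM)[S [k kp [c Hc]]].
have kK : 0 < k / K by rewrite divr_gt0.
have [C C0 H] := HC _ kK; exists (k / K), C, c; split; [exact: kK|exact: C0| |].
  by rewrite mulrC divfK// gt_eqF.
move=> psi c' G B; apply: (H psi c' _ B); exact: (GS_smooth hM G).
Qed.

Lemma dual_GS_linear cl f : lcs_dual (GS cl M A) f ->
  linear_on (GS cl M A : lcs (cfun R d)) f.
Proof. by case. Qed.

Lemma eucl_le_box (z : V) r : 0 <= r -> (forall j, `|z 0 j| <= r) -> eucl_norm z <= d%:R * r.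
Proof.
move=> r0 H; have [z0|[j zj]] := eucl_max z.
  have -> : z = 0 by apply/rowP => j; rewrite z0 mxE.
  have := euclZ 0 (0 : V); rewrite scaler0 normr0 mul0r => ->.
  by rewrite mulr_ge0.
by apply: le_trans zj _; rewrite ler_wpM2l.
Qed.

Lemma conv_loc_bounded cl f phi : lcs_dual (GS cl M A) f -> GS cl M A phi ->
  loc_bounded (convolution f phi).
Proof.
move=> Df G x; have S := GS_smooth hM G.
have [h [C [c [hp C0 B HC]]]] := dual_level (ler1n R 2) Df G.
have c0 : 0 <= c by exact: (bd_ge0 (M0 _) (w0 _) B).
have h2 := two0 hp; have h4 := two0 h2.
exists (C * (weight A (2 * (2 * h)) x * wexp A (2 * (2 * h) * (d%:R * 1)) * c)).
  by rewrite !mulr_ge0// ltW// wexp_gt0.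
exists 1; first exact: ltr01.
move=> y xy; apply: le_trans (HC _ _ (GS_refl y G) (gs_refl y hp S B)) _.
apply: (ler_wpM2l C0); apply: (ler_wpM2r c0).
rewrite -[X in weight A _ X](subrK x) addrC.
apply: le_trans (weight_add x (y - x) hA (ltW h2)) _; apply: (ler_wpM2l (w0 _ _)).
apply: wexp_mono; [exact: hA|by rewrite mulr_ge0 ?eucl_ge0// ltW|].
apply: (ler_wpM2l (ltW h4)); apply: eucl_le_box; first exact: ler01.
by move=> j; rewrite !mxE distrC; exact: ltW (xy j).
Qed.

(** The remainder of first order of the translates in direction [j]. *)
Definition taylor_rest j t phi : cfun R d :=
  - t%:C *: pderiv j phi + (shift_by (t *: e_ j) phi - phi).

(** The remainder is controlled by second derivatives at points at distance at
    most one, whose weights are comparable. *)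
Lemma gs_taylor j h phi c : 0 < h -> smooth phi ->
  bd M h (weight A (2 * h)) (D [:: j; j] phi) c ->
  forall t, `|t| <= 1 -> smooth (taylor_rest j t phi) /\
    gsb M A h (taylor_rest j t phi) (2 * c * wexp A (2 * h) * t ^+ 2).
Proof.
move=> hp S B t t1; have [S1 DE] := smooth_shift_D (t *: e_ j) S.
have S2 : smooth (pderiv j phi) := smooth_D [:: j] S.
have S3 := smoothB S1 S; split; first exact: smooth_lin.
have h2 := two0 hp.
split=> s z; rewrite (D_lin _ _ S2 S3) (DB _ S1 S) DE (D_pderiv _ _ S).
rewrite !cfunD cfunN cfunZ mulNr addrC.
pose K0 := c * M (size s) / h ^+ size s * wexp A (2 * h) / weight A h z.
have HK r : `|r| <= `|t| -> cmod (D [:: j, j & s] phi (z + r *: e_ j)) <= K0.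
  move=> rt; rewrite /K0 ler_pdivlMr ?weight_gt0//.
  have W : weight A h z <= weight A (2 * h) (z + r *: e_ j) * wexp A (2 * h).
    rewrite -[X in weight A h X](addrK (r *: e_ j)).
    apply: le_trans (weight_add (z + r *: e_ j) (- (r *: e_ j)) hA (ltW hp)) _.
    apply: (ler_wpM2l (w0 _ _)); rewrite weightN /weight eucl_delta.
    apply: wexp_mono; [exact: hA|by rewrite mulr_ge0// ltW|].
    by rewrite -[leRHS]mulr1; apply: (ler_wpM2l (ltW h2)); exact: le_trans rt t1.
  apply: le_trans (ler_wpM2l (cmod_ge0 _) W) _.
  rewrite mulrA; apply: ler_wpM2r; first exact/ltW/wexp_gt0.
  rewrite ler_pdivlMr ?exprn_gt0// mulrC mulrA.
  have := B s (z + r *: e_ j); rewrite -D_cat.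
  by rewrite (D_perm (s' := [:: j, j & s]) S)// perm_catC.
have E := ctaylor (smooth_has_pd s j S) (smooth_has_pd (j :: s) j S) HK.
apply: le_trans (_ : h ^+ size s * (2 * K0 * t ^+ 2) * weight A h z <= _).
  apply: ler_wpM2r; first exact: w0.
  by apply: ler_wpM2l; [rewrite exprn_ge0// ltW|exact: E].
apply: le_of_eq; rewrite /K0; field.
by rewrite (gt_eqF (weight_gt0 _ _ _)) expf_neq0// gt_eqF.
Qed.

(** The functional is applied to the Taylor expansion of the translates, whose
    remainder is quadratic in the norm of the level that [f] and [phi] share. *)
Lemma conv_has_pd cl f phi j : lcs_dual (GS cl M A) f -> GS cl M A phi ->
  has_pd j (convolution f phi) (convolution f (pderiv j phi)).
Proof.
move=> Df G; have S := GS_smooth hM G; have [C0 [H [C00 H1 HH]]] := M2_pos.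
have H0 : 0 < H by exact: lt_le_trans ltr01 H1.
apply: has_pd_of_estimate => x.
have K1 : 1 <= 2 * 2 * H by lra.
have [h [C [c [hp Cp B HC]]]] := dual_level K1 Df G.
have c0 : 0 <= c by exact: (bd_ge0 (M0 _) (w0 _) B).
have h2 := two0 hp; have h4 := two0 h2.
have B2 : bd M (2 * h) (weight A (2 * (2 * h))) (D [:: j; j] phi)
    (c * (C0 * M 2 / (2 * h) ^+ 2)).
  apply: (bd_D [:: j; j] HH h2 H0 c0 (w0 _)).
  have a1 : 2 * h * H <= 2 * 2 * H * h by rewrite -subr_ge0 (_ : _ - _ = 2 * h * H) ?mulr_ge0 ?ltW//; ring.
  have a2 : 2 * (2 * h) <= 2 * 2 * H * h.
    by rewrite mulrA [leRHS]mulrAC ler_peMr// ltW// -mulrA.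
  by apply: (bd_mono (ltW (mulr_gt0 h2 H0)) a1 (w0 _) _ B) => y; exact: weight_mono (ltW h4) a2.
have T := gs_taylor h2 S B2.
set c2 := 2 * _ * _ in T; exists (C * (weight A (2 * h) x * c2)) => t t1.
have [St Bt] := T t t1.
have Gp : GS cl M A (pderiv j phi) := GS_D [:: j] G.
have Sub : subspace (GS cl M A : lcs (cfun R d)) by exact: GS_subspace.
have L := dual_GS_linear Df.
have Rx z : GS cl M A (refl z phi) := GS_refl z G.
have E : refl x (taylor_rest j t phi) =
   - t%:C *: refl x (pderiv j phi) + (refl (x + t *: e_ j) phi - refl x phi).
  apply/funext => y; rewrite /refl /taylor_rest; congr (_ + (phi _ - _)).
  by rewrite addrAC.
have GD : GS cl M A (refl (x + t *: e_ j) phi - refl x phi).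
  by apply: (subspaceB Sub); exact: Rx.
have Gt : GS cl M A (refl x (taylor_rest j t phi)).
  by rewrite E; apply: Sub.2; [exact: GS_refl|exact: GD].
have := HC _ _ Gt (gs_refl x hp St Bt).
rewrite E L; [|exact: GS_refl|exact: GD].
rewrite (linear_onB Sub L (Rx _) (Rx _)) mulNr addrC => K.
by apply: le_trans K _; apply: le_of_eq; ring.
Qed.

Lemma conv_smooth_D cl f phi : lcs_dual (GS cl M A) f -> GS cl M A phi ->
  smooth (convolution f phi) /\
  forall s, D s (convolution f phi) = convolution f (D s phi).
Proof.
move=> Df G; pose F s := convolution f (D s phi).
have Fd s j : has_pd j (F s) (F (j :: s)) by apply: (conv_has_pd j Df); exact: GS_D.
split; last exact: (D_of_family Fd).
by apply: (smooth_of_family (F := F)) => // s; apply: (conv_loc_bounded Df); exact: GS_D.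
Qed.

End TestFunctions.

(** * Decay of the convolutions with elements of the smaller dual *)

Section Decay.
Context {R : realType} {d : nat} (M A B : nat -> R).
Notation V := 'rV[R]_d.
Hypothesis hM : weight_sequence M.
Hypothesis hM2 : cond_M2 M.
Hypothesis hA : weight_sequence A.
Hypothesis hB : weight_sequence B.
Implicit Types (h k c t : R) (phi psi : cfun R d) (x y : V) (f : cfun R d -> R[i]).

Let M0 p : 0 < M p := wseq_gt0 p hM.
Let w0 (W : nat -> R) k x : 0 <= weight W k x := ltW (weight_gt0 W k x).

Lemma wsup_lty k (phi : cfun R d) : 0 <= k -> (wsup B k phi < +oo)%E <->
  exists c, forall x, cmod (phi x) * weight B k x <= c.
Proof.
move=> k0; have wE x : expR (assoc_funV B (k *: x)) = weight B k x by exact: weightE.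
split=> [|[c H]].
  case E : (wsup B k phi) => [r| |] // _; last first.
    have : ((cmod (phi 0) * expR (assoc_funV B (k *: (0 : V))))%:E <= wsup B k phi)%E.
      by rewrite /wsup; apply: ereal_sup_ubound; exists 0.
    by rewrite E.
  exists r => x; have : ((cmod (phi x) * expR (assoc_funV B (k *: x)))%:E <= wsup B k phi)%E.
    by rewrite /wsup; apply: ereal_sup_ubound; exists x.
  by rewrite E lee_fin wE.
apply: le_lt_trans (ltry c); apply: ge_ereal_sup => _ [x _ <-].
by rewrite lee_fin wE; exact: H.
Qed.

Lemma exists_inv_nat k : 0 < k -> exists2 n : nat, (1 <= n)%N & n%:R^-1 <= k.
Proof.
move=> k0; exists (Num.truncn k^-1).+1 => //.
rewrite -[leRHS]invrK lef_pV2 ?posrE ?invr_gt0 ?ltr0n//.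
by apply/ltW; exact: truncnS_gt.
Qed.

Lemma exists_nat k : exists n : nat, k <= n%:R.
Proof. by exists (Num.truncn k).+1; apply/ltW; exact: truncnS_gt. Qed.

Lemma GS_decaying_cont cl phi : GS cl M B phi -> decaying_cont cl B phi.
Proof.
move=> G; have S := GS_smooth hM G; split; first by case: (S [::]).
case: cl G => [/(GS_Beurling hM)[_ H] N|/(GS_Roumieu hM)[_ [h hp [c Hc]]]].
  have [c Hc] := H (1 + N%:R) (ltr_pwDl ltr01 (ler0n _ _)).
  apply/(wsup_lty _ (ler0n R N)); exists (c * M 0%N) => x.
  apply: le_trans (_ : cmod (phi x) * weight B (1 + N%:R) x <= _).
    apply: (ler_wpM2l (cmod_ge0 _)); apply: (weight_mono x hB (ler0n R N)).
    by rewrite lerDr.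
  by have := Hc [::] x; rewrite expr0 mul1r.
have [n n1 nh] := exists_inv_nat hp.
have n0 : 0 <= n%:R^-1 :> R by rewrite invr_ge0.
exists n => //; apply/(wsup_lty _ n0); exists (c * M 0%N) => x.
apply: le_trans (_ : cmod (phi x) * weight B h x <= _).
  by apply: (ler_wpM2l (cmod_ge0 _)); exact: (weight_mono x hB n0 nh).
by have := Hc [::] x; rewrite expr0 mul1r.
Qed.

Hypothesis hAB : wsubset A B.

(** The decisive estimate for the decay of convolutions. Of two points [y] and
    [x - y], one has at least half the norm of [x]: where [y] is large, the weight
    for functions of moderate growth is small, and where [x - y] is large, the
    test function is. *)
Lemma ocb_refl_D : exists K L H C0 : R, [/\ 0 < K, 0 < L, 1 <= H, 0 < C0 &
  forall h k phi c s x, 0 < h -> 0 < k -> smooth phi ->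
    bd M (h * H) (weight A (L * k)) phi c ->
    ocb M B h k (refl x (D s phi))
      (K * (weight B (k / 2) x)^-1 * (c * (C0 * M (size s) / h ^+ size s)))].
Proof.
have [C0 [H [C00 H1 HH]]] := M2_pos hM2.
have H0 : 0 < H by exact: lt_le_trans ltr01 H1.
have [C [L [Cp Lp HL]]] := wexp_subset hA hB hAB.
exists C, L, H, C0; split => // h k phi c s x hp kp S Bd.
have c0 : 0 <= c by exact: (bd_ge0 (M0 _) (w0 _ _) Bd).
have K0 : 0 <= C * (weight B (k / 2) x)^-1.
  by rewrite mulr_ge0 ?invr_ge0// ltW.
apply: (bd_refl (smooth_D s S) (ltW hp) K0 _ (bd_D s HH hp H0 c0 (w0 _ _) Bd)) => y.
rewrite mulrAC ler_pdivlMr ?weight_gt0// mulrC ler_pdivrMr ?weight_gt0//.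
have k2 : 0 <= k / 2 by rewrite divr_ge0// ltW.
have e1 : y + (x - y) = x by rewrite addrC subrK.
have e2 : 2 * (k / 2) = k by field.
have := weight_add y (x - y) hB k2; rewrite e1 e2 => W.
apply: le_trans W _; rewrite [leRHS]mulrC; apply: (ler_wpM2l (w0 _ _ _)).
rewrite /weight -[L * k * _]mulrA; apply: HL.
by rewrite mulr_ge0 ?eucl_ge0// ltW.
Qed.

Lemma gsb_of_pointwise h k h' (phi : cfun R d) Q : 0 < h -> 0 < h' -> h' <= h -> h' <= k -> 0 <= Q ->
  (forall s x, cmod (D s phi x) <= Q * (weight B k x)^-1 * (M (size s) / h ^+ size s)) ->
  gsb M B h' phi Q.
Proof.
move=> hp h'p h'h h'k Q0 H; split=> s x.
have Ms : 0 <= M (size s) by exact/ltW/M0.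
apply: le_trans (_ : h ^+ size s * (Q * (weight B k x)^-1 * (M (size s) / h ^+ size s)) *
   weight B k x <= _).
  apply: ler_pM; [|exact: w0| |exact: weight_mono (ltW h'p) h'k].
    by rewrite mulr_ge0 ?cmod_ge0// exprn_ge0// ltW.
  apply: ler_pM; [by rewrite exprn_ge0// ltW|exact: cmod_ge0| |exact: H].
  by rewrite lerXn2r// nnegrE ltW.
apply: le_of_eq; field.
by rewrite (gt_eqF (weight_gt0 _ _ _)) expf_neq0// gt_eqF.
Qed.

(** The derivatives of the convolution at [x] are the values of the extended
    functional at the reflections at [x] of the derivatives of [phi]; these are
    small for large [x] by [ocb_refl_D]. *)
Lemma conv_in_GS cl f phi : lcs_dual (GS cl M A) f ->
  in_lcs_dual (GS cl M A) (OC cl M B) f -> GS cl M A phi -> GS cl M B (convolution f phi).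
Proof.
move=> Df [g Dg gf] G; have S := GS_smooth hM G.
have [K [L [H [C0 [Kp Lp H1 C0p key]]]]] := ocb_refl_D.
have H0 : 0 < H by exact: lt_le_trans ltr01 H1.
have [Sc Dc] := conv_smooth_D hM hM2 hA Df G.
have val s x : D s (convolution f phi) x = g (refl x (D s phi)).
  by rewrite Dc gf//; apply: (GS_refl hM hA); exact: (GS_D hM hM2 hA).
case: cl Df Dg gf G val => Df Dg gf G val.
  have {G} [_ G] := (GS_Beurling hM A phi).1 G.
  have {Dg} [_ Dg] := (dual_OC_Beurling hM hB g).1 Dg.
  apply/(GS_Beurling hM); split; first exact: Sc.
  move=> h' h'p; have [n hn] := exists_nat (2 * h').
  have np : 0 < n%:R :> R by apply: lt_le_trans hn; rewrite mulr_gt0.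
  have [h0 [C [h0p Cp HC]]] := Dg n.
  pose h := Num.max h0 h'; have hp : 0 < h by rewrite lt_max h0p.
  have bdphi k : 0 < k -> exists c, bd M (k * H) (weight A (L * n%:R)) phi c.
    move=> kp; have kH : 0 < k * H by exact: mulr_gt0.
    have mp : 0 < Num.max (k * H) (L * n%:R) by rewrite lt_max kH.
    have [c Bc] := G _ mp.
    exists c; apply: (bd_mono (ltW kH) _ (w0 _ _) _ Bc); first by rewrite le_max lexx.
    move=> x; apply: (weight_mono x hA (ltW (mulr_gt0 Lp np))).
    by rewrite le_max lexx orbT.
  have [c Bc] := bdphi h hp.
  have c0 : 0 <= c by exact: (bd_ge0 (M0 _) (w0 _ _) Bc).
  exists (C * K * c * C0).
  apply: (@gsb_of_pointwise h (n%:R / 2) h') => //.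
  - by rewrite le_max lexx orbT.
  - by rewrite ler_pdivlMr// mulrC.
  - by rewrite !mulr_ge0// ltW.
  move=> s x; rewrite val.
  have Sx : smooth (refl x (D s phi)) by exact/smooth_refl/smooth_D.
  have O := key h n%:R phi c s x hp np S Bc.
  have h0h : h0 <= h by rewrite le_max lexx.
  have O' := ocb_mono hB (ltW h0p) h0h (ltW np) (lexx _) O.
  apply: le_trans (HC _ _ Sx _ O') _.
    move=> k kp; have [c' Bc'] := bdphi k kp.
    by exists (K * (weight B (n%:R / 2) x)^-1 * (c' * (C0 * M (size s) / k ^+ size s))); exact: key.
  by apply: le_of_eq; ring.
have {G} [_ [h0 h0p [c Bc]]] := (GS_Roumieu hM A phi).1 G.
have {Dg} [_ Dg] := (dual_OC_Roumieu hM hB g).1 Dg.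
apply/(GS_Roumieu hM); split; first exact: Sc.
pose h := h0 / H; have hp : 0 < h by rewrite divr_gt0.
have [N0 [C [N01 Cp HC]]] := Dg h hp.
have [n1 n11 n1h] := exists_inv_nat (divr_gt0 h0p Lp).
have c0 : 0 <= c by exact: (bd_ge0 (M0 _) (w0 _ _) Bc).
have inv_le (m n : nat) : (1 <= m)%N -> (m <= n)%N -> n%:R^-1 <= m%:R^-1 :> R.
  move=> m1 mn; rewrite lef_pV2 ?posrE ?ltr0n ?ler_nat//.
  exact: leq_trans mn.
have O (N : nat) s x : (1 <= N)%N -> (n1 <= N)%N -> ocb M B h N%:R^-1 (refl x (D s phi))
    (K * (weight B (N%:R^-1 / 2) x)^-1 * (c * (C0 * M (size s) / h ^+ size s))).
  move=> N1 nN; have Np : 0 < N%:R^-1 :> R by rewrite invr_gt0 ltr0n.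
  apply: (key _ _ _ _ _ _ hp Np S); rewrite /h divfK ?gt_eqF//.
  apply: (bd_mono (ltW h0p) (lexx _) (w0 _ _) _ Bc) => y.
  apply: (weight_mono y hA (ltW (mulr_gt0 Lp Np))).
  rewrite mulrC -ler_pdivlMr//; apply: le_trans n1h; exact: inv_le.
have n0 (m : nat) : 0 <= m%:R^-1 :> R by rewrite invr_ge0.
pose N := maxn N0 n1; have N1 : (1 <= N)%N by rewrite leq_max N01.
have nN : (n1 <= N)%N by rewrite leq_maxr.
have Np : 0 < N%:R^-1 :> R by rewrite invr_gt0 ltr0n.
have h'p : 0 < Num.min h (N%:R^-1 / 2) by rewrite lt_min hp divr_gt0.
exists (Num.min h (N%:R^-1 / 2)); first exact: h'p.
exists (C * K * c * C0); apply: (@gsb_of_pointwise h (N%:R^-1 / 2)) => //.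
- by rewrite ge_min lexx.
- by rewrite ge_min lexx orbT.
- by rewrite !mulr_ge0// ltW.
move=> s x; rewrite val.
have Sx : smooth (refl x (D s phi)) by exact/smooth_refl/smooth_D.
have O' := ocb_mono hB (ltW hp) (lexx h) (n0 N) (inv_le _ _ N01 (leq_maxl N0 n1)) (O N s x N1 nN).
apply: le_trans (HC _ _ Sx _ O') _.
  move=> m m1; have m1' : (1 <= maxn m n1)%N by rewrite leq_max m1.
  exists (K * (weight B ((maxn m n1)%:R^-1 / 2) x)^-1 * (c * (C0 * M (size s) / h ^+ size s))).
  exact: (ocb_mono hB (ltW hp) (lexx h) (n0 _) (inv_le _ _ m1 (leq_maxl m n1))
    (O _ s x m1' (leq_maxr m n1))).
by apply: le_of_eq; ring.
Qed.

End Decay.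

(** * Completeness and uniform boundedness *)

Section Completeness.
Context {R : realType}.

(** The limit is the supremum of the lower bounds [u n - tau n]; this keeps the
    rate of convergence explicit. *)
Lemma real_cauchy_limit (u tau : nat -> R) :
  (forall m n, (m <= n)%N -> `|u n - u m| <= tau m) ->
  exists l, forall n, `|l - u n| <= tau n.
Proof.
move=> H; have t0 n : 0 <= tau n by apply: le_trans (H n n (leqnn n)).
have key m n : u m - tau m <= u n + tau n.
  have [mn|/ltnW nm] := leqP m n.
    by have := H _ _ mn; rewrite ler_norml => /andP[? ?]; have := t0 n; lra.
  have := H _ _ nm; rewrite ler_norml => /andP[_ ?]; have := t0 m; lra.
pose E := [set u n - tau n | n in setT].
have Eub n : ubound E (u n + tau n) by move=> _ [m _ <-]; exact: key.
exists (sup E) => n; rewrite ler_norml; apply/andP; split.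
  rewrite lerBrDl; apply: ub_le_sup; last by exists n.
  by exists (u 0%N + tau 0%N); exact: Eub.
rewrite lerBlDl; apply: sup_le_ub; last exact: Eub.
by exists (u 0%N - tau 0%N); exists 0%N.
Qed.

Definition vanishing (tau : nat -> R) := forall e, 0 < e ->
  exists N, forall n, (N <= n)%N -> tau n <= e.

Lemma vanishing_scale tau (k : R) : 0 <= k -> vanishing tau ->
  vanishing (fun n => k * tau n).
Proof.
move=> k0 T e e0; have k1 : 0 < k + 1 by rewrite ltr_wpDl.
have [N HN] := T _ (divr_gt0 e0 k1); exists N => n Nn.
apply: le_trans (ler_wpM2l k0 (HN n Nn)) _.
by rewrite mulrCA ler_piMr ?(ltW e0)// ler_pdivrMr// mul1r lerDl.
Qed.

Lemma le_of_vanishing tau N0 (a b k : R) : vanishing tau -> 0 <= k ->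
  (forall n, (N0 <= n)%N -> a <= b + k * tau n) -> a <= b.
Proof.
move=> T k0 H; apply/ler_addgt0Pr => e e0.
have [N HN] := vanishing_scale k0 T e0.
apply: le_trans (H (maxn N0 N) (leq_maxl _ _)) _; rewrite lerD2l.
exact: HN (leq_maxr _ _).
Qed.

Definition clim (l : R[i]) (u : nat -> R[i]) := vanishing (fun n => cmod (l - u n)).

Lemma clim_unique l l' u : clim l u -> clim l' u -> l = l'.
Proof.
move=> H1 H2; apply/eqP; rewrite -subr_eq0; apply/eqP; apply: cmod_eq0; apply/eqP.
rewrite eq_le cmod_ge0 andbT; apply/ler_addgt0Pr => e e0; rewrite add0r.
have e2 : 0 < e / 2 by rewrite divr_gt0.
have [[N1 HN1] [N2 HN2]] := (H1 _ e2, H2 _ e2).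
have E1 := HN1 _ (leq_maxl N1 N2); have E2 := HN2 _ (leq_maxr N1 N2).
set z := u _ in E1 E2; have -> : l - l' = (l - z) - (l' - z) by ring.
by apply: le_trans (cmodB _ _) _; lra.
Qed.

Lemma clim_lin (a : R[i]) l l' u u' : clim l u -> clim l' u' ->
  clim (a * l + l') (fun n => a * u n + u' n).
Proof.
move=> H1 H2 e e0; have e2 : 0 < e / 2 by rewrite divr_gt0.
have [[N1 HN1] [N2 HN2]] := (vanishing_scale (cmod_ge0 a) H1 e2, H2 _ e2).
exists (maxn N1 N2) => n; rewrite geq_max => /andP[/HN1 E1 /HN2 E2].
have -> : a * l + l' - (a * u n + u' n) = a * (l - u n) + (l' - u' n) by ring.
by apply: le_trans (cmodD _ _) _; rewrite cmodM; lra.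
Qed.

Lemma complex_cauchy_limit (u : nat -> R[i]) (tau : nat -> R) : vanishing tau ->
  (forall m n, (m <= n)%N -> cmod (u n - u m) <= tau m) ->
  exists l, forall n, cmod (l - u n) <= tau n.
Proof.
move=> T H.
have [a Ha] : exists a, forall n, `|a - complex.Re (u n)| <= tau n.
  apply: real_cauchy_limit => m n mn; apply: le_trans (H _ _ mn).
  by rewrite -reN -reD cmod_Re.
have [b Hb] : exists b, forall n, `|b - complex.Im (u n)| <= tau n.
  apply: real_cauchy_limit => m n mn; apply: le_trans (H _ _ mn).
  by rewrite -imN -imD cmod_Im.
have E n : cmod (a +i* b - u n) <= 2 * tau n.
  apply: le_trans (cmod_ReIm _) _; rewrite reD imD reN imN /=.
  by rewrite mulrDl mul1r lerD.
exists (a +i* b) => n; apply: (@le_of_vanishing tau n _ _ 2) => // m nm.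
rewrite -[a +i* b](subrK (u m)) -addrA addrC.
by apply: le_trans (cmodD _ _) _; rewrite lerD ?H.
Qed.

End Completeness.

Section StepCompleteness.
Context {R : realType} {d : nat} (M : nat -> R).
Notation V := 'rV[R]_d.
Notation e_ j := (delta_mx 0 j : 'rV[R]_d).
Hypothesis M0 : forall p, 0 < M p.
Variables (h : R) (w : V -> R) (Phi : nat -> cfun R d) (tau : nat -> R) (c : R).
Hypothesis hp : 0 < h.
Hypothesis w1 : forall x, 1 <= w x.
Hypothesis S : forall n, smooth (Phi n).
Hypothesis B0 : bd M h w (Phi 0%N) c.
Hypothesis T : vanishing tau.
Hypothesis Cau : forall m n, (m <= n)%N -> bd M h w (Phi n - Phi m) (tau m).

Let K s := M s / h ^+ s.
Let K0 s : 0 <= K s. Proof. by rewrite divr_ge0// ?exprn_ge0// ltW. Qed.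
Let w0 x : 0 <= w x. Proof. exact: le_trans ler01 (w1 x). Qed.
Let t0 n : 0 <= tau n := bd_ge0 (M0 _) w0 (Cau (leqnn n)).

Lemma step_cauchy_pointwise s x m n : (m <= n)%N ->
  cmod (D s (Phi n) x - D s (Phi m) x) <= K (size s) * tau m.
Proof.
move=> mn; have := bd_pointwise s hp (w1 x) (Cau mn).
by rewrite (DB _ (S n) (S m)) mulrC.
Qed.

Lemma step_bounded s x n : cmod (D s (Phi n) x) <= K (size s) * (tau 0%N + c).
Proof.
rewrite -[D s (Phi n) x](subrK (D s (Phi 0%N) x)).
apply: le_trans (cmodD _ _) _; rewrite mulrDr; apply: lerD.
  exact: step_cauchy_pointwise.
by rewrite mulrC; exact: (bd_pointwise s hp (w1 x) B0).
Qed.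

(** Completeness of the step spaces: the limits of all the derivatives exist
    pointwise, and the Taylor estimates, uniform along the sequence, identify
    them as the derivatives of the limit. *)
Lemma step_complete : exists2 phi, smooth phi &
  forall n, bd M h w (phi - Phi n) (tau n).
Proof.
have /boolp.choice[F HF] : forall sx : seq 'I_d * V, exists l, forall n,
    cmod (l - D sx.1 (Phi n) sx.2) <= K (size sx.1) * tau n.
  move=> [s x]; apply: complex_cauchy_limit => [|m n] /=; last exact: step_cauchy_pointwise.
  exact: (vanishing_scale (K0 _) T).
pose G s : cfun R d := fun x => F (s, x).
have HG s x n : cmod (G s x - D s (Phi n) x) <= K (size s) * tau n by exact: HF.
have Gb s : loc_bounded (G s).
  move=> x; have [C C0 [r r0 Hr]] := smooth_loc_bounded s (S 0%N) x.
  exists (K (size s) * tau 0%N + C); first by rewrite addr_ge0// mulr_ge0.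
  exists r; first exact: r0.
  move=> y xy; rewrite -[G s y](subrK (D s (Phi 0%N) y)).
  by apply: le_trans (cmodD _ _) _; apply: lerD; [exact: HG|exact: Hr].
have Gd s j : has_pd j (G s) (G (j :: s)).
  apply: has_pd_of_estimate => x; pose Q := K (size s).+2 * (tau 0%N + c).
  exists (2 * Q) => t t1.
  pose k := K (size s) + K (size s) + K (size s).+1.
  apply: (@le_of_vanishing _ tau 0 _ _ k T).
    by rewrite !addr_ge0.
  move=> n _.
  have E := ctaylor (x := x) (t := t) (smooth_has_pd s j (S n)) (smooth_has_pd (j :: s) j (S n))
    (fun r _ => step_bounded [:: j, j & s] (x + r *: e_ j) n).
  set y := x + t *: e_ j in E *.
  have -> : G s y - G s x - t%:C * G (j :: s) x =
     (D s (Phi n) y - D s (Phi n) x - t%:C * D (j :: s) (Phi n) x) +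
     ((G s y - D s (Phi n) y) + - (G s x - D s (Phi n) x) +
        - (t%:C * (G (j :: s) x - D (j :: s) (Phi n) x))).
    by rewrite mulrBr; ring.
  apply: le_trans (cmodD _ _) _; apply: lerD; first exact: E.
  apply: le_trans (cmodD _ _) _; rewrite mulrDl; apply: lerD.
    by apply: le_trans (cmodD _ _) _; rewrite cmodN mulrDl; apply: lerD; exact: HG.
  rewrite cmodN cmodM cmodR; apply: le_trans (ler_wpM2r (cmod_ge0 _) t1) _.
  by rewrite mul1r; exact: HG.
have SG : smooth (G [::]) by exact: (smooth_of_family Gb Gd).
exists (G [::]); first exact: SG.
move=> n; split=> s x; rewrite (DB _ SG (S n)) (D_of_family Gd).
have hw : 0 <= h ^+ size s * w x by rewrite mulr_ge0 ?exprn_ge0// ltW.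
apply: (@le_of_vanishing _ tau n _ _ (h ^+ size s * w x * K (size s)) T).
  exact: mulr_ge0.
move=> m nm; rewrite mulrAC.
apply: (@le_trans _ _ (h ^+ size s * w x *
   (cmod ((D s (Phi m) - D s (Phi n)) x) + cmod (G s x - D s (Phi m) x)))).
  apply: (ler_wpM2l hw); have -> : (G s - D s (Phi n)) x =
     (D s (Phi m) - D s (Phi n)) x + (G s x - D s (Phi m) x).
    by rewrite !cfunD !cfunN; ring.
  exact: cmodD.
rewrite mulrDr; apply: lerD; last by rewrite -[leRHS]mulrA; apply: (ler_wpM2l hw); exact: HG.
by rewrite mulrAC -(DB _ (S m) (S n)); exact: (Cau nm).
Qed.

End StepCompleteness.

Section UniformBoundedness.
Context {R : realType} {V : lmodType R[i]}.
Variables (E : V -> Prop) (nb : nat -> V -> R -> Prop) (T : nat -> set (V -> R[i])).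
Hypothesis ES : subspace E.
Hypothesis nb_mono : forall i j v c, (i <= j)%N -> nb j v c -> nb i v c.
Hypothesis nb_le : forall j v c c', c <= c' -> nb j v c -> nb j v c'.
Hypothesis nb_sn : seminorm_bounds [set: nat] nb E.
Hypothesis complete : forall u : nat -> V, (forall n, E (u n)) ->
  (forall n, nb n (u n.+1 - u n) (2 ^- n)) ->
  exists2 v, E v & forall j (e : R), 0 < e -> exists N, forall n, (N <= n)%N -> nb j (v - u n) e.
Hypothesis T_lin : forall n S, T n S -> linear_on E S.
Hypothesis T_bd : forall n S, T n S -> exists j : nat, forall v c, E v -> nb j v c ->
  cmod (S v) <= j%:R * c.
Hypothesis T_ptwise : forall v, E v -> exists (n0 : nat) (C : R), forall n, (n0 <= n)%N ->
  forall S, T n S -> cmod (S v) <= C.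

(** An element on which some functional is large in comparison with the norm is
    scaled so as to be small but of large value, and is added to [v] or subtracted
    from it: at one of the two results the functional is large, since their
    difference is twice the scaled element. *)
Let hump (n : nat) (v : V) (J : nat) : E v ->
  (forall j : nat, exists S v c, [/\ T n S, E v, nb j v c & j%:R * c < cmod (S v)]) ->
  exists v' (J' : nat) S, [/\ E v', T n S,
    nb J (v' - v) (2 ^- n / (J%:R + 1)), (n + 2)%:R <= cmod (S v') &
    (J < J')%N /\ forall v c, E v -> nb J' v c -> cmod (S v) <= J'%:R * c].
Proof.
(* With this [j], an element scaled to have the value [n + 2] is as small as the
   statement demands. *)
move=> Ev H; pose j := ((n + 2) * 2 ^ n * J.+1)%N.
have j0 : 0 < j%:R :> R by rewrite ltr0n !muln_gt0 addn2 expn_gt0.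
have Jj : (J <= j)%N.
  by apply: ltnW; rewrite /j -[leqLHS]mul1n leq_mul2r muln_gt0 addn2 expn_gt0.
have [S [x [c [TS Ex bc Sc]]]] := H j; have [c0 bZ] := nb_sn I Ex bc.
have Sx0 : 0 < cmod (S x) by apply: le_lt_trans Sc; rewrite mulr_ge0// ltW.
pose a := (n + 2)%:R / cmod (S x).
have a0 : 0 < a by rewrite divr_gt0// ltr0n addn2.
have L := T_lin TS.
have Eu (b : R[i]) : E (b *: x) by exact: subspaceZ.
have small (b : R[i]) : cmod b = a -> nb J (b *: x) (2 ^- n / (J%:R + 1)).
  move=> ba; apply: nb_mono Jj _; apply: nb_le (bZ b); rewrite ba /a.
  have Sj : c <= cmod (S x) / j%:R by rewrite ler_pdivlMr// mulrC ltW.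
  apply: le_trans (ler_wpM2l (ltW a0) Sj) _; apply: le_of_eq.
  rewrite /a /j !natrM natrX -natr1.
  have p1 k : k%:R + 1 != 0 :> R by rewrite natr1 pnatr_eq0.
  field; apply/and4P; split; [exact: p1|exact/expf_neq0/(p1 1%N)| |by rewrite gt_eqF].
  by rewrite -natrD addn2 pnatr_eq0.
have large (b : R[i]) : cmod b = a -> cmod (S (b *: x)) = (n + 2)%:R.
  by move=> ba; rewrite (linear_onZ _ ES L Ex) cmodM ba /a divfK// gt_eqF.
have aR : cmod a%:C = a by rewrite cmodR gtr0_norm.
have aN : cmod (- a%:C) = a by rewrite cmodN.
have [b ba Sb] : exists2 b, cmod b = a & (n + 2)%:R <= cmod (S (b *: x + v)).
  have [|/ltW le1] := leP (n + 2)%:R (cmod (S (a%:C *: x + v))); first by exists a%:C.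
  have [|/ltW le2] := leP (n + 2)%:R (cmod (S ((- a%:C) *: x + v))); first by exists (- a%:C).
  exists a%:C => //; apply: le_trans (_ : cmod (S (a%:C *: x)) <= _); first by rewrite large.
  have := large _ aR; rewrite (linear_onZ _ ES L Ex) => lg.
  move: le1 le2; rewrite !L// lg mulNr => le1 le2.
  set p := _ * S x in lg le1 le2 *; set q := S v in le1 le2 *.
  have : cmod (p + p) <= cmod (p + q) + cmod (- p + q).
    have -> : p + p = (p + q) - (- p + q) by ring.
    exact: cmodB.
  have -> : p + p = 2%:C * p by rewrite -[2]/(1 + 1) rmorphD rmorph1; ring.
  by rewrite cmodM cmodR normr_nat lg; lra.
have [jS HS] := T_bd TS.
exists (b *: x + v), (maxn J.+1 jS), S; split => //.
- exact: ES.2.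
- by rewrite addrK; exact: small.
split; first by rewrite leq_max leqnn.
move=> y c' Ey B; have [c'0 _] := nb_sn I Ey B.
apply: le_trans (HS _ _ Ey (nb_mono (leq_maxr _ _) B)) _.
by rewrite ler_wpM2r// ler_nat leq_maxr.
Qed.

(** A gliding hump: if no bound held, one would choose functionals [S n] one
    after the other together with increments that are negligible for the
    functionals already chosen but make the current one large; the sum of the
    increments violates the pointwise bounds. *)
Lemma uniform_boundedness : exists n j : nat, forall S, T n S -> forall v c,
  E v -> nb j v c -> cmod (S v) <= j%:R * c.
Proof.
apply: contrapT => /forallNP noB.
have big n j : exists S v c, [/\ T n S, E v, nb j v c & j%:R * c < cmod (S v)].
  apply: contrapT => K; apply: (noB n); exists j => S TS v c Ev B.
  rewrite leNgt; apply/negP => lt; apply: K; exists S, v, c; split => //.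
have /boolp.choice[F HF] : forall p : nat * (V * nat), exists q : V * nat * (V -> R[i]),
    E p.2.1 -> [/\ E q.1.1, T p.1 q.2,
    nb p.2.2 (q.1.1 - p.2.1) (2 ^- p.1 / (p.2.2%:R + 1)), (p.1 + 2)%:R <= cmod (q.2 q.1.1) &
    (p.2.2 < q.1.2)%N /\ forall v c, E v -> nb q.1.2 v c -> cmod (q.2 v) <= q.1.2%:R * c].
  move=> [n [v J]] /=; have [Ev|nE] := pselect (E v); last by exists (v, J, fun=> 0).
  by have [v' [J' [S H]]] := hump J Ev (big n); exists (v', J', S).
pose st := fix st n : V * nat := if n is m.+1 then (F (m, st m)).1 else (0, 0%N).
pose S n := (F (n, st n)).2; pose u n := (st n).1; pose J n := (st n).2.
have Eu n : E (u n).
  by elim: n => [|n IH]; [case: ES|case: (HF (n, st n) IH)].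
have P n : [/\ T n (S n), nb (J n) (u n.+1 - u n) (2 ^- n / ((J n)%:R + 1)),
    (n + 2)%:R <= cmod (S n (u n.+1)), (J n < J n.+1)%N &
    forall v c, E v -> nb (J n.+1) v c -> cmod (S n v) <= (J n.+1)%:R * c].
  by have [_ ? ? ? [? ?]] := HF (n, st n) (Eu n).
have Jmono m n : (m <= n)%N -> (J m <= J n)%N.
  move=> /subnKC <-; elim: (n - m)%N => [|k IH]; first by rewrite addn0.
  by rewrite addnS; apply: leq_trans IH (ltnW _); case: (P (m + k)%N).
have Jn n : (n <= J n)%N.
  by elim: n => // n IH; apply: leq_ltn_trans IH _; case: (P n).
have pow0 n : 0 <= 2 ^- n :> R by rewrite invr_ge0 exprn_ge0.
have J1 n : 1 <= (J n)%:R + 1 :> R by rewrite lerDr.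
have [v Ev Hv] : exists2 v, E v & forall j (e : R), 0 < e ->
    exists N, forall n, (N <= n)%N -> nb j (v - u n) e.
  apply: complete Eu _ => n; have [_ B _ _ _] := P n.
  apply: nb_mono (Jn n) _; apply: nb_le B.
  by rewrite ler_pdivrMr ?(lt_le_trans ltr01)// ler_peMr.
have Sv n : n%:R <= cmod (S n v).
  have [TS _ _ _ HS] := P n; have L := T_lin TS.
  have grow m : (n < m)%N -> n%:R + 1 + 2 * 2 ^- m <= cmod (S n (u m)).
    elim: m => // m IH; rewrite ltnS leq_eqVlt => /orP[/eqP <-|nm].
      have [_ _ Sn _ _] := P n; apply: le_trans Sn; rewrite natrD.
      have : 2 * 2 ^- n.+1 <= 1 :> R.
        rewrite exprS invfM mulrA divff// mul1r invf_le1 ?exprn_gt0//.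
        by rewrite exprn_ege1// ler1n.
      lra.
    have [_ B _ _ _] := P m.
    have E1 : cmod (S n (u m.+1 - u m)) <= 2 ^- m.
      have Ed : E (u m.+1 - u m) by exact: subspaceB.
      apply: le_trans (HS _ _ Ed (nb_mono (Jmono _ _ nm) B)) _.
      rewrite mulrCA ler_piMr// ler_pdivrMr ?(lt_le_trans ltr01)// mul1r.
      by apply: le_trans (_ : (J m)%:R <= _); rewrite ?ler_nat ?Jmono// lerDl.
    have E2 : cmod (S n (u m)) <= cmod (S n (u m.+1)) + cmod (S n (u m.+1 - u m)).
      rewrite (linear_onB ES L)//.
      have {1}-> : S n (u m) = S n (u m.+1) - (S n (u m.+1) - S n (u m)) by ring.
      exact: cmodB.
    have := IH nm; have : 2 * 2 ^- m.+1 = 2 ^- m :> R.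
      by rewrite exprS invfM mulrA divff// mul1r.
    lra.
  have Jp : 0 < (J n.+1)%:R :> R by rewrite ltr0n; apply: leq_trans (Jn n.+1).
  have Jip : 0 < (J n.+1)%:R^-1 :> R by rewrite invr_gt0.
  have [N HN] := Hv (J n.+1) _ Jip.
  pose m := maxn N n.+1.
  have B := HN m (leq_maxl _ _); have Em : E (v - u m) by exact: subspaceB.
  have := HS _ _ Em B; rewrite divff ?gt_eqF// => E1.
  have := grow m (leq_maxr _ _) => E2.
  have E3 : cmod (S n (u m)) <= cmod (S n v) + cmod (S n (v - u m)).
    rewrite (linear_onB ES L)//.
    have {1}-> : S n (u m) = S n v - (S n v - S n (u m)) by ring.
    exact: cmodB.
  have := pow0 m; lra.
have [n0 [C HC]] := T_ptwise Ev.
pose n := maxn n0 (Num.truncn C).+1.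
have [TS _ _ _ _] := P n.
have := le_trans (Sv n) (HC n (leq_maxl _ _) _ TS).
apply/negP; rewrite -ltNge; apply: lt_le_trans (truncnS_gt C) _.
by rewrite ler_nat leq_maxr.
Qed.

End UniformBoundedness.

(** * Decay of convolutions, uniformly in the test function *)

Section UniformDecay.
Context {R : realType} {d : nat} (M A B : nat -> R).
Notation V := 'rV[R]_d.
Hypothesis hM : weight_sequence M.
Hypothesis hA : weight_sequence A.
Hypothesis hB : weight_sequence B.
Implicit Types (h k c t : R) (phi psi : cfun R d) (x y : V) (f : cfun R d -> R[i]).

Let M0 p : 0 < M p := wseq_gt0 p hM.
Let w0 (W : nat -> R) k x : 0 <= weight W k x := ltW (weight_gt0 W k x).

Lemma vanishing_geometric j : vanishing (fun n => 2 * 2 ^- (n + j) : R).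
Proof.
move=> e e0; have [N HN] := exists_nat (2 / e); exists N.+1 => n Nn.
have n0 : (0 < n)%N by exact: leq_trans Nn.
rewrite ler_pdivrMr ?exprn_gt0// mulrC -ler_pdivrMr//.
apply: le_trans HN _; rewrite -natrX ler_nat; apply: leq_trans (ltnW Nn) _.
by apply: leq_trans (leq_addr j n) (ltnW (ltn_expl _ _)).
Qed.

Lemma geometric_cauchy h (w : V -> R) (u : nat -> cfun R d) j : 0 <= h ->
  (forall x, 0 <= w x) -> (forall n, smooth (u n)) ->
  (forall n, (j <= n)%N -> bd M h w (u n.+1 - u n) (2 ^- n)) ->
  forall m n, (j <= m)%N -> (m <= n)%N -> bd M h w (u n - u m) (2 * 2 ^- m).
Proof.
move=> h0 wp S H m n jm mn.
have pow0 i : 0 <= 2 ^- i :> R by rewrite invr_ge0 exprn_ge0.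
apply: (@bd_le _ _ _ _ _ _ (2 * 2 ^- m - 2 * 2 ^- n)) => //.
  by rewrite gerBl mulr_ge0.
rewrite -(subnKC mn); elim: (n - m)%N => [|k IH].
  by rewrite addn0 !subrr; exact: bd_zero.
rewrite addnS; have jk : (j <= m + k)%N by apply: leq_trans jm (leq_addr _ _).
have := bd_lin 1 (smoothB (S (m + k).+1) (S (m + k)%N)) (smoothB (S (m + k)%N) (S m)) h0 wp (H _ jk) IH.
rewrite scale1r addrA subrK (cmodR 1) normr1 mul1r; apply: bd_le => //.
have : 2 * 2 ^- (m + k).+1 = 2 ^- (m + k) :> R by rewrite exprS invfM mulrA divff// mul1r.
lra.
Qed.

Definition ptwise_limit phi (u : nat -> cfun R d) :=
  forall x, clim (phi x) (fun n => u n x).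

Lemma ptwise_limit_unique phi psi (u : nat -> cfun R d) :
  ptwise_limit phi u -> ptwise_limit psi u -> phi = psi.
Proof. by move=> H1 H2; apply/funext => x; exact: (clim_unique (H1 x) (H2 x)). Qed.

Lemma ptwise_limit_bd h (w : V -> R) phi (u : nat -> cfun R d) (tau : nat -> R) j :
  0 < h -> (forall x, 1 <= w x) -> vanishing tau ->
  (forall n, bd M h w (phi - u (n + j)%N) (tau n)) -> ptwise_limit phi u.
Proof.
move=> hp w1 T H x e e0; have [N HN] := T _ (divr_gt0 e0 (M0 0%N)).
exists (N + j)%N => n Nn; have jn : (j <= n)%N by apply: leq_trans Nn; exact: leq_addl.
have := bd_pointwise [::] hp (w1 x) (H (n - j)%N); rewrite expr0 divr1 subnK// => E.
apply: le_trans E _; rewrite -ler_pdivlMr//; apply: HN.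
by rewrite leq_subRL// addnC.
Qed.

Section Levels.
Variable l : nat -> R.
Hypothesis l0 : forall j, 0 < l j.
Hypothesis l_mono : forall i j, (i <= j)%N -> l i <= l j.

(** Two cases in one: levels tending to infinity give the Beurling space, constant
    levels a step of the Roumieu space. *)
Definition in_levels phi := smooth phi /\ forall j, exists c, gsb M A (l j) phi c.

(** The limits at the different levels exist by [step_complete], and they agree
    because they are all pointwise limits. *)
Lemma levels_complete (u : nat -> cfun R d) : (forall n, in_levels (u n)) ->
  (forall n, gsb M A (l n) (u n.+1 - u n) (2 ^- n)) ->
  exists2 v, in_levels v & forall j (e : R), 0 < e ->
    exists N, forall n, (N <= n)%N -> gsb M A (l j) (v - u n) e.
Proof.
move=> Eu Hu; have S n : smooth (u n) by case: (Eu n).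
have W1 j x : 1 <= weight A (l j) x := weight_ge1 x hA (ltW (l0 j)).
have lim j : exists2 v, smooth v &
    forall n, gsb M A (l j) (v - u (n + j)%N) (2 * 2 ^- (n + j)).
  have [_ /(_ j)[c Bc]] := Eu j.
  apply: (@step_complete _ _ _ M0 _ _ (fun n => u (n + j)%N) _ c (l0 j) (W1 j)) => //.
  - exact: vanishing_geometric.
  - move=> m n mn; apply: (geometric_cauchy (ltW (l0 j)) (w0 _ _) S (j := j)).
    + by move=> k jk; exact: (gsb_mono hA (ltW (l0 j)) (l_mono jk) (Hu k)).
    + exact: leq_addl.
    + by rewrite leq_add2r.
have [v Sv Hv] := lim 0%N.
have Hj j n : gsb M A (l j) (v - u (n + j)%N) (2 * 2 ^- (n + j)).
  have [v' Sv' Hv'] := lim j.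
  rewrite (_ : v = v'); first exact: Hv'.
  apply: (@ptwise_limit_unique _ _ u).
    exact: (ptwise_limit_bd (l0 0%N) (W1 0%N) (vanishing_geometric 0) Hv).
  exact: (ptwise_limit_bd (l0 j) (W1 j) (vanishing_geometric j) Hv').
exists v.
  split; first exact: Sv.
  move=> j; have [_ /(_ j)[c Bc]] := Eu j.
  exists (cmod 1 * (2 * 2 ^- (0 + j)) + c).
  have := bd_lin 1 (smoothB Sv (S j)) (S j) (ltW (l0 j)) (w0 _ _) (Hj j 0%N) Bc.
  by rewrite scale1r subrK.
move=> j e e0; have [N HN] := vanishing_geometric j e0.
exists (N + j)%N => n Nn; have jn : (j <= n)%N by apply: leq_trans Nn; exact: leq_addl.
rewrite -(subnK jn); apply: (bd_le M0 _ (Hj j (n - j)%N)); apply: HN.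
by rewrite leq_subRL// addnC.
Qed.

Lemma levels_subspace : subspace in_levels.
Proof.
split; first by split; [exact: smooth0|move=> j; exists 0; exact: bd_zero].
move=> a phi psi [S1 H1] [S2 H2]; split; first exact: smooth_lin.
move=> j; have [[c1 B1] [c2 B2]] := (H1 j, H2 j); exists (cmod a * c1 + c2).
exact: (bd_lin a S1 S2 (ltW (l0 j)) (w0 _ _) B1 B2).
Qed.

(** The uniform boundedness principle for the family of the evaluations of
    [f * phi] at the points [x], multiplied by weights [m n]. *)
Lemma levels_uniform_decay (m : nat -> R) f :
  (forall x, linear_on in_levels (fun phi => convolution f phi x)) ->
  (forall x, exists (j : nat) C, 0 <= C /\ forall phi c, in_levels phi -> gsb M A (l j) phi c ->
     cmod (convolution f phi x) <= C * c) ->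
  (forall phi, in_levels phi -> exists (n0 : nat) C, forall n, (n0 <= n)%N -> forall x,
     cmod (convolution f phi x) * weight B (m n) x <= C) ->
  exists n j : nat, forall x phi c, in_levels phi -> gsb M A (l j) phi c ->
    cmod (convolution f phi x) * weight B (m n) x <= j%:R * c.
Proof.
move=> L Hc Hp.
pose T n : set (cfun R d -> R[i]) :=
  [set S | exists x, S = fun phi => (weight B (m n) x)%:C * convolution f phi x].
have cT n x phi : cmod ((weight B (m n) x)%:C * convolution f phi x) =
    cmod (convolution f phi x) * weight B (m n) x.
  by rewrite cmodM cmodR gtr0_norm ?weight_gt0// mulrC.
have sn : seminorm_bounds [set: nat] (fun j => gsb M A (l j)) in_levels.
  by apply: (bd_seminorm M0 (fun j _ => ltW (l0 j)) (fun j => w0 A (l j))) => phi [].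
have mono i j phi c : (i <= j)%N -> gsb M A (l j) phi c -> gsb M A (l i) phi c.
  by move=> ij; apply: (gsb_mono hA (ltW (l0 i))); exact: l_mono.
have [||| n [j H]] := @uniform_boundedness _ _ in_levels (fun j => gsb M A (l j)) T
    levels_subspace mono (fun j phi c c' => @bd_le _ _ _ _ _ _ _ _ M0) sn levels_complete.
- by move=> n _ [x ->] a phi psi E1 E2; rewrite (L x a phi psi E1 E2); ring.
- move=> n _ [x ->]; have [j [C [C0 H]]] := Hc x.
  have [N HN] := exists_nat (C * weight B (m n) x).
  exists (maxn j N) => phi c Ephi Bc; rewrite cT.
  have [c0 _] := sn _ _ _ I Ephi Bc.
  apply: le_trans (ler_wpM2r (w0 _ _ _) (H _ _ Ephi (mono _ _ _ _ (leq_maxl _ _) Bc))) _.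
  rewrite mulrAC; apply: (ler_wpM2r c0); apply: le_trans HN _.
  by rewrite ler_nat leq_maxr.
- move=> phi /Hp[n0 [C H]]; exists n0, C => n nn _ [x ->]; rewrite cT; exact: H.
exists n, j => x phi c Ephi Bc; rewrite -cT.
by apply: (H (fun phi => (weight B (m n) x)%:C * convolution f phi x)) => //; exists x.
Qed.

End Levels.

Lemma uniform_decay_Beurling f m : lcs_dual (GS Beurling M A) f -> 0 <= m ->
  (forall phi, GS Beurling M A phi -> decaying_cont Beurling B (convolution f phi)) ->
  exists h C, [/\ 0 < h, 0 <= C & forall x phi c, GS Beurling M A phi ->
    gsb M A h phi c -> cmod (convolution f phi x) * weight B m x <= C * c].
Proof.
move=> Df m0 H; pose l (j : nat) : R := j.+1%:R.
have l0 j : 0 < l j by rewrite ltr0n.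
have lm i j : (i <= j)%N -> l i <= l j by rewrite ler_nat.
have LE phi : in_levels l phi <-> GS Beurling M A phi.
  split=> [[S K]|/(GS_Beurling hM)[S K]].
    apply/(GS_Beurling hM); split; first exact: S.
    move=> h hp; have [N HN] := exists_nat h; have [c Bc] := K N; exists c.
    apply: (gsb_mono hA (ltW hp) _ Bc); apply: le_trans HN _.
    by rewrite ler_nat.
  by split; [exact: S|move=> j; exact: K].
have [L [h [C [hp C0 HC]]]] := (dual_GS_Beurling hM hA f).1 Df.
have [|x|phi /LE G|n [j HU]] := @levels_uniform_decay l l0 lm (fun=> m) f.
- move=> x a phi psi /LE G1 /LE G2.
  by apply: L; exact: (GS_refl hM hA).
- have [N HN] := exists_nat (2 * h); exists N, (C * weight A (2 * h) x).
  split; first by rewrite mulr_ge0.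
  move=> phi c /LE G Bc; rewrite -mulrA.
  apply: (HC _ _ (GS_refl hM hA x G)).
  apply: (gs_refl hA x hp (GS_smooth hM G)).
  apply: (gsb_mono hA (ltW (mulr_gt0 (ltr0n R 2) hp)) _ Bc); apply: le_trans HN _.
  by rewrite ler_nat.
- have [_ K] := H phi G; have [N HN] := exists_nat m.
  have [c Bc] := (wsup_lty B _ (ler0n R N)).1 (K N).
  exists 0%N, c => _ _ x; apply: le_trans (Bc x); apply: (ler_wpM2l (cmod_ge0 _)).
  exact: (weight_mono x hB m0 HN).
exists (l j), j%:R; split; [exact: l0|exact: ler0n|].
by move=> x phi c /LE; exact: HU.
Qed.

Lemma uniform_decay_Roumieu f h : lcs_dual (GS Roumieu M A) f -> 0 < h ->
  (forall phi, GS Roumieu M A phi -> decaying_cont Roumieu B (convolution f phi)) ->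
  exists m C, [/\ 0 < m, 0 <= C & forall x phi c, smooth phi ->
    gsb M A h phi c -> cmod (convolution f phi x) * weight B m x <= C * c].
Proof.
move=> Df hp H.
have [L HC] := (dual_GS_Roumieu hM hA f).1 Df.
have GE phi : in_levels (fun=> h) phi -> GS Roumieu M A phi.
  move=> [S K]; apply/(GS_Roumieu hM); split; first exact: S.
  by exists h; [exact: hp|exact: K 0%N].
have h2 : 0 < h / 2 by rewrite divr_gt0.
have hh : 2 * (h / 2) = h by field.
have n0 (n : nat) : 0 <= n%:R^-1 :> R by rewrite invr_ge0.
have [|x|phi /GE G|n [j HU]] :=
    @levels_uniform_decay (fun=> h) (fun=> hp) (fun _ _ _ => lexx h) (fun n => n.+1%:R^-1) f.
- move=> x a phi psi /GE G1 /GE G2.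
  by apply: L; exact: (GS_refl hM hA).
- have [C C0 K] := HC _ h2; exists 0%N, (C * weight A (2 * (h / 2)) x).
  split; first by rewrite mulr_ge0.
  move=> phi c [S _] Bc; rewrite -mulrA.
  apply: (K _ _ (smooth_refl x S)); apply: (gs_refl hA x h2 S).
  by rewrite hh.
- have [_ [n n1 /(wsup_lty B _ (n0 n))[c Bc]]] := H phi G.
  exists n, c => k nk x; apply: le_trans (Bc x); apply: (ler_wpM2l (cmod_ge0 _)).
  apply: (weight_mono x hB (n0 _)); rewrite lef_pV2 ?posrE ?ltr0n// ler_nat.
  exact: leqW.
exists n.+1%:R^-1, j%:R; split; [by rewrite invr_gt0 ltr0n|exact: ler0n|].
move=> x phi c S Bc; apply: HU; last exact: Bc.
by split; [exact: S|move=> _; exists c].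
Qed.

End UniformDecay.

(** * Averaged profiles of one variable *)

Section OneDimensionalProfiles.
Context {R : realType}.
Implicit Types (g : R -> R) (A M : nat -> R).

(** The integrals from [- n.+1] to [x], normalized to vanish at [0], are compatible
    with each other, and so define an antiderivative on the whole line. *)
Lemma antiderivative g : continuous g ->
  exists G : R -> R, forall t : R, is_derive t 1 G (g t).
Proof.
move=> cg; pose mu := @lebesgue_measure R.
pose I (a x : R) := (\int[mu]_(t in `[a, x]) g t)%R.
have Id (a x : R) : a < x -> is_derive x 1 (I a) (g x).
  move=> ax; have xu : x < x + 1 by rewrite ltrDl.
  have ig : mu.-integrable `[a, x + 1] (EFin \o g).
    apply: continuous_compact_integrable; first exact: segment_compact.
    exact: continuous_subspaceT.
  have [dI eI] := continuous_FTC1_closed xu ig ax (cg x).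
  by split; [exact: dI|rewrite -derive1E].
pose G (n : nat) x := I (- n.+1%:R) x - I (- n.+1%:R) 0.
have Gd n (x : R) : - n.+1%:R < x -> is_derive x 1 (G n) (g x).
  move=> nx; rewrite -[g x]subr0.
  exact: (is_deriveB (Id _ _ nx) (is_derive_cst (I (- n.+1%:R) 0) x 1)).
have G0 n : G n 0 = 0 by rewrite /G subrr.
have GG m n x : - m.+1%:R < x -> - n.+1%:R < x -> G m x = G n x.
  move=> mx nx; apply/eqP; rewrite -subr_eq0; apply/eqP.
  have dd (y : R) : - m.+1%:R < y -> - n.+1%:R < y -> is_derive y 1 (G m - G n) 0.
    by move=> my ny; rewrite -(subrr (g y)); apply: is_deriveB; exact: Gd.
  have key a b : a <= b -> - m.+1%:R < a -> - n.+1%:R < a ->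
      (G m - G n) b = (G m - G n) a.
    move=> ab ma na; have [||c _] := @MVT_segment _ (G m - G n) (fun=> 0) a b ab.
    - move=> y; rewrite in_itv/= => /andP[ay _].
      by apply: dd; [exact: lt_trans ay|exact: lt_trans ay].
    - apply: derivable_within_continuous => y; rewrite in_itv/= => /andP[ay _].
      by case: (dd y (lt_le_trans ma ay) (lt_le_trans na ay)).
    by rewrite mul0r => /eqP; rewrite subr_eq0 => /eqP.
  have N0 k : - k.+1%:R < 0 :> R by rewrite oppr_lt0 ltr0n.
  have E0 : (G m - G n) 0 = 0 by rewrite -[LHS]/(G m 0 - G n 0) !G0 subrr.
  rewrite -[LHS]/((G m - G n) x); have [x0|/ltW x0] := leP 0 x.
    by rewrite (key 0 x).
  by rewrite -(key x 0).
pose N (x : R) := Num.truncn `|x|.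
have Nx x : - (N x).+1%:R < x.
  by rewrite ltrNl; apply: le_lt_trans (truncnS_gt `|x|); rewrite -normrN ler_norm.
exists (fun x => G (N x) x) => t.
have tN : - (N t).+2%:R < t.
  by apply: le_lt_trans (Nx t); rewrite lerN2 ler_nat.
apply: near_eq_is_derive (Gd (N t).+1 t tN).
near=> x; apply: GG; last exact: Nx.
near: x; exact: lt_nbhsr.
Unshelve. all: by end_near. Qed.

Lemma is_derive_shift1 g (t l : R) : is_derive (t - 1) 1 g l ->
  is_derive t 1 (fun s => g (s - 1)) l.
Proof.
move=> H; have {}H : is_derive (- 1 + t *: (1 : R)) 1 g l.
  by rewrite [t *: 1]mulr1 addrC.
have := is_derive_line H; congr is_derive; apply/funext => s.
by rewrite [s *: 1]mulr1 addrC.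
Qed.

(** A function of one variable given together with all its derivatives, which
    belongs to the one-dimensional Beurling space. *)
Record profile A M (eta : nat -> R -> R) : Prop := Profile {
  profile_derive : forall n (t : R), is_derive t 1 (eta n) (eta n.+1 t);
  profile_bound : forall h, 0 < h -> exists c, forall n t,
    h ^+ n * `|eta n t| * wexp A (h * `|t|) <= c * M n }.

Section Averaging.
Variables (A M : nat -> R) (eta : nat -> R -> R).
Hypothesis hA : weight_sequence A.
Hypothesis hM : weight_sequence M.
Hypothesis hM1 : cond_M1 M.
Hypothesis P : profile A M eta.
Hypothesis eta_ge0 : forall t, 0 <= eta 0%N t.
Variable t0 : R.
Hypothesis eta_gt0 : 0 < eta 0%N t0.

Lemma profile_shift_bound h : 0 < h -> exists2 c, 0 <= c & forall n t r, `|r| <= 1 ->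
  h ^+ n * `|eta n (t + r)| * wexp A (h * `|t|) <= c * M n.
Proof.
move=> hp; have h2 : 0 < 2 * h by rewrite mulr_gt0.
have [c Hc] := profile_bound P h2.
have c0 : 0 <= c.
  have := Hc 0%N 0; rewrite expr0 mul1r => E.
  have : 0 <= c * M 0%N by apply: le_trans E; rewrite mulr_ge0// ltW// wexp_gt0.
  by rewrite pmulr_lge0// wseq_gt0.
exists (c * wexp A (2 * h)); first by rewrite mulr_ge0// ltW// wexp_gt0.
move=> n t r r1.
have W : wexp A (h * `|t|) <= wexp A (2 * h * `|t + r|) * wexp A (2 * h).
  rewrite -mulrA; apply: wexp_quasi_add; rewrite ?mulr_ge0 ?(ltW hp)//.
  rewrite -[X in Num.max _ X]mulr1 -maxr_pMr ?(ltW hp)// mulrCA ler_wpM2l ?(ltW hp)//.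
  have : `|t| <= `|t + r| + `|r| by rewrite -[X in `|X| <= _](addrK r) ler_normB.
  have : `|t + r| <= Num.max `|t + r| 1 by rewrite le_max lexx.
  have : 1 <= Num.max `|t + r| 1 by rewrite le_max lexx orbT.
  lra.
have H := Hc n (t + r).
apply: le_trans (_ : (2 * h) ^+ n * `|eta n (t + r)| * (wexp A (2 * h * `|t + r|) * wexp A (2 * h)) <= _).
  apply: ler_pM; [by rewrite mulr_ge0// exprn_ge0// ltW|exact/ltW/wexp_gt0| |exact: W].
  apply: (ler_wpM2r (normr_ge0 _)); rewrite lerXn2r ?nnegrE ?(ltW hp) ?(ltW h2)//.
  by rewrite ler_peMl ?(ltW hp)// ler1n.
by rewrite mulrA [leRHS]mulrAC ler_wpM2r// ltW// wexp_gt0.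
Qed.

Lemma profile_integrable : exists2 c, 0 <= c & forall t, eta 0%N t <= c * (1 + t ^+ 2)^-1.
Proof.
have [c Hc] := profile_bound P ltr01.
have [C C0 HC] := wexp_poly 2 hA.
have cM : 0 <= c * M 0%N.
  by apply: le_trans (Hc 0%N 0); rewrite !mulr_ge0 ?exprn_ge0// ltW// wexp_gt0.
exists (C * (c * M 0%N)); first by rewrite mulr_ge0// ltW.
move=> t; have t2 : 0 < 1 + t ^+ 2 by rewrite ltr_pwDl// sqr_ge0.
rewrite ler_pdivlMr//.
have := Hc 0%N t; rewrite expr0 !mul1r (ger0_norm (eta_ge0 t)) => E.
apply: le_trans (_ : eta 0%N t * (C * wexp A `|t|) <= _).
  rewrite ler_wpM2l//; apply: le_trans (HC _ (normr_ge0 t)).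
  by rewrite sqrrD expr1n mul1r real_normK ?num_real// lerD2r lerDl mulrn_wge0.
by rewrite mulrCA ler_wpM2l// ltW.
Qed.

(** Averaging over unit intervals: the translates by integers of the averaged
    profile form a telescoping sum, which converges to the integral. *)
Lemma profile_average : exists Psi, profile A M Psi /\ forall t,
  (\sum_(i < K + K) Psi 0%N (t - (i%:R - K%:R))) @[K --> \oo] --> (1 : R).
Proof.
have [G HG] := antiderivative (is_derive_continuous (profile_derive P 0%N)).
have Gmono s t : s <= t -> G s <= G t.
  move=> st; have [x _ E] := mvt s t HG.
  by rewrite -subr_ge0 E mulr_ge0// subr_ge0.
have [c c0 Hc] := profile_integrable.
have Gbd s t : s <= t -> G t - G s <= c * pi.
  move=> st.
  have dd (x : R) : is_derive x 1 (G - c \*: (@atan R)) (eta 0%N x - c * (1 + x ^+ 2)^-1).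
    by apply: is_deriveB; apply: is_deriveZ; exact: is_derive1_atan.
  have [x _ E] := mvt s t dd.
  have : (G - c \*: (@atan R)) t - (G - c \*: (@atan R)) s <= 0.
    by rewrite E mulr_le0_ge0 ?subr_ge0// subr_le0.
  rewrite -[(G - c \*: (@atan R)) t]/(G t - c * atan t).
  rewrite -[(G - c \*: (@atan R)) s]/(G s - c * atan s) => E2.
  have := atan_ltpi2 t; have := atan_gtNpi2 s => a1 a2.
  have : c * (atan t - atan s) <= c * pi by rewrite ler_wpM2l//; lra.
  lra.
have pi0 : 0 <= c * (pi : R) by rewrite mulr_ge0// ltW// pi_gt0.
have Gub : has_ubound (range G).
  exists (G 0 + c * pi) => _ [t _ <-]; have [t_le|/ltW t_ge] := leP t 0.
    by have := Gmono _ _ t_le; lra.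
  by have := Gbd _ _ t_ge; lra.
have Glb : has_lbound (range G).
  exists (G 0 - c * pi) => _ [t _ <-]; have [t_le|/ltW t_ge] := leP t 0.
    by have := Gbd _ _ t_le; lra.
  by have := Gmono _ _ t_ge; lra.
have Gne : range G !=set0 by exists (G 0); exists 0.
pose Lp := sup (range G); pose Lm := inf (range G).
have GLp t : G t <= Lp by apply: ub_le_sup => //; exists t.
have GLm t : Lm <= G t by apply: ge_inf => //; exists t.
have Lpm : 0 < Lp - Lm.
  rewrite subr_gt0 ltNge; apply/negP => LL.
  have Gc : G = cst Lp.
    apply/funext => t; apply/eqP; rewrite eq_le GLp/=.
    exact: le_trans LL (GLm t).
  have [_ E] := HG t0; have : eta 0%N t0 = 0 by rewrite -E Gc derive_cst.
  by move=> e0; have := eta_gt0; rewrite e0 ltxx.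
pose kap := (Lp - Lm)^-1; have kap0 : 0 < kap by rewrite invr_gt0.
pose Psi n t := kap * (if n is m.+1 then eta m t - eta m (t - 1) else G t - G (t - 1)).
exists Psi; split; first split.
- have D f (f' : R -> R) : (forall t : R, is_derive t 1 f (f' t)) -> forall t : R,
      is_derive t 1 (fun s => kap * (f s - f (s - 1))) (kap * (f' t - f' (t - 1))).
    move=> H t; apply: (is_deriveZ kap (f := fun s => f s - f (s - 1))).
    by apply: is_deriveB; apply: is_derive_shift1.
  by case=> [|n] t; apply: D => // s; exact: (profile_derive P).
- move=> h hp; have [C C0 HC] := profile_shift_bound hp.
  have [Q Q0 HQ] := M1_le1 hM hM1.
  exists (kap * C + h * kap * 2 * C * Q) => -[|n] t.
    have [x x1 E] := mvt t (t - 1) HG.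
    rewrite expr0 mul1r /Psi normrM (gtr0_norm kap0).
    have -> : G t - G (t - 1) = eta 0%N (t + (x - t)).
      rewrite -opprB E [t + (x - t)]addrC subrK; ring.
    have xt : `|x - t| <= 1.
      by apply: le_trans x1 _; rewrite addrAC subrr sub0r normrN normr1.
    have := HC 0%N t _ xt; rewrite expr0 mul1r => E0.
    rewrite -[leLHS]mulrA; apply: le_trans (ler_wpM2l (ltW kap0) E0) _.
    rewrite mulrA; apply: ler_wpM2r; first exact/ltW/wseq_gt0.
    by rewrite lerDl !mulr_ge0 ?(ltW hp) ?(ltW kap0) ?(ltW Q0).
  rewrite /Psi normrM (gtr0_norm kap0).
  have E1 := HC n t 0; rewrite normr0 addr0 in E1.
  have {}E1 := E1 ler01; have := HC n t (-1); rewrite normrN normr1 => /(_ (lexx _)) E2.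
  have w0 : 0 <= wexp A (h * `|t|) by exact/ltW/wexp_gt0.
  have hn : 0 <= h ^+ n by rewrite exprn_ge0// ltW.
  apply: le_trans (_ : h * kap * (h ^+ n * `|eta n t| * wexp A (h * `|t|) +
     h ^+ n * `|eta n (t - 1)| * wexp A (h * `|t|)) <= _).
    have -> : h * kap * (h ^+ n * `|eta n t| * wexp A (h * `|t|) +
     h ^+ n * `|eta n (t - 1)| * wexp A (h * `|t|)) =
      h ^+ n.+1 * (kap * (`|eta n t| + `|eta n (t - 1)|)) * wexp A (h * `|t|).
      by rewrite exprS; ring.
    rewrite ler_wpM2r// ler_wpM2l ?exprn_ge0 ?(ltW hp)// ler_wpM2l ?(ltW kap0)//.
    exact: ler_normB.
  have hk : 0 <= h * kap by rewrite mulr_ge0// ltW.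
  apply: le_trans (ler_wpM2l hk (lerD E1 E2)) _.
  apply: le_trans (_ : h * kap * 2 * C * (Q * M n.+1) <= _).
    rewrite [leLHS](_ : _ = h * kap * 2 * C * M n); last by ring.
    by rewrite ler_wpM2l// !mulr_ge0// ltW.
  rewrite mulrA ler_wpM2r ?lerDr ?mulr_ge0 ?(ltW kap0)//.
  exact/ltW/wseq_gt0.
move=> t.
have tel K : \sum_(i < K + K) Psi 0%N (t - (i%:R - K%:R)) =
    kap * (G (t + K%:R) - G (t - K%:R)).
  rewrite -mulr_sumr; congr (_ * _).
  pose a (i : nat) := G (t - (i%:R - K%:R)).
  rewrite (eq_bigr (fun i : 'I_(K + K) => - (a i.+1 - a i))); last first.
    move=> i _; rewrite [RHS]opprB /a; congr (_ - G _).
    by rewrite -natr1; ring.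
  rewrite sumrN -(big_mkord xpredT (fun i => a i.+1 - a i)) telescope_sumr// [LHS]opprB /a.
  by congr (G _ - G _); rewrite ?natrD; ring.
under eq_fun do rewrite tel.
have [cp cm] : (G (t + K%:R) @[K --> \oo] --> Lp) /\ (G (t - K%:R) @[K --> \oo] --> Lm).
  have big (s : R) : exists N : nat, forall K, (N <= K)%N -> s <= K%:R.
    have [N HN] := exists_nat s; exists N => K NK.
    by apply: le_trans HN _; rewrite ler_nat.
  split; apply/cvgrPdist_le => e e0.
    have [_ [s _ <-] Gs] := sup_adherent e0 (conj Gne Gub).
    have [N HN] := big (s - t); exists N => // K /= NK.
    rewrite ger0_norm ?subr_ge0//.
    have : G s <= G (t + K%:R) by apply: Gmono; have := HN K NK; lra.
    by move: Gs; rewrite -/Lp; lra.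
  have [_ [s _ <-] Gs] := inf_adherent e0 (conj Gne Glb).
  have [N HN] := big (t - s); exists N => // K /= NK.
  rewrite ler0_norm ?subr_le0// opprB.
  have : G (t - K%:R) <= G s by apply: Gmono; have := HN K NK; lra.
  by move: Gs; rewrite -/Lm; lra.
suff : (kap * (G (t + K%:R) - G (t - K%:R))) @[K --> \oo] --> kap * (Lp - Lm).
  by rewrite mulVf// gt_eqF.
by apply: cvgM; [exact: cvg_cst|exact: cvgB].
Qed.

End Averaging.
End OneDimensionalProfiles.

(** * Partitions of unity along the lattice *)

Section PartitionOfUnity.
Context {R : realType} {d : nat} (M A : nat -> R).
Notation V := 'rV[R]_d.
Notation e_ j := (delta_mx 0 j : 'rV[R]_d).
Hypothesis hM : weight_sequence M.
Hypothesis hM1 : cond_M1 M.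
Hypothesis hA : weight_sequence A.
Implicit Types (h k c t : R) (phi psi : cfun R d) (x y : V) (s : seq 'I_d).

Let M0 p : 0 < M p := wseq_gt0 p hM.
Let w0 (W : nat -> R) k x : 0 <= weight W k x := ltW (weight_gt0 W k x).

Lemma GS_Beurling_sqr_modulus phi : GS Beurling M A phi ->
  GS Beurling M A (pmul phi (cconj phi)).
Proof.
move=> /(GS_Beurling hM)[S H]; have [SJ _] := smooth_conj_D S.
apply/(GS_Beurling hM); split; first exact: smooth_mul.
move=> h hp; have h2 : 0 < 2 * h by rewrite mulr_gt0.
have hh : h <= 2 * h by rewrite ler_peMl ?(ltW hp)// ler1n.
have [c Hc] := H _ h2; exists (M 0%N * 1 * (c * c)).
apply: (bd_mul hM hM1 S SJ (ltW hp) ler01 (w0 A (2 * h)) (w0 A (2 * h)) _ Hc (bd_conj S Hc)).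
move=> x; rewrite mul1r; apply: le_trans (weight_mono x hA (ltW hp) hh) _.
by rewrite ler_peMr ?w0// weight_ge1 ?(ltW h2).
Qed.

(** The restriction of a nonzero element to a line parallel to an axis, squared
    to prevent cancellations in the integral. *)
Lemma profile_of_element phi (j : 'I_d) x : GS Beurling M A phi -> phi x <> 0 ->
  exists eta, [/\ profile A M eta, forall t, 0 <= eta 0%N t & 0 < eta 0%N 0].
Proof.
move=> /GS_Beurling_sqr_modulus G nz; set q := pmul _ _ in G.
have [S H] := (GS_Beurling hM A q).1 G.
have qE y : complex.Re (q y) = complex.Re (phi y) ^+ 2 + complex.Im (phi y) ^+ 2.
  by rewrite /q /pmul /cconj reM; case: (phi y) => a b /=; ring.
exists (fun n t => complex.Re (D (nseq n j) q (x + t *: e_ j))); split.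
- split=> [n t|h hp].
    by case: (has_pd_line x (smooth_has_pd (nseq n j) j S)) => + _; apply.
  have h2 : 0 < 2 * h by rewrite mulr_gt0.
  have hh : h <= 2 * h by rewrite ler_peMl ?(ltW hp)// ler1n.
  have [c Bc] := H _ h2; exists (c * weight A (2 * h) x) => n t.
  have W : wexp A (h * `|t|) <= weight A (2 * h) (x + t *: e_ j) * weight A (2 * h) x.
    have e1 : t *: e_ j = (x + t *: e_ j) + (- x) by rewrite addrC addKr.
    have := weight_add (x + t *: e_ j) (- x) hA (ltW hp).
    by rewrite -e1 weightN {1}/weight eucl_delta.
  have := Bc (nseq n j) (x + t *: e_ j); rewrite size_nseq => E.
  have hn : 0 <= h ^+ n by rewrite exprn_ge0 ?(ltW hp).
  apply: le_trans (_ : (2 * h) ^+ n * cmod (D (nseq n j) q (x + t *: e_ j)) *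
     (weight A (2 * h) (x + t *: e_ j) * weight A (2 * h) x) <= _).
    apply: ler_pM; [by rewrite mulr_ge0|exact/ltW/wexp_gt0| |exact: W].
    apply: ler_pM; [exact: hn|exact: normr_ge0| |exact: cmod_Re].
    by rewrite lerXn2r ?nnegrE ?(ltW hp) ?(ltW h2).
  by rewrite mulrA [leRHS]mulrAC ler_wpM2r ?w0.
- by move=> t; rewrite qE addr_ge0// sqr_ge0.
rewrite scale0r addr0 qE lt0r addr_ge0 ?sqr_ge0// andbT.
apply/negP; rewrite paddr_eq0 ?sqr_ge0// !sqrf_eq0 => /andP[/eqP r0 /eqP i0].
by apply: nz; move: r0 i0; case: (phi x) => a b /= -> ->.
Qed.

Lemma prod_M_le (l : seq 'I_d) (n : 'I_d -> nat) :
  (\prod_(j <- l) M (n j)) * M 0%N <= M 0%N ^+ size l * M (\sum_(j <- l) n j)%N.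
Proof.
elim: l => [|j l IH]; first by rewrite !big_nil expr0.
rewrite !big_cons /= -mulrA.
apply: le_trans (ler_wpM2l (ltW (M0 _)) IH) _.
rewrite mulrCA exprSr -mulrA ler_wpM2l ?exprn_ge0 ?(ltW (M0 _))//.
exact: M1_mul.
Qed.

(** The factor of the largest coordinate suffices; the others are at least one. *)
Lemma weight_le_prod h x : 0 <= h ->
  weight A h x <= \prod_(j < d) wexp A (h * d%:R * `|x 0 j|).
Proof.
move=> h0; have ge1 j : 1 <= wexp A (h * d%:R * `|x 0 j|).
  by rewrite wexp_ge1 ?mulr_ge0.
have prod_ge1 (P : pred 'I_d) : 1 <= \prod_(j < d | P j) wexp A (h * d%:R * `|x 0 j|).
  elim/big_ind: _ => // a b a1 b1; exact: mulr_ege1.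
have [x0|[j xj]] := eucl_max x.
  have -> : x = 0 by apply/rowP => j; rewrite x0 mxE.
  have := euclZ 0 (0 : V); rewrite scaler0 normr0 mul0r /weight => ->.
  rewrite mulr0 wexp0; elim/big_ind: _ => // [a b a1 b1|j _]; first exact: mulr_ege1.
  by rewrite wexp_ge1 ?mulr_ge0.
rewrite (bigD1 j)//=.
apply: le_trans (_ : wexp A (h * d%:R * `|x 0 j|) <= _).
  apply: wexp_mono; [exact: hA|by rewrite mulr_ge0 ?eucl_ge0|].
  by rewrite -mulrA ler_wpM2l.
by rewrite ler_peMr ?prod_ge1// ltW ?wexp_gt0.
Qed.

Section Tensor.
Variable Psi : 'I_d -> nat -> R -> R.
Hypothesis HPsi : forall j, profile A M (Psi j).

(** Each factor carries its own order of derivation, so that all the derivatives of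
    the product have this form. *)
Definition tensor (n : 'I_d -> nat) : cfun R d :=
  fun x => (\prod_(j < d) Psi j (n j) (x 0 j))%:C.

Let F s := tensor (fun j => count_mem j s).

Let F_bd h : 0 < h -> exists c, forall s x,
  h ^+ size s * cmod (F s x) * weight A h x <= c * M (size s).
Proof.
move=> hp; have d0 : 0 <= d%:R :> R by [].
pose h' := h * (d%:R + 1); have h'0 : 0 < h' by rewrite mulr_gt0// ltr_wpDl.
have hh' : h <= h' by rewrite ler_peMr ?(ltW hp)// lerDr.
have hd : h * d%:R <= h' by rewrite ler_wpM2l ?(ltW hp)// lerDl.
have /boolp.choice[c Hc] := fun j => profile_bound (HPsi j) h'0.
have c0 j : 0 <= c j.
  have := Hc j 0%N 0; rewrite expr0 mul1r => E.
  have : 0 <= c j * M 0%N by apply: le_trans E; rewrite mulr_ge0 ?(ltW (wexp_gt0 _ _)).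
  by rewrite pmulr_lge0.
exists ((\prod_(j < d) c j) * (M 0%N ^+ d / M 0%N)) => s x.
pose n j := count_mem j s.
have sE : size s = (\sum_(j < d) n j)%N.
  rewrite -(perm_size (perm_multi_seq s)) size_multi_seq; by [].
rewrite cmodR normr_prod {1}sE expr_sum.
apply: le_trans (ler_wpM2l _ (weight_le_prod x (ltW hp))) _.
  by rewrite mulr_ge0 ?prodr_ge0// => j _; rewrite exprn_ge0 ?(ltW hp).
rewrite -!big_split/=.
apply: le_trans (_ : \prod_(j < d) (c j * M (n j)) <= _).
  apply: ler_prod => j _; apply/andP; split.
    by rewrite !mulr_ge0 ?exprn_ge0 ?(ltW hp) ?(ltW (wexp_gt0 _ _)).
  apply: le_trans (Hc j (n j) (x 0 j)).
  apply: ler_pM; [by rewrite mulr_ge0// exprn_ge0 ?(ltW hp)|exact/ltW/wexp_gt0| |].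
    by rewrite ler_wpM2r// lerXn2r ?nnegrE ?(ltW hp) ?(ltW h'0).
  apply: wexp_mono; [exact: hA|by rewrite !mulr_ge0 ?(ltW hp)|].
  by rewrite ler_wpM2r.
rewrite big_split/= -mulrA ler_wpM2l ?prodr_ge0//.
rewrite mulrAC ler_pdivlMr ?M0//.
by have := prod_M_le (enum 'I_d) n; rewrite !big_enum /= size_enum_ord sE.
Qed.

Let F_pd s j : has_pd j (F s) (F (j :: s)).
Proof.
move=> x; split; last by exact: is_derive_cst.
pose n i := count_mem i s.
apply: is_derive_of_line; rewrite /F /tensor /=.
pose Q := \prod_(i < d | i != j) Psi i (n i) (x 0 i).
have E (t : R) : \prod_(i < d) Psi i (n i) ((x + t *: e_ j) 0 i) = Psi j (n j) (x 0 j + t) * Q.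
  rewrite (bigD1 j)//= !mxE !eqxx mulr1; congr (_ * _); apply: eq_bigr => i ij.
  by rewrite !mxE (negPf ij) andbF mulr0 addr0.
have -> : (fun t : R => \prod_(i < d) Psi i (n i) ((x + t *: e_ j) 0 i)) =
    (fun t : R => Q * (fun t => Psi j (n j) (x 0 j + t)) t).
  by apply/funext => t; rewrite E mulrC.
rewrite (bigD1 j)//= eqxx add1n mulrC.
rewrite (eq_bigr (fun i => Psi i (n i) (x 0 i))); last first.
  by move=> i ij; rewrite eq_sym (negPf ij) add0n.
apply: is_deriveZ.
have H : is_derive (x 0 j + 0 *: (1 : R)) 1 (Psi j (n j)) (Psi j (n j).+1 (x 0 j)).
  by rewrite scale0r addr0; exact: (profile_derive (HPsi j)).
have := is_derive_line H; congr is_derive; apply/funext => t.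
by rewrite [t *: 1]mulr1.
Qed.

Lemma tensor_GS : GS Beurling M A (tensor (fun=> 0%N)).
Proof.
have Fb s : loc_bounded (F s).
  have [c Hc] := F_bd ltr01; move=> x; exists (Num.max 0 (c * M (size s))).
    by rewrite le_max lexx.
  exists 1 => // y _; rewrite le_max; apply/orP; right; apply: le_trans (Hc s y).
  by rewrite expr1n mul1r ler_peMr ?cmod_ge0// weight_ge1.
have FS : smooth (F [::]) := smooth_of_family Fb F_pd.
apply/(GS_Beurling hM); split; first exact: FS.
move=> h hp; have [c Hc] := F_bd hp; exists c; split=> s x.
by rewrite -[tensor _]/(F [::]) (D_of_family F_pd); exact: Hc.
Qed.

End Tensor.

Definition lattice := {ffun 'I_d -> int}.
Definition pos (v : lattice) : V := \row_j (v j)%:~R.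
(** The lattice points with coordinates in [-K, ..., K - 1]: in each direction the
    [K + K] translates of a profile telescope. *)
Definition cube (K : nat) : seq lattice :=
  [seq ([ffun j => (v j : nat)%:Z - K%:Z] : lattice)
     | v : {ffun 'I_d -> 'I_(K + K)} <- enum {ffun 'I_d -> 'I_(K + K)}].

Lemma cube_uniq K : uniq (cube K).
Proof.
rewrite map_inj_uniq ?enum_uniq// => u v /ffunP E; apply/ffunP => j.
have := E j; rewrite !ffunE => /addIr; by case=> /val_inj.
Qed.

Lemma mem_cube K v : (v \in cube K) = [forall j, (- K%:Z <= v j) && (v j < K%:Z)].
Proof.
apply/mapP/forallP => [[u _ ->] j|H].
  rewrite ffunE; apply/andP; split; first by rewrite lerBrDr addNr.
  by rewrite ltrBlDr -PoszD ltz_nat.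
have K0 j : (`|(v j + K%:Z)%R|%N < K + K)%N.
  have /andP[a b] := H j; rewrite -ltz_nat gez0_abs; first by rewrite PoszD ltrD2r.
  by rewrite -lerBlDr sub0r.
exists [ffun j => Ordinal (K0 j)]; first by rewrite mem_enum.
apply/ffunP => j; rewrite !ffunE /= gez0_abs ?addrK//.
by have /andP[a _] := H j; rewrite -lerBlDr sub0r.
Qed.

(** The tensor product of averaged profiles: its sum over a cube is the product of
    the sums of the translates of the profiles. *)
Lemma partition_of_unity : (exists2 phi : cfun R d, GS Beurling M A phi & phi <> 0) ->
  exists psi, GS Beurling M A psi /\
    ptwise_limit (fun=> 1) (fun K x => \sum_(v <- cube K) psi (x - pos v)).
Proof.
move=> [phi G nz].
have [x nzx] : exists x, phi x <> 0.
  apply: contrapT => /forallNP H; apply: nz; apply/funext => x.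
  exact: contrapT (H x).
have /boolp.choice[Psi HPsi] : forall j : 'I_d, exists Psi, profile A M Psi /\ forall t,
    (\sum_(i < K + K) Psi 0%N (t - (i%:R - K%:R))) @[K --> \oo] --> (1 : R).
  move=> j; have [eta [P e0 e1]] := profile_of_element j G nzx.
  exact: (profile_average hA hM hM1 P e0 e1).
exists (tensor Psi (fun=> 0%N)); split.
  by apply: tensor_GS => j; case: (HPsi j).
move=> y e e0.
have E K : \sum_(v <- cube K) tensor Psi (fun=> 0%N) (y - pos v) =
    (\prod_(j < d) \sum_(i < K + K) Psi j 0%N (y 0 j - (i%:R - K%:R)))%:C.
  rewrite bigA_distr_bigA /= big_map big_enum /= rmorph_sum; apply: eq_bigr => v _.
  rewrite /tensor; congr (_%:C); apply: eq_bigr => j _; congr (Psi _ _ _).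
  by rewrite !mxE ffunE rmorphB.
have C : (\prod_(j < d) \sum_(i < K + K) Psi j 0%N (y 0 j - (i%:R - K%:R))) @[K --> \oo] --> (1 : R).
  elim: (index_enum 'I_d) => [|j l IH].
    by under eq_fun do rewrite big_nil; exact: cvg_cst.
  under eq_fun do rewrite big_cons.
  suff C (f g : nat -> R) : f @ \oo --> (1 : R) -> g @ \oo --> (1 : R) ->
    (f K * g K) @[K --> \oo] --> (1 : R) by apply: C; [exact: (HPsi j).2|exact: IH].
  by move=> Hf Hg; have := cvgM Hf Hg; rewrite mulr1; exact.
move/cvgrPdist_le : C => /(_ e e0)[N _ HN]; exists N => K NK.
by rewrite E -[1]/(1%:C) -rmorphB cmodR; exact: HN.
Qed.

End PartitionOfUnity.

(** * Sums over the lattice *)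

Section LatticeSums.
Context {R : realType} {d : nat}.
Notation V := 'rV[R]_d.
Notation lattice := (@lattice d).

(** The product makes the rates summable over the lattice; the first factor makes
    their sum outside large cubes small with an explicit bound. *)
Definition rate (v : lattice) : R :=
  ((1 + eucl_norm (pos v : V)) * \prod_(j < d) (1 + `|(v j)%:~R : R|) ^+ 2)^-1.

Lemma rate_factors_gt0 (v : lattice) : 0 < 1 + eucl_norm (pos v : V) /\
  0 < \prod_(j < d) (1 + `|(v j)%:~R : R|) ^+ 2.
Proof.
split; first by rewrite ltr_pwDl// eucl_ge0.
by apply: prodr_gt0 => j _; rewrite exprn_gt0// ltr_pwDl.
Qed.

Lemma rate_ge0 v : 0 <= rate v.
Proof.
by have [a b] := rate_factors_gt0 v; rewrite invr_ge0 mulr_ge0 ?(ltW a) ?(ltW b).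
Qed.

Lemma sum_inv_sqr n : \sum_(i < n) ((1 + i%:R) ^+ 2)^-1 <= 2 :> R.
Proof.
suff H : \sum_(i < n.+1) ((1 + i%:R) ^+ 2)^-1 <= 2 - n.+1%:R^-1 :> R.
  apply: le_trans (_ : \sum_(i < n.+1) ((1 + i%:R) ^+ 2)^-1 <= (2 : R)).
    by rewrite big_ord_recr /= lerDl invr_ge0 exprn_ge0.
  by apply: le_trans H _; rewrite gerBl invr_ge0.
elim: n => [|n IH]; first by rewrite big_ord1 addr0 expr1n invr1; lra.
rewrite big_ord_recr /=; apply: le_trans (lerD IH (lexx _)) _.
rewrite [1 + _]addrC natr1.
have a0 : 0 < n.+1%:R :> R by rewrite ltr0n.
have b0 : 0 < n.+2%:R :> R by rewrite ltr0n.
have : (n.+2%:R ^+ 2)^-1 <= n.+1%:R^-1 - n.+2%:R^-1 :> R.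
  have -> : n.+1%:R^-1 - n.+2%:R^-1 = (n.+1%:R * n.+2%:R)^-1 :> R.
    move: a0 b0; rewrite -[n.+2%:R]natr1; set a := n.+1%:R => a0 b0.
    by rewrite -[LHS]mul1r -{1}(addrK a 1) [1 + a]addrC; field; rewrite !gt_eqF.
  by rewrite lef_pV2 ?posrE ?mulr_gt0 ?exprn_gt0// expr2 ler_wpM2r ?(ltW b0)// ler_nat.
move: (n.+2%:R ^- 2) (n.+1%:R^-1) (n.+2%:R^-1) => x y z; lra.
Qed.

Lemma sum_cube_factor K : \sum_(i < K + K) ((1 + `|((i : nat)%:Z - K%:Z)%:~R : R|) ^+ 2)^-1 <= 4.
Proof.
rewrite big_split_ord /=.
have -> : (4 : R) = 2 + 2 by rewrite -natrD.
apply: lerD; apply: le_trans (sum_inv_sqr K).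
  rewrite (reindex_inj rev_ord_inj) /=; apply: ler_sum => i _.
  rewrite lef_pV2 ?posrE ?exprn_gt0 ?ltr_pwDl// lerXn2r ?nnegrE ?addr_ge0//.
  rewrite lerD2l rmorphB /= -!pmulrn natrB//.
  have -> : K%:R - i.+1%:R - K%:R = - i.+1%:R :> R by ring.
  by rewrite normrN normr_nat ler_nat.
apply: ler_sum => i _.
have -> : (K + i)%N%:Z - K%:Z = i%:Z by rewrite PoszD [LHS]addrC addKr.
by rewrite -pmulrn normr_nat.
Qed.

Lemma sum_cube_prod K :
  \sum_(v <- cube K) (\prod_(j < d) (1 + `|((v : lattice) j)%:~R : R|) ^+ 2)^-1 <= 4 ^+ d.
Proof.
rewrite big_map big_enum /=.
rewrite (eq_bigr (fun v : {ffun 'I_d -> 'I_(K + K)} =>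
   \prod_(j < d) ((1 + `|((v j : nat)%:Z - K%:Z)%:~R : R|) ^+ 2)^-1)); last first.
  by move=> v _; rewrite -prodfV; apply: eq_bigr => j _; rewrite ffunE.
rewrite -(bigA_distr_bigA (fun (j : 'I_d) (i : 'I_(K + K)) =>
  ((1 + `|((i : nat)%:Z - K%:Z)%:~R : R|) ^+ 2)^-1)).
apply: le_trans (_ : \prod_(j < d) (4 : R) <= _); last by rewrite prodr_const card_ord.
by apply: ler_prod => j _; rewrite sum_cube_factor andbT sumr_ge0.
Qed.

Lemma rate_le (v : lattice) : rate v <= (\prod_(j < d) (1 + `|(v j)%:~R : R|) ^+ 2)^-1.
Proof.
have [a b] := rate_factors_gt0 v; rewrite /rate invfM ler_piMl ?invr_ge0 ?(ltW b)//.
by rewrite invf_le1// lerDl eucl_ge0.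
Qed.

Lemma rate_outside m (v : lattice) : v \notin cube m ->
  rate v <= (1 + m%:R)^-1 * (\prod_(j < d) (1 + `|(v j)%:~R : R|) ^+ 2)^-1.
Proof.
rewrite mem_cube negb_forall => /existsP[j vj].
have [a b] := rate_factors_gt0 v; rewrite /rate invfM ler_wpM2r ?invr_ge0 ?(ltW b)//.
rewrite lef_pV2 ?posrE// ?ltr_pwDl// lerD2l.
apply: le_trans (eucl_coord (pos v : V) j); rewrite mxE.
have -> : m%:R = (m%:Z)%:~R :> R by [].
rewrite -intr_norm ler_int; move: vj; rewrite negb_and -!ltNge -leNgt => /orP[vj|vj].
  by apply: le_trans (_ : - v j <= _); [rewrite lerNr ltW|rewrite -normrN ler_norm].
exact: le_trans vj (ler_norm _).
Qed.

Lemma sum_rate K : \sum_(v <- cube K) rate v <= 4 ^+ d.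
Proof.
by apply: le_trans (sum_cube_prod K); apply: ler_sum => v _; exact: rate_le.
Qed.

Lemma sum_rate_outside m n :
  \sum_(v <- cube n | v \notin cube m) rate v <= 4 ^+ d / (1 + m%:R).
Proof.
apply: le_trans (_ : \sum_(v <- cube n) (1 + m%:R)^-1 *
    (\prod_(j < d) (1 + `|((v : lattice) j)%:~R : R|) ^+ 2)^-1 <= _).
  rewrite [leRHS](bigID (fun v => v \notin cube m)) /=.
  apply: le_trans (_ : \sum_(v <- cube n | v \notin cube m) (1 + m%:R)^-1 *
    (\prod_(j < d) (1 + `|((v : lattice) j)%:~R : R|) ^+ 2)^-1 <= _).
    by apply: ler_sum => v; exact: rate_outside.
  rewrite lerDl sumr_ge0// => v _; have [_ b] := rate_factors_gt0 v.
  by rewrite mulr_ge0 ?invr_ge0 ?(ltW b)// addr_ge0.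
rewrite -mulr_sumr mulrC ler_wpM2r ?sum_cube_prod// invr_ge0 addr_ge0//.
Qed.

Lemma cube_sum_diff (U : zmodType) (F : lattice -> U) m n : (m <= n)%N ->
  \sum_(v <- cube n) F v - \sum_(v <- cube m) F v =
  \sum_(v <- cube n | v \notin cube m) F v.
Proof.
move=> mn; rewrite (bigID (mem (cube m))) /= addrC.
suff -> : \sum_(v <- cube n | v \in cube m) F v = \sum_(v <- cube m) F v by rewrite addrK.
rewrite -big_filter; apply: perm_big; apply: uniq_perm.
- by rewrite filter_uniq// cube_uniq.
- exact: cube_uniq.
move=> v; rewrite mem_filter; apply: andb_idr; rewrite !mem_cube => /forallP H.
apply/forallP => j; have /andP[a b] := H j.
have mnz : m%:Z <= n%:Z by rewrite lez_nat.
by rewrite (le_trans _ a) ?lerN2// (lt_le_trans b).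
Qed.

(** The weights grow faster than every power. *)
Lemma weight_rate (W : nat -> R) k : weight_sequence W -> 0 < k ->
  exists2 Q, 0 < Q & forall v : lattice, (weight W k (pos v : V))^-1 <= Q * rate v.
Proof.
move=> hW kp; have [C C0 HC] := wexp_poly (d * 2).+1 hW.
pose kap := 1 + k^-1; have ki : 0 < k^-1 by rewrite invr_gt0.
have kap0 : 0 < kap by rewrite addr_gt0.
exists (kap ^+ (d * 2).+1 * C); first by rewrite mulr_gt0 ?exprn_gt0.
move=> v; have [a b] := rate_factors_gt0 v.
rewrite /rate ler_pdivlMr ?mulr_gt0// mulrC ler_pdivrMr ?weight_gt0//.
pose e := eucl_norm (pos v : V); have e0 : 0 <= e by exact: eucl_ge0.
apply: le_trans (_ : (1 + e) ^+ (d * 2).+1 <= _).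
  rewrite exprS ler_wpM2l ?(ltW a)//.
  apply: le_trans (_ : \prod_(j < d) (1 + e) ^+ 2 <= _); last first.
    by rewrite prodr_const card_ord -exprM mulnC.
  apply: ler_prod => j _; rewrite exprn_ge0 ?addr_ge0//=.
  rewrite lerXn2r ?nnegrE ?addr_ge0// lerD2l.
  by have := eucl_coord (pos v : V) j; rewrite mxE.
rewrite -mulrA; apply: le_trans (ler_wpM2l _ (HC (k * e) _)); last 2 first.
- by rewrite exprn_ge0 ?(ltW kap0).
- by rewrite mulr_ge0 ?(ltW kp).
have ke : 0 <= k * e by rewrite mulr_ge0 ?(ltW kp).
have kE : kap * (1 + k * e) = 1 + k * e + k^-1 + e.
  by rewrite /kap; field; rewrite gt_eqF.
have le1 : 1 + e <= kap * (1 + k * e) by rewrite kE; lra.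
by rewrite -exprMn lerXn2r ?nnegrE ?(le_trans _ le1)// addr_ge0.
Qed.

End LatticeSums.

(** * Extension by localization *)

Section Extension.
Context {R : realType} {d : nat} (M A B : nat -> R).
Notation V := 'rV[R]_d.
Notation lattice := (@lattice d).
Hypothesis hM : weight_sequence M.
Hypothesis hM1 : cond_M1 M.
Hypothesis hA : weight_sequence A.
Hypothesis hA2 : cond_M2 A.
Hypothesis hB : weight_sequence B.
Hypothesis hAB : wsubset A B.
Implicit Types (h k c t : R) (phi chi psi : cfun R d) (x y : V) (f : cfun R d -> R[i]).

Let M0 p : 0 < M p := wseq_gt0 p hM.
Let w0 (W : nat -> R) k x : 0 <= weight W k x := ltW (weight_gt0 W k x).
Let iw0 (W : nat -> R) k x : 0 <= (weight W k x)^-1 := inv_weight_ge0 W k x.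

Variable psi : cfun R d.
Hypothesis Gpsi : GS Beurling M A psi.
Hypothesis psi1 : ptwise_limit (fun=> 1) (fun K x => \sum_(v <- cube K) psi (x - pos v)).

Let Spsi : smooth psi := GS_smooth hM Gpsi.

Lemma psi_bd h k : 0 < h -> 0 < k -> exists2 c, 0 <= c & bd M h (weight A k) (refl 0 psi) c.
Proof.
move=> hp kp; have mp : 0 < Num.max h k by rewrite lt_max hp.
have m2 : 0 < 2 * Num.max h k by rewrite mulr_gt0.
have [c Hc] := ((GS_Beurling hM A psi).1 Gpsi).2 _ m2.
have H := gs_refl hA 0 mp Spsi Hc.
exists (weight A (2 * Num.max h k) (0 : V) * c); first exact: (bd_ge0 (M0 _) (w0 _ _) H).
apply: (bd_mono (ltW hp) _ (w0 _ _) _ H); first by rewrite le_max lexx.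
by move=> x; apply: (weight_mono x hA (ltW kp)); rewrite le_max lexx orbT.
Qed.

(** The part of [chi] near the lattice point [v], reflected to the origin: the
    value of [f] at [piece v chi] is that of a convolution at [v]. *)
Definition local_piece v chi := pmul (refl (pos v) chi) (refl 0 psi).

Definition piece v chi : cfun R d := refl (pos v) (local_piece v chi).

Lemma pieceE v chi y : piece v chi y = (chi y : R[i]) * (psi (y - pos v) : R[i]).
Proof. by rewrite /piece /local_piece /pmul /refl subKr sub0r opprB. Qed.

Lemma smooth_local_piece v chi : smooth chi -> smooth (local_piece v chi).
Proof. by move=> S; apply: smooth_mul; exact: smooth_refl. Qed.

Lemma smooth_piece v chi : smooth chi -> smooth (piece v chi).
Proof. by move=> S; apply: smooth_refl; exact: (smooth_local_piece v S). Qed.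

Lemma piece_lin v (a : R[i]) chi chi' :
  piece v (a *: chi + chi') = a *: piece v chi + piece v chi'.
Proof.
apply/funext => y; rewrite pieceE !cfunD !cfunZ !pieceE; ring.
Qed.

(** Localization turns functions of moderate growth into test functions, with norms
    that grow with the lattice point like the weight of [B]; the decay of [psi]
    absorbs the growth away from that point, by the inclusion of [A] in [B]. *)
Lemma local_piece_bd h k : 0 < h -> 0 < k -> exists2 Q, 0 <= Q &
  forall v chi c, smooth chi -> ocb M B (2 * h) k chi c ->
    gsb M A h (local_piece v chi) (Q * c * weight B (2 * k) (pos v)).
Proof.
move=> hp kp; have [C [L [Cp Lp HL]]] := wexp_subset hA hB hAB.
have [C2 [H [C21 H1 HH]]] := @weight_prod R d A hA hA2.
have H0 : 0 < H by exact: lt_le_trans ltr01 H1.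
have C20 : 0 < C2 by exact: lt_le_trans ltr01 C21.
have k2 : 0 < 2 * k by rewrite mulr_gt0.
have Lk : 0 < L * (2 * k) by rewrite mulr_gt0.
pose m := H * Num.max h (L * (2 * k)).
have mp : 0 < m by rewrite mulr_gt0// lt_max hp.
have h2 : 0 < 2 * h by rewrite mulr_gt0.
have [cp cp0 Bp] := psi_bd h2 mp.
exists (M 0%N * (C * C2) * cp).
  by rewrite !mulr_ge0 ?(ltW Cp) ?(ltW C20) ?(ltW (M0 0)).
move=> v chi c S Bc; set p := pos v.
pose w1 z := (weight B k (p - z))^-1.
have B1 : bd M (2 * h) w1 (refl p chi) (1 * c).
  by apply: (bd_refl S (ltW h2) ler01 _ Bc) => z; rewrite mul1r.
have W z : weight A h z <= (C * C2 * weight B (2 * k) p) * (w1 z * weight A m z).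
  rewrite /w1 mulrCA mulrC ler_pdivlMr ?weight_gt0//.
  have E1 := weight_add p (- z) hB (ltW kp); rewrite weightN in E1.
  apply: le_trans (ler_wpM2l (w0 A h z) E1) _.
  have E2 : weight B (2 * k) z <= C * weight A (L * (2 * k)) z.
    rewrite /weight -[L * (2 * k) * _]mulrA; apply: HL.
    exact: mulr_ge0 (ltW k2) (eucl_ge0 z).
  have E3 := HH h (L * (2 * k)) z (ltW hp) (ltW Lk).
  rewrite mulrCA; apply: le_trans (_ : weight B (2 * k) p * (C * (C2 * weight A m z)) <= _).
    apply: (ler_wpM2l (w0 _ _ _)).
    apply: le_trans (ler_wpM2l (w0 A h z) E2) _.
    by rewrite mulrCA; apply: (ler_wpM2l (ltW Cp)); exact: E3.
  by apply: le_of_eq; ring.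
have K0 : 0 <= C * C2 * weight B (2 * k) p.
  by rewrite !mulr_ge0 ?(ltW Cp) ?(ltW C20) ?w0.
have := bd_mul hM hM1 (smooth_refl p S) (smooth_refl 0 Spsi) (ltW hp) K0
  (fun z => iw0 B k (p - z)) (w0 A m) W B1 Bp.
by congr (bd _ _ _ _ _); rewrite mul1r; ring.
Qed.

(** Of [z] and [pos v - z], one is comparable in norm with [pos v], so that the
    decay of [chi] and of [psi] together gives any rate in [v]. *)
Lemma piece_bd : exists2 H : R, 1 <= H & forall h chi c, 0 < h -> smooth chi ->
  gsb M A (H * h) chi c -> exists2 Q, 0 <= Q & forall v, gsb M A h (piece v chi) (Q * rate v).
Proof.
have [C2 [H [C21 H1 HH]]] := @weight_prod R d A hA hA2.
have H0 : 0 < H by exact: lt_le_trans ltr01 H1.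
have C20 : 0 < C2 by exact: lt_le_trans ltr01 C21.
exists (2 * H); first by lra.
move=> h chi c hp S Bc.
have h2 : 0 < 2 * h by rewrite mulr_gt0.
have Hh : 0 < H * (2 * h) by rewrite mulr_gt0.
have [cp cp0 Bp] := psi_bd h2 h2.
have [Q Q0 HQ] := @weight_rate _ d A h hA hp.
have c0 : 0 <= c by exact: (bd_ge0 (M0 _) (w0 _ _) Bc).
exists (M 0%N * (C2 * Q) * (c * cp)).
  by rewrite !mulr_ge0 ?(ltW Q0) ?(ltW C20) ?(ltW (M0 0)).
move=> v; pose p : V := pos v.
have E : piece v chi = pmul chi (refl p (refl 0 psi)).
  by apply/funext => y; rewrite pieceE /pmul /refl sub0r opprB.
have B1 : bd M (2 * h) (weight A (H * (2 * h))) chi c.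
  apply: (bd_mono (ltW h2) _ (w0 _ _) _ Bc).
    by rewrite mulrAC ler_peMr ?(ltW h2).
  by move=> y; rewrite (_ : H * (2 * h) = 2 * H * h)//; ring.
pose w2 z := weight A (2 * h) (p - z).
have B2 : bd M (2 * h) w2 (refl p (refl 0 psi)) (1 * cp).
  by apply: (bd_refl (smooth_refl 0 Spsi) (ltW h2) ler01 _ Bp) => z; rewrite mul1r.
have W z : weight A h z <= (C2 * (Q * rate v)) * (weight A (H * (2 * h)) z * w2 z).
  have E1 : weight A h p <= weight A (2 * h) z * weight A (2 * h) (p - z).
    have := weight_add z (p - z) hA (ltW hp); by rewrite addrC subrK.
  have E2 := HH h (2 * h) z (ltW hp) (ltW h2).
  have mE : Num.max h (2 * h) = 2 * h.
    by apply/max_idPr; rewrite ler_peMl ?(ltW hp)// ler1n.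
  rewrite mE in E2.
  apply: le_trans (_ : weight A h z * (weight A h p * (Q * rate v)) <= _).
    rewrite ler_peMr ?w0//; have := HQ v; rewrite -/p => HQv.
    apply: le_trans (ler_wpM2l (w0 A h p) HQv); rewrite divff//.
    by rewrite gt_eqF ?weight_gt0.
  have r0 : 0 <= Q * rate v by rewrite mulr_ge0 ?(ltW Q0) ?rate_ge0.
  rewrite mulrA [leRHS](_ : _ = (C2 * weight A (H * (2 * h)) z * w2 z) * (Q * rate v)); last by ring.
  apply: (ler_wpM2r r0); apply: le_trans (ler_wpM2l (w0 A h z) E1) _.
  by rewrite mulrA; apply: (ler_wpM2r (w0 _ _ _)).
have K0 : 0 <= C2 * (Q * rate v) by rewrite !mulr_ge0 ?(ltW C20) ?(ltW Q0) ?rate_ge0.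
rewrite E; have := bd_mul hM hM1 S (smooth_refl p (smooth_refl 0 Spsi)) (ltW hp) K0
  (w0 A _) (fun z => w0 A _ (p - z)) W B1 B2.
by congr (bd _ _ _ _ _); rewrite mul1r; ring.
Qed.

Lemma vanishing_inv (Q : R) : vanishing (fun n => Q / (1 + n%:R)).
Proof.
move=> e e0; have [N HN] := exists_nat (Q / e); exists N => n Nn.
have n0 : 0 < 1 + n%:R :> R by rewrite ltr_pwDl.
rewrite ler_pdivrMr// mulrC -ler_pdivrMr//; apply: le_trans HN _.
by rewrite ler_wpDl// ler_nat.
Qed.

Section Functional.
Variables (cl : gs_class) (f : cfun R d -> R[i]).
Hypothesis Df : lcs_dual (GS cl M A) f.

Let Sub : subspace (GS cl M A : lcs (cfun R d)). Proof. exact: GS_subspace. Qed.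
Let L : linear_on (GS cl M A : lcs (cfun R d)) f. Proof. by case: Df. Qed.

(** As [chi] is the sum of its pieces, an extension of [f] to [chi] has to be the
    sum of its values there; convergence is the content of [partial_limit]. *)
Definition partial chi K := \sum_(v <- cube K) f (piece v chi).
Definition extension chi : R[i] := xget (0 : R[i]) [set l | clim l (partial chi)].

Definition piecewise chi := forall v, GS cl M A (piece v chi).

Lemma partial_limit chi (Q : R) :
  (forall v, cmod (f (piece v chi)) <= Q * rate v) ->
  clim (extension chi) (partial chi) /\ cmod (extension chi) <= 2 * 4 ^+ d * Q.
Proof.
move=> H; pose tau n : R := Q * 4 ^+ d / (1 + n%:R).
have H0 := H [ffun=> 0].
have [a b] := @rate_factors_gt0 R d [ffun=> 0].
have Q0 : 0 <= Q.
  have : 0 <= Q * rate ([ffun=> 0] : lattice) by apply: le_trans H0; exact: cmod_ge0.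
  by rewrite pmulr_lge0// invr_gt0 mulr_gt0.
have T : vanishing tau by exact: vanishing_inv.
have Cau m n : (m <= n)%N -> cmod (partial chi n - partial chi m) <= tau m.
  move=> mn; rewrite /partial cube_sum_diff//; apply: le_trans (cmod_sum _ _ _) _.
  apply: le_trans (_ : \sum_(v <- cube n | v \notin cube m) Q * rate v <= _).
    by apply: ler_sum => v _; exact: H.
  by rewrite -mulr_sumr /tau -mulrA ler_wpM2l// sum_rate_outside.
have [l Hl] := complex_cauchy_limit T Cau.
have lim : clim l (partial chi).
  by move=> e /T[N HN]; exists N => n Nn; apply: le_trans (Hl n) (HN n Nn).
have -> : extension chi = l.
  apply: (@clim_unique _ _ _ (partial chi)); last exact: lim.
  exact: (@xgetPex _ (0 : R[i]) [set l | clim l (partial chi)] (ex_intro _ l lim)).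
(* One [4 ^+ d] for the first partial sum, one for the rest of the series. *)
split => //; rewrite -[l](subrK (partial chi 0)).
apply: le_trans (cmodD _ _) _; rewrite -mulrA mulrDl mul1r; apply: lerD.
  by apply: le_trans (Hl 0%N) _; rewrite /tau addr0 divr1 mulrC.
apply: le_trans (cmod_sum _ _ _) _.
apply: le_trans (_ : \sum_(v <- cube 0) Q * rate v <= _).
  by apply: ler_sum => v _; exact: H.
by rewrite -mulr_sumr mulrC ler_wpM2r// sum_rate.
Qed.

Lemma extension_lin (a : R[i]) chi chi' Q Q' : piecewise chi -> piecewise chi' ->
  (forall v, cmod (f (piece v chi)) <= Q * rate v) ->
  (forall v, cmod (f (piece v chi')) <= Q' * rate v) ->
  extension (a *: chi + chi') = a * extension chi + extension chi'.
Proof.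
move=> P P' H H'; have fE v : f (piece v (a *: chi + chi')) =
    a * f (piece v chi) + f (piece v chi').
  by rewrite piece_lin; exact: L (P v) (P' v).
have H'' v : cmod (f (piece v (a *: chi + chi'))) <= (cmod a * Q + Q') * rate v.
  rewrite fE; apply: le_trans (cmodD _ _) _; rewrite cmodM mulrDl -mulrA.
  by apply: lerD; [apply: (ler_wpM2l (cmod_ge0 a)); exact: H|exact: H'].
have [E _] := partial_limit H; have [E' _] := partial_limit H'.
have [E'' _] := partial_limit H''.
apply: (clim_unique E''); have := clim_lin a E E'.
rewrite (_ : (fun n => _) = partial (a *: chi + chi'))//; apply/funext => K.
rewrite /partial mulr_sumr -big_split/=; apply: eq_bigr => v _; exact/esym/fE.
Qed.

Lemma sum_pieceE chi K y : (\sum_(v <- cube K) piece v chi) y =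
  (chi y : R[i]) * \sum_(v <- cube K) (psi (y - pos v) : R[i]).
Proof.
rewrite fct_sumE mulr_sumr; apply: eq_bigr => v _; exact: pieceE.
Qed.

(** On test functions the series of the pieces converges in the test space, so
    that nothing is lost by summing the values of [f]. *)
Lemma extension_GS chi : GS cl M A chi -> piecewise chi -> extension chi = f chi.
Proof.
move=> G P; have S := GS_smooth hM G; have [H H1 HP] := piece_bd.
have [h [C [c [hp C0 Bc HC]]]] := dual_level hM hA H1 Df G.
have [Q Q0 HQ] := HP h chi c hp S Bc.
have Sp v : smooth (piece v chi) by exact: smooth_piece.
have fp v : cmod (f (piece v chi)) <= (C * Q) * rate v.
  by rewrite -mulrA; apply: (HC _ _ (P v)); exact: HQ.
have [E _] := partial_limit fp; apply: (clim_unique E).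
pose Phi K : cfun R d := \sum_(v <- cube K) piece v chi.
have bd_sum (l : seq lattice) (p : pred lattice) : smooth (\sum_(v <- l | p v) piece v chi) /\
    gsb M A h (\sum_(v <- l | p v) piece v chi) (\sum_(v <- l | p v) Q * rate v).
  elim: l => [|v l [S1 B1]]; first by rewrite !big_nil; split; [exact: smooth0|exact: bd_zero].
  rewrite !big_cons; case: (p v); last exact: (conj S1 B1).
  rewrite -[piece v chi]scale1r; split; first exact: (smooth_lin 1 (Sp v) S1).
  have := bd_lin 1 (Sp v) S1 (ltW hp) (w0 A h) (HQ v) B1.
  by rewrite (cmodR 1) normr1 mul1r.
have SPhi K : smooth (Phi K) by case: (bd_sum (cube K) xpredT).
pose tau n : R := Q * 4 ^+ d / (1 + n%:R).
have T : vanishing tau by exact: vanishing_inv.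
have Cau m n : (m <= n)%N -> bd M h (weight A h) (Phi n - Phi m) (tau m).
  move=> mn; rewrite /Phi cube_sum_diff//.
  have [_ B1] := bd_sum (cube n) (fun v => v \notin cube m).
  apply: (bd_le M0 _ B1); rewrite -mulr_sumr /tau -mulrA ler_wpM2l//.
  exact: sum_rate_outside.
have W1 x : 1 <= weight A h x := weight_ge1 x hA (ltW hp).
have [phi Sphi Bphi] := step_complete M0 hp W1 SPhi (bd_sum (cube 0) xpredT).2 T Cau.
have Elim : phi = chi.
  apply: (@ptwise_limit_unique _ _ _ _ Phi).
    by apply: (ptwise_limit_bd (j := 0) hM hp W1 T) => n; rewrite addn0; exact: Bphi.
  move=> x e e0; have [N HN] := vanishing_scale (cmod_ge0 (chi x)) (psi1 x) e0.
  exists N => n Nn; rewrite /Phi sum_pieceE -[X in X - _]mulr1 -mulrBr cmodM.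
  exact: HN.
rewrite {}Elim in Bphi Sphi.
move=> e e0; have [N HN] := vanishing_scale C0 T e0; exists N => n Nn.
have [GPhi fPhi] := linear_on_sum (cube n) Sub L P.
rewrite /partial -fPhi -(linear_onB Sub L G GPhi).
exact: le_trans (HC _ _ (subspaceB Sub G GPhi) (Bphi n)) (HN n Nn).
Qed.

(** Of the weight [m] by which the convolutions decay, one factor of [weight B (2 * k)]
    compensates the norms of the pieces of [chi], and the other one yields the rate. *)
Lemma piece_value_bd h k m (Q0 CB : R) : 0 < h -> 0 < k -> 0 <= Q0 -> 0 <= CB ->
  (forall x phi c, GS cl M A phi -> gsb M A h phi c ->
     cmod (convolution f phi x) * weight B m x <= Q0 * c) ->
  (forall x : V, weight B (2 * k) x * weight B (2 * k) x <= CB * weight B m x) ->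
  exists2 Q, 0 <= Q & forall v chi c, smooth chi -> GS cl M A (local_piece v chi) ->
    ocb M B (2 * h) k chi c -> cmod (f (piece v chi)) <= Q * c * rate v.
Proof.
move=> hp kp Q00 CB0 HQ0 HCB; have k2 : 0 < 2 * k by rewrite mulr_gt0.
have [Q1 Q10 HQ1] := local_piece_bd hp kp.
have [Q2 Q20 HQ2] := @weight_rate _ d B (2 * k) hB k2.
exists (Q0 * Q1 * CB * Q2); first by rewrite !mulr_ge0 ?(ltW Q20).
move=> v chi c S G Bc; pose p : V := pos v.
have c0 : 0 <= c by exact: (bd_ge0 (M0 _) (fun x => iw0 B k x) Bc).
have D := HQ0 p _ _ G (HQ1 v chi c S Bc).
have wk := weight_gt0 B (2 * k) p; have wm := weight_gt0 B m p.
have E : (weight B (2 * k) p) / weight B m p <= CB * (Q2 * rate v).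
  apply: le_trans (_ : CB * (weight B (2 * k) p)^-1 <= _); last first.
    by apply: (ler_wpM2l CB0); exact: HQ2.
  by rewrite (ler_pdivrMr _ _ wm) mulrAC (ler_pdivlMr _ _ wk); exact: HCB.
rewrite -ler_pdivlMr// in D; apply: le_trans D _.
rewrite (_ : Q0 * (Q1 * c * weight B (2 * k) p) / weight B m p =
   Q0 * Q1 * c * (weight B (2 * k) p / weight B m p)); last by ring.
rewrite (_ : Q0 * Q1 * CB * Q2 * c * rate v = Q0 * Q1 * c * (CB * (Q2 * rate v))); last by ring.
by apply: ler_wpM2l; [rewrite !mulr_ge0|exact: E].
Qed.

End Functional.

(** * The equivalence *)

Hypothesis hB2 : cond_M2 B.

Lemma ocb_of_gsb h k phi c : 0 < h -> 0 <= k -> gsb M A h phi c -> ocb M B h k phi c.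
Proof.
move=> hp k0; apply: (bd_mono (ltW hp) (lexx h) (fun x => inv_weight_ge0 B k x)) => x.
apply: le_trans (weight_ge1 x hA (ltW hp)).
by rewrite invf_le1 ?weight_gt0//; exact: weight_ge1.
Qed.

Lemma GS_sub_OC cl phi : GS cl M A phi -> OC cl M B phi.
Proof.
case: cl => [/(GS_Beurling hM)[S H]|/(GS_Roumieu hM)[S [h hp [c Hc]]]].
  apply: (OC_Beurling B hM _).2; exists 0%N; split; first exact: S.
  by move=> h hp; have [c Hc] := H h hp; exists c; exact: (ocb_of_gsb hp (ler0n R 0) Hc).
apply: (OC_Roumieu B hM _).2; exists h; first exact: hp.
split; first exact: S.
move=> N _; exists c; apply: (ocb_of_gsb hp _ Hc); by rewrite invr_ge0.
Qed.

Lemma piecewise_OC cl chi : OC cl M B chi ->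
  forall v, GS cl M A (local_piece v chi) /\ GS cl M A (piece v chi).
Proof.
move=> O v; suff G : GS cl M A (local_piece v chi).
  by split; [exact: G|exact: (GS_refl hM hA)].
case: cl O => [/(OC_Beurling B hM)[n [S H]]|/(OC_Roumieu B hM)[h hp [S H]]].
  apply/(GS_Beurling hM); split; first exact: (smooth_local_piece v S).
  move=> h hp; have n1 : 0 < n.+1%:R :> R by rewrite ltr0n.
  have [Q Q0 HQ] := local_piece_bd hp n1.
  have h2 : 0 < 2 * h by rewrite mulr_gt0.
  have [c Hc] := H _ h2; exists (Q * c * weight B (2 * n.+1%:R) (pos v : V)).
  apply: (HQ v chi c S); apply: (ocb_mono hB (ltW h2) (lexx _) (ler0n R n) _ Hc).
  by rewrite ler_nat.
apply/(GS_Roumieu hM); split; first exact: (smooth_local_piece v S).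
have h2 : 0 < h / 2 by rewrite divr_gt0.
have [Q Q0 HQ] := local_piece_bd h2 ltr01.
exists (h / 2); first exact: h2.
have [c Hc] := H 1%N isT; exists (Q * c * weight B (2 * 1) (pos v : V)).
apply: (HQ v chi c S); rewrite (_ : 2 * (h / 2) = h); last by field.
by move: Hc; rewrite invr1.
Qed.

(** Uniform decay is used for a weight [m] that beats, by (M.2), the growth of the
    [n]-th step twice: once against the norms of the pieces, once for the rate. *)
Lemma piece_values_Beurling f : lcs_dual (GS Beurling M A) f ->
  (forall phi, GS Beurling M A phi -> decaying_cont Beurling B (convolution f phi)) ->
  forall n : nat, exists h C, [/\ 0 < h, 0 <= C & forall chi c, OC Beurling M B chi ->
    ocb M B h n%:R chi c -> forall v, cmod (f (piece v chi)) <= C * c * rate v].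
Proof.
move=> Df D n; have [CB [HB [CB1 HB1 HCB]]] := @weight_prod R d B hB hB2.
have n1 : 0 < n.+1%:R :> R by rewrite ltr0n.
have k2 : 0 < 2 * n.+1%:R :> R by rewrite mulr_gt0.
have CB0 : 0 <= CB by exact: le_trans ler01 CB1.
pose m := HB * (2 * n.+1%:R); have m0 : 0 <= m.
  by rewrite mulr_ge0 ?(ltW k2)//; exact: le_trans ler01 HB1.
have [h [C [hp C0 HC]]] := uniform_decay_Beurling hM hA hB Df m0 D.
have dom (x : V) : weight B (2 * n.+1%:R) x * weight B (2 * n.+1%:R) x <= CB * weight B m x.
  by have := HCB _ _ x (ltW k2) (ltW k2); rewrite maxxx.
have [Q Q0 HQ] := piece_value_bd hp n1 C0 CB0 HC dom.
have h2 : 0 < 2 * h by rewrite mulr_gt0.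
exists (2 * h), Q; split; [exact: h2|exact: Q0|] => chi c O Bc v.
have S : smooth chi by have [? []] := (OC_Beurling B hM chi).1 O.
apply: (HQ v chi c S (piecewise_OC O v).1).
apply: (ocb_mono hB (ltW h2) (lexx _) (ler0n R n) _ Bc).
by rewrite ler_nat.
Qed.

Lemma piece_values_Roumieu f : lcs_dual (GS Roumieu M A) f ->
  (forall phi, GS Roumieu M A phi -> decaying_cont Roumieu B (convolution f phi)) ->
  forall h, 0 < h -> exists (N : nat) C, [/\ (1 <= N)%N, 0 <= C & forall chi c, smooth chi ->
    (forall v, GS Roumieu M A (local_piece v chi)) ->
    ocb M B h N%:R^-1 chi c -> forall v, cmod (f (piece v chi)) <= C * c * rate v].
Proof.
move=> Df D h hp; have [CB [HB [CB1 HB1 HCB]]] := @weight_prod R d B hB hB2.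
have CB0 : 0 <= CB by exact: le_trans ler01 CB1.
have HB0 : 0 < HB by exact: lt_le_trans ltr01 HB1.
have h2 : 0 < h / 2 by rewrite divr_gt0.
have [m [C [mp C0 HC]]] := uniform_decay_Roumieu hM hA hB Df h2 D.
have mH : 0 < m / (HB * 2) by rewrite divr_gt0// mulr_gt0.
have [N N1 Nm] := exists_inv_nat mH.
have kp : 0 < N%:R^-1 :> R by rewrite invr_gt0 ltr0n.
have k2 : 0 < 2 * N%:R^-1 :> R by rewrite mulr_gt0.
have dom (x : V) : weight B (2 * N%:R^-1) x * weight B (2 * N%:R^-1) x <= CB * weight B m x.
  have := HCB _ _ x (ltW k2) (ltW k2); rewrite maxxx => E; apply: le_trans E _.
  apply: (ler_wpM2l CB0); apply: (weight_mono x hB); first by rewrite mulr_ge0 ?(ltW HB0) ?(ltW k2).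
  by rewrite mulrA mulrC -ler_pdivlMr// mulr_gt0.
have HC' x phi c : GS Roumieu M A phi -> gsb M A (h / 2) phi c ->
    cmod (convolution f phi x) * weight B m x <= C * c.
  by move=> G; apply: HC; exact: (GS_smooth hM G).
have [Q Q0 HQ] := piece_value_bd h2 kp C0 CB0 HC' dom.
exists N, Q; split; [exact: N1|exact: Q0|] => chi c S G Bc v.
apply: (HQ v chi c S (G v)); rewrite (_ : 2 * (h / 2) = h); last by field.
exact: Bc.
Qed.

Lemma OC_piece_values cl f chi : lcs_dual (GS cl M A) f ->
  (forall phi, GS cl M A phi -> decaying_cont cl B (convolution f phi)) ->
  OC cl M B chi -> exists Q, forall v, cmod (f (piece v chi)) <= Q * rate v.
Proof.
case: cl => Df D O.
  have [n [S H]] := (OC_Beurling B hM chi).1 O.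
  have [h [C [hp C0 HC]]] := piece_values_Beurling Df D n.
  have [c Hc] := H h hp; exists (C * c); exact: HC O Hc.
have [h hp [S H]] := (OC_Roumieu B hM chi).1 O.
have [N [C [N1 C0 HC]]] := piece_values_Roumieu Df D hp.
have [c Hc] := H N N1; exists (C * c); apply: (HC chi c S _ Hc) => v.
exact: (piecewise_OC O v).1.
Qed.

(** The extension is linear and bounded on each step because the values at the
    pieces are bounded by the norm of the step times a summable rate. *)
Lemma in_dual_of_decay cl f : lcs_dual (GS cl M A) f ->
  (forall phi, GS cl M A phi -> decaying_cont cl B (convolution f phi)) ->
  in_lcs_dual (GS cl M A) (OC cl M B) f.
Proof.
move=> Df D; exists (extension f); last first.
  move=> chi G; apply: (extension_GS Df G) => v.
  exact: (piecewise_OC (GS_sub_OC G) v).2.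
have Lext : linear_on (OC cl M B : lcs (cfun R d)) (extension f).
  move=> a chi chi' O O'; have [Q HQ] := OC_piece_values Df D O.
  have [Q' HQ'] := OC_piece_values Df D O'.
  have P v := (piecewise_OC O v).2; have P' v := (piecewise_OC O' v).2.
  exact: (extension_lin Df a P P' HQ HQ').
case: cl Df D Lext => Df D Lext.
  apply/(dual_OC_Beurling hM hB); split; first exact: Lext.
  move=> n; have [h [C [hp C0 HC]]] := piece_values_Beurling Df D n.
  exists h, (2 * 4 ^+ d * C); split; [exact: hp|by rewrite !mulr_ge0 ?exprn_ge0|].
  move=> chi c S K Bc; have O : OC Beurling M B chi by apply: (OC_Beurling B hM _).2; exists n.
  by rewrite -mulrA; exact: (partial_limit (HC chi c O Bc)).2.
apply/(dual_OC_Roumieu hM hB); split; first exact: Lext.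
move=> h hp; have [N [C [N1 C0 HC]]] := piece_values_Roumieu Df D hp.
exists N, (2 * 4 ^+ d * C); split; [exact: N1|by rewrite !mulr_ge0 ?exprn_ge0|].
move=> chi c S K Bc; have O : OC Roumieu M B chi by apply: (OC_Roumieu B hM _).2; exists h.
rewrite -mulrA; apply: (partial_limit (HC chi c S _ Bc)).2 => v.
exact: (piecewise_OC O v).1.
Qed.

End Extension.

Theorem corollary4p22 (R : realType) (d : nat) (M A B : nat -> R)
  (hM : weight_sequence M) (hM1 : cond_M1 M) (hM2 : cond_M2 M)
  (hA : weight_sequence A) (hA1 : cond_M1 A) (hA2 : cond_M2 A)
  (hMA : wprec (fun p => p`!%:R) (fun p => M p * A p))
  (hS : exists2 phi : cfun R d, GS Beurling M A phi & phi <> 0)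
  (hB : weight_sequence B) (hB1 : cond_M1 B) (hB2 : cond_M2 B)
  (hAB : wsubset A B)
  (c : gs_class) (f : cfun R d -> R[i]) (hf : lcs_dual (GS c M A) f) :
  (in_lcs_dual (GS c M A) (OC c M B) f <->
     (forall phi : cfun R d, GS c M A phi -> decaying_cont c B (convolution f phi)))
  /\
  ((forall phi : cfun R d, GS c M A phi -> decaying_cont c B (convolution f phi)) <->
     (forall phi : cfun R d, GS c M A phi -> GS c M B (convolution f phi))).
Proof.
have [psi [Gpsi psi1]] := partition_of_unity hM hM1 hA hS.
have i_iii : in_lcs_dual (GS c M A) (OC c M B) f ->
    forall phi : cfun R d, GS c M A phi -> GS c M B (convolution f phi).
  by move=> I phi; exact: (conv_in_GS hM hM2 hA hB hAB hf I).
have iii_ii : (forall phi : cfun R d, GS c M A phi -> GS c M B (convolution f phi)) ->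
    forall phi : cfun R d, GS c M A phi -> decaying_cont c B (convolution f phi).
  by move=> H phi /H; exact: (GS_decaying_cont hM hB).
have ii_i := in_dual_of_decay hM hM1 hA hA2 hB hAB Gpsi psi1 hB2 hf.
split; split=> H.
- exact: iii_ii (i_iii H).
- exact: ii_i H.
- exact: i_iii (ii_i H).
- exact: iii_ii H.
Qed.
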